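(* Assume $\rho<1$. Let $a(w)=\sum_{|\gamma|\le m}c_\gamma w^\gamma$ be a real-valued elliptic Shubin polynomial on $\mathbb R^{2d}$ of degree $m\ge 2$ ($m\in\mathbb Z_+$), with principal part $a'(w)=\sum_{|\gamma|=m}c_\gamma w^\gamma$, and assume there is $B_1\ge1$ such that $a(w)>0$ for all $w\in Q^c_{B_1}$. Let $s>1/(1-\rho)$ be such that $M_p\subset p!^s$ in the Beurling case and $M_p\prec p!^s$ in the Roumieu case. Let $(\widehat M_n)_{n\in\mathbb N}$ be positive numbers with $\widehat M_0=1$ for which there is $C_0\ge1$ with $$C_0^{n-k}\frac{\widehat M_n}{(nm)!^s}\ge\frac{\widehat M_k}{(km)!^s}\quad\text{for all } n,k\in\mathbb N,\ n\ge k,$$ and let $P(\lambda)=\sum_{n=0}^\infty \lambda^n/\widehat M_n$, $\lambda\in\mathbb R$. Then: (i) the functions $w\mapsto P(|a(w)|)$ and $w\mapsto P(|a'(w)|)$, $\mathbb R^{2d}\to[0,\infty)$, are continuous and of ultrapolynomial growth of class $*$; (ii) the series $\sum_{n=0}^\infty a^{(\# n)}(w)/\widehat M_n$, $\sum_{n=0}^\infty (a(w))^n/\widehat M_n$ and $\sum_{n=0}^\infty (a'(w))^n/\widehat M_n$ converge absolutely in $\Gamma^{*,\infty}_{A_p,1}(\mathbb R^{2d})$; (iii) there exist $C>1$ and $B>0$ such that for all $w\in Q^c_B$ and $\gamma\in\mathbb N^{2d}$, $$\Big|\sum_{n=0}^\infty\frac{D^\gamma_w a^{(\# n)}(w)}{\widehat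 M_n}\Big|\le\frac{C^{|\gamma|+1}P(a(w))}{\langle w\rangle^{\rho|\gamma|}},\qquad |D^\gamma_w P(a(w))|\le \frac{C^{|\gamma|+1}P(a(w))}{\langle w\rangle^{\rho|\gamma|}},$$ $$\Big|D^\gamma_w\Big(P(a(w))-\sum_{n=0}^\infty\frac{a^{(\# n)}(w)}{\widehat M_n}\Big)\Big|\le\frac{C^{|\gamma|+1}P(a(w))}{\langle w\rangle^{\rho(|\gamma|+2)}};$$ in particular the symbols $\sum_{n=0}^\infty a^{(\# n)}/\widehat M_n$ and $P\circ a=\sum_{n=0}^\infty a^n/\widehat M_n$ are $\Gamma^{*,\infty}_{A_p,\rho}$-hypoelliptic; (iv) there exist $C>1$ and $B>0$ such that for all $w\in Q^c_B$ and $\gamma\in\mathbb N^{2d}$, $$|D^\gamma_w P(a'(w))|\le\frac{C^{|\gamma|+1}P(a'(w))}{\langle w\rangle^{\rho|\gamma|}},\qquad \Big|D^\gamma_w\Big(P(a'(w))-\sum_{n=0}^\infty\frac{a^{(\# n)}(w)}{\widehat M_n}\Big)\Big|\le\frac{C^{|\gamma|+1}P(a'(w))}{\langle w\rangle^{\rho(|\gamma|+1)}};$$ in particular $P\circ a'=\sum_{n=0}^\infty (a')^n/\widehat M_n$ is $\Gamma^{*,\infty}_{A_p,\rho}$-hypoelliptic.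
   Context: Weight sequences: for a sequence $(N_p)_{p\in\mathbb N}$ of positive numbers with $N_0=1$ consider the conditions (M.1) $N_p^2\le N_{p-1}N_{p+1}$, $p\ge1$; (M.2) there are $c_0,H\ge1$ with $N_p\le c_0H^p\min_{0\le q\le p}N_qN_{p-q}$; (M.3) there is $c_0>0$ with $\sum_{q>p}N_{q-1}/N_q\le c_0pN_p/N_{p+1}$; (M.3)' $\sum_{p\ge1}N_{p-1}/N_p<\infty$; (M.4) $(N_p/p!)^2\le (N_{p-1}/(p-1)!)(N_{p+1}/(p+1)!)$, $p\ge1$. Write $N_\alpha=N_{|\alpha|}$ for multi-indices, and $N(t)=\sup_{p\in\mathbb N}\ln_+(t^p/N_p)$, $t>0$, for the associated function. $N_p\subset L_p$ means $N_p\le CL^pL_p$ for some $C,L>0$ and all $p$; $N_p\prec L_p$ means that for every $L>0$ there is $C>0$ with this inequality. Standing assumptions: $A_p,M_p$ are weight sequences with $A_0=A_1=M_0=M_1=1$, $M_p$ satisfies (M.1),(M.2),(M.3), $A_p$ satisfies (M.1),(M.2),(M.3)',(M.4), $A_p\subset M_p$; $\rho_0=\inf\{r>0: A_p\subset M_p^r\}$ and $\rho$ is fixed with $\rho_0\le\rho\le1$ if the infimum is attained, $\rho_0<\rho\le1$ otherwise. The symbol $*$ denotes either the Beurling case $(M_p)$ or the Roumieu case $\{M_p\}$; in ''A (resp. B)'' formulations, A is the Beurling and B the Roumieu version. $\langle w\rangle=(1+|w|^2)^{1/2}$, $D^\alpha=i^{-|\alpha|}\partial^\alpha$. A measurable function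 $g$ has ultrapolynomial growth of class $(M_p)$ (resp. $\{M_p\}$) if $\sup_w|g(w)|e^{-M(h|w|)}<\infty$ for some $h>0$ (resp. for every $h>0$). Symbol classes: for $0<r\le1$ and $h,m>0$, $\Gamma^{M_p,\infty}_{A_p,r}(\mathbb R^{2d};h,m)$ is the Banach space of $a\in C^\infty(\mathbb R^{2d})$ with finite norm $\sup_{\alpha,\beta\in\mathbb N^d}\sup_{(x,\xi)}|D^\alpha_\xi D^\beta_xa(x,\xi)|\langle(x,\xi)\rangle^{r(|\alpha|+|\beta|)}e^{-M(m|\xi|)-M(m|x|)}/(h^{|\alpha|+|\beta|}A_\alpha A_\beta)$; $\Gamma^{(M_p),\infty}_{A_p,r}(\mathbb R^{2d})=\varinjlim_{m\to\infty}\varprojlim_{h\to0}\Gamma^{M_p,\infty}_{A_p,r}(\mathbb R^{2d};h,m)$ and $\Gamma^{\{M_p\},\infty}_{A_p,r}(\mathbb R^{2d})=\varinjlim_{h\to\infty}\varprojlim_{m\to0}\Gamma^{M_p,\infty}_{A_p,r}(\mathbb R^{2d};h,m)$ (locally convex limits). For $t\ge0$, $Q_t=\{(x,\xi)\in\mathbb R^{2d}:\langle x\rangle<t,\langle\xi\rangle<t\}$, $Q_t^c=\mathbb R^{2d}\setminus Q_t$. A symbol $a\in\Gamma^{*,\infty}_{A_p,\rho}(\mathbb R^{2d})$ is $\Gamma^{*,\infty}_{A_p,\rho}$-hypoelliptic if there is $B>0$ such that: there are $c,m>0$ (resp. for every $m>0$ there is $c>0$) with $|a(x,\xi)|\ge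 ce^{-M(m|x|)-M(m|\xi|)}$ on $Q_B^c$; and for every $h>0$ there is $C>0$ (resp. there are $h,C>0$) with $|D^\alpha_\xi D^\beta_xa(x,\xi)|\le Ch^{|\alpha|+|\beta|}A_\alpha A_\beta|a(x,\xi)|\langle(x,\xi)\rangle^{-\rho(|\alpha|+|\beta|)}$ for all $\alpha,\beta\in\mathbb N^d$, $(x,\xi)\in Q_B^c$. A polynomial $a(w)=\sum_{|\gamma|\le m}c_\gamma w^\gamma$ of degree $m$ on $\mathbb R^{2d}$ is an elliptic Shubin polynomial if its principal part $a'(w)=\sum_{|\gamma|=m}c_\gamma w^\gamma$ does not vanish for $w\neq0$. Sharp product: for formal sums $\sum_ja_j,\sum_jb_j$ of smooth functions, $\sum_ja_j\#\sum_jb_j=\sum_jc_j$ with $c_j(x,\xi)=\sum_{s+k+l=j}\sum_{|\alpha+\beta|=l}\frac{(-1)^{|\beta|}}{\alpha!\beta!2^l}\partial^\alpha_\xi D^\beta_xa_s(x,\xi)\,\partial^\beta_\xi D^\alpha_xb_k(x,\xi)$; a single symbol $a$ is identified with the formal sum $a+0+0+\cdots$. This product is associative; $a^{\#1}=a$ and $a^{\#n}=a^{\#(n-1)}\#a$, and $(\cdot)_k$ denotes the $k$-th term of a formal sum. For a polynomial $a$, $a^{(\#n)}:=\sum_{k\ge0}(a^{\#n})_k$ (a finite sum, hence a polynomial) for $n\ge1$, and $a^{(\#0)}:=1$. *)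

(* Defs.v *)
From HB Require Import structures.
From mathcomp Require Import all_boot all_order all_algebra.
From mathcomp Require Import all_classical all_reals all_analysis.
From mathcomp Require Export complex.
Set Implicit Arguments. Unset Strict Implicit. Unset Printing Implicit Defensive.
Import Order.TTheory GRing.Theory Num.Theory.
Import numFieldNormedType.Exports.
Local Open Scope ring_scope.
Local Open Scope classical_set_scope.
Local Open Scope complex_scope.

Section Defs.
Variable R : realType.

Definition reC (z : R[i]) : R := complex.Re z.
Definition imC (z : R[i]) : R := complex.Im z.
Definition cabs (z : R[i]) : R := Normc.normc z.
Definition csum (u : nat -> R[i]) : R[i] :=
  (limn (series (fun n => reC (u n)))) +i* (limn (series (fun n => imC (u n)))).

Definition weight_seq (N : nat -> R) : Prop :=
  N 0%N = 1 /\ forall p, 0 < N p.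

Definition cond_M1 (N : nat -> R) : Prop :=
  forall p, (1 <= p)%N -> N p ^+ 2 <= N p.-1 * N p.+1.

Definition cond_M2 (N : nat -> R) : Prop :=
  exists c0 H : R, 1 <= c0 /\ 1 <= H /\
    forall p q, (q <= p)%N -> N p <= c0 * H ^+ p * (N q * N (p - q)%N).

(* sum_{q>p} N_{q-1}/N_q <= c0 p N_p/N_{p+1}  (p >= 1); the series has
   nonnegative terms, so this is expressed on all partial sums *)
Definition cond_M3 (N : nat -> R) : Prop :=
  exists c0 : R, 0 < c0 /\
    forall p, (1 <= p)%N -> forall n,
      \sum_(p.+1 <= q < n) N q.-1 / N q <= c0 * p%:R * N p / N p.+1.

(* sum_{p>=1} N_{p-1}/N_p < oo (nonnegative terms) *)
Definition cond_M3' (N : nat -> R) : Prop :=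
  exists B : R, forall n, \sum_(1 <= p < n) N p.-1 / N p <= B.

Definition cond_M4 (N : nat -> R) : Prop :=
  forall p, (1 <= p)%N ->
    (N p / (p`!)%:R) ^+ 2 <= (N p.-1 / (p.-1`!)%:R) * (N p.+1 / (p.+1`!)%:R).

Definition lnp (x : R) : R := Num.max 0 (ln x).

Definition assoc_fun (N : nat -> R) (t : R) : R :=
  sup (range (fun p : nat => lnp (t ^+ p / N p))).

Definition wsub (N L : nat -> R) : Prop :=
  exists C L0 : R, 0 < C /\ 0 < L0 /\ forall p, N p <= C * L0 ^+ p * L p.

Definition wprec (N L : nat -> R) : Prop :=
  forall L0 : R, 0 < L0 -> exists C : R, 0 < C /\
    forall p, N p <= C * L0 ^+ p * L p.

Definition rho_set (A M : nat -> R) : set R :=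
  [set r : R | 0 < r /\ wsub A (fun p => M p `^ r)].
Definition rho0 (A M : nat -> R) : R := inf (rho_set A M).

Definition rho_admissible (A M : nat -> R) (rho : R) : Prop :=
  (rho_set A M (rho0 A M) /\ rho0 A M <= rho /\ rho <= 1) \/
  (~ rho_set A M (rho0 A M) /\ rho0 A M < rho /\ rho <= 1).

Definition standing (A M : nat -> R) (rho : R) : Prop :=
  weight_seq A /\ weight_seq M /\ A 1%N = 1 /\ M 1%N = 1 /\
  cond_M1 M /\ cond_M2 M /\ cond_M3 M /\
  cond_M1 A /\ cond_M2 A /\ cond_M3' A /\ cond_M4 A /\ wsub A M /\
  rho_admissible A M rho.

Definition enorm n (w : 'rV[R]_n) : R := Num.sqrt (\sum_(i < n) w ord0 i ^+ 2).
Definition japan n (w : 'rV[R]_n) : R := Num.sqrt (1 + enorm w ^+ 2).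

Definition mabs n (g : 'I_n -> nat) : nat := (\sum_(i < n) g i)%N.
Definition mfact n (g : 'I_n -> nat) : nat := (\prod_(i < n) (g i)`!)%N.

Definition xpart d (w : 'rV[R]_(d + d)) : 'rV[R]_d := lsubmx w.
Definition xipart d (w : 'rV[R]_(d + d)) : 'rV[R]_d := rsubmx w.

(* multi-index (beta, alpha) on R^{2d}: beta acts on x, alpha on xi *)
Definition mjoin d (beta alpha : 'I_d -> nat) : 'I_(d + d) -> nat :=
  fun i => match fintype.split i with inl j => beta j | inr j => alpha j end.

Definition pdr n (i : 'I_n) (f : 'rV[R]_n -> R) : 'rV[R]_n -> R :=
  fun w => 'D_(delta_mx 0 i) f w.
Definition pdrn n (i : 'I_n) (k : nat) (f : 'rV[R]_n -> R) := iter k (pdr i) f.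
Definition pdr_mi n (g : 'I_n -> nat) (f : 'rV[R]_n -> R) : 'rV[R]_n -> R :=
  foldr (fun i h => pdrn i (g i) h) f (enum 'I_n).
Definition pdc n (g : 'I_n -> nat) (f : 'rV[R]_n -> R[i]) : 'rV[R]_n -> R[i] :=
  fun w => (pdr_mi g (fun v => reC (f v)) w) +i* (pdr_mi g (fun v => imC (f v)) w).
Definition Dc n (g : 'I_n -> nat) (f : 'rV[R]_n -> R[i]) : 'rV[R]_n -> R[i] :=
  fun w => 'i ^- (mabs g) * pdc g f w.

Definition Dx d (beta : 'I_d -> nat) (f : 'rV[R]_(d + d) -> R[i]) :=
  Dc (mjoin beta (fun _ => 0%N)) f.
Definition Dxi d (alpha : 'I_d -> nat) (f : 'rV[R]_(d + d) -> R[i]) :=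
  Dc (mjoin (fun _ => 0%N) alpha) f.
Definition pxi d (alpha : 'I_d -> nat) (f : 'rV[R]_(d + d) -> R[i]) :=
  pdc (mjoin (fun _ => 0%N) alpha) f.

Definition smooth_r n (f : 'rV[R]_n -> R) : Prop :=
  forall (g : 'I_n -> nat) (w : 'rV[R]_n), differentiable (pdr_mi g f) w.
Definition smooth n (f : 'rV[R]_n -> R[i]) : Prop :=
  smooth_r (fun v => reC (f v)) /\ smooth_r (fun v => imC (f v)).

(* gbound ... f C : the norm of f in Gamma(h,m) is <= C *)
Definition gbound d (A M : nat -> R) (r h m : R)
    (f : 'rV[R]_(d + d) -> R[i]) (C : R) : Prop :=
  forall (alpha beta : 'I_d -> nat) (w : 'rV[R]_(d + d)),
    cabs (Dxi alpha (Dx beta f) w)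
      * japan w `^ (r * (mabs alpha + mabs beta)%:R)
      * expR (- assoc_fun M (m * enorm (xipart w)) - assoc_fun M (m * enorm (xpart w)))
      / (h ^+ (mabs alpha + mabs beta) * A (mabs alpha) * A (mabs beta)) <= C.

(* beur = true : Beurling case (M_p);  beur = false : Roumieu case {M_p} *)
Definition Gamma (beur : bool) d (A M : nat -> R) (r : R)
    (f : 'rV[R]_(d + d) -> R[i]) : Prop :=
  smooth f /\
  if beur then exists m : R, 0 < m /\ forall h : R, 0 < h -> exists C : R, gbound A M r h m f C
  else exists h : R, 0 < h /\ forall m : R, 0 < m -> exists C : R, gbound A M r h m f C.

Definition is_seminorm n (E : set ('rV[R]_n -> R[i]))
    (q : ('rV[R]_n -> R[i]) -> R) : Prop :=
  (forall f, E f -> 0 <= q f) /\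
  (forall f g, E f -> E g -> q (fun w => f w + g w) <= q f + q g) /\
  (forall (c : R[i]) f, E f -> q (fun w => c * f w) = cabs c * q f).

Definition Gstep_B d (A M : nat -> R) (r m : R) (f : 'rV[R]_(d + d) -> R[i]) :=
  smooth f /\ forall h : R, 0 < h -> exists C : R, gbound A M r h m f C.
Definition Gstep_R d (A M : nat -> R) (r h : R) (f : 'rV[R]_(d + d) -> R[i]) :=
  smooth f /\ forall m : R, 0 < m -> exists C : R, gbound A M r h m f C.

(* continuous seminorms for the locally convex inductive limit topology:
   q is continuous iff its restriction to every step space (a Frechet
   space, projective limit of the Banach spaces Gamma(h,m)) is continuous *)
Definition cont_seminorm (beur : bool) d (A M : nat -> R) (r : R)
    (q : ('rV[R]_(d + d) -> R[i]) -> R) : Prop :=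
  is_seminorm (Gamma beur A M r) q /\
  if beur then
    forall m : R, 0 < m -> exists h C : R, 0 < h /\ 0 <= C /\
      forall f K, Gstep_B A M r m f -> gbound A M r h m f K -> q f <= C * K
  else
    forall h : R, 0 < h -> exists m C : R, 0 < m /\ 0 <= C /\
      forall f K, Gstep_R A M r h f -> gbound A M r h m f K -> q f <= C * K.

Definition fpsum n (u : nat -> 'rV[R]_n -> R[i]) (N : nat) : 'rV[R]_n -> R[i] :=
  fun w => \sum_(k < N) u k w.

Definition abs_conv_Gamma (beur : bool) d (A M : nat -> R) (r : R)
    (u : nat -> 'rV[R]_(d + d) -> R[i]) : Prop :=
  (forall k, Gamma beur A M r (u k)) /\
  (forall q, cont_seminorm beur A M r q ->
     exists B : R, forall N, \sum_(k < N) q (u k) <= B) /\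
  (exists g, Gamma beur A M r g /\
     forall q, cont_seminorm beur A M r q ->
       forall eps : R, 0 < eps -> exists N0, forall N, (N0 <= N)%N ->
         q (fun w => g w - fpsum u N w) < eps).

Definition ultrapoly_growth (beur : bool) n (M : nat -> R) (g : 'rV[R]_n -> R) :=
  if beur then exists h : R, 0 < h /\ exists C : R, forall w,
      `|g w| * expR (- assoc_fun M (h * enorm w)) <= C
  else forall h : R, 0 < h -> exists C : R, forall w,
      `|g w| * expR (- assoc_fun M (h * enorm w)) <= C.

Definition Qc d (t : R) (w : 'rV[R]_(d + d)) : Prop :=
  ~ (japan (xpart w) < t /\ japan (xipart w) < t).

Definition hypoelliptic (beur : bool) d (A M : nat -> R) (rho : R)
    (a : 'rV[R]_(d + d) -> R[i]) : Prop :=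
  Gamma beur A M rho a /\
  exists B : R, 0 < B /\
  let lower c m := forall w, Qc B w ->
      c * expR (- assoc_fun M (m * enorm (xpart w)) - assoc_fun M (m * enorm (xipart w)))
        <= cabs (a w) in
  let upper h C := forall (alpha beta : 'I_d -> nat) w, Qc B w ->
      cabs (Dxi alpha (Dx beta a) w) <=
        C * h ^+ (mabs alpha + mabs beta) * A (mabs alpha) * A (mabs beta)
          * cabs (a w) * japan w `^ (- (rho * (mabs alpha + mabs beta)%:R)) in
  if beur then
    (exists c m : R, 0 < c /\ 0 < m /\ lower c m) /\
    (forall h : R, 0 < h -> exists C : R, 0 < C /\ upper h C)
  else
    (forall m : R, 0 < m -> exists c : R, 0 < c /\ lower c m) /\
    (exists h C : R, 0 < h /\ 0 < C /\ upper h C).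

(* Polynomials on R^n of degree <= m: coefficients c_gamma indexed by
   gamma : 'I_n -> 'I_m.+1, only those with |gamma| <= m are used     *)
Definition mdeg n k (g : {ffun 'I_n -> 'I_k}) : nat := (\sum_(i < n) (g i : nat))%N.

Definition mono n (w : 'rV[R]_n) k (g : {ffun 'I_n -> 'I_k}) : R :=
  \prod_(i < n) w ord0 i ^+ g i.

Definition poly_eval n m (c : {ffun 'I_n -> 'I_m.+1} -> R) (w : 'rV[R]_n) : R :=
  \sum_(g : {ffun 'I_n -> 'I_m.+1} | (mdeg g <= m)%N) c g * mono w g.

Definition poly_princ n m (c : {ffun 'I_n -> 'I_m.+1} -> R) (w : 'rV[R]_n) : R :=
  \sum_(g : {ffun 'I_n -> 'I_m.+1} | mdeg g == m) c g * mono w g.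

Definition elliptic_shubin n m (c : {ffun 'I_n -> 'I_m.+1} -> R) : Prop :=
  forall w : 'rV[R]_n, w != 0 -> poly_princ c w != 0.

Definition fsum d := nat -> 'rV[R]_(d + d) -> R[i].

Definition sharp d (F G : fsum d) : fsum d := fun j w =>
  \sum_(s < j.+1) \sum_(k < (j - s).+1)
    \sum_(al : {ffun 'I_d -> 'I_(j - s - k).+1})
    \sum_(be : {ffun 'I_d -> 'I_(j - s - k).+1}
            | (mabs (fun i => (al i : nat)) + mabs (fun i => (be i : nat)) == j - s - k)%N)
      let alpha := fun i => (al i : nat) in
      let beta := fun i => (be i : nat) in
      (((-1) ^+ mabs beta) / ((mfact alpha * mfact beta * 2 ^ (j - s - k))%N)%:R)
        * pxi alpha (Dx beta (F s)) w * pxi beta (Dx alpha (G k)) w.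

Definition fsingle d (f : 'rV[R]_(d + d) -> R[i]) : fsum d :=
  fun j => if j == 0%N then f else (fun _ => 0).

(* a^{#n} for n >= 1: a^{#1} = a, a^{#n} = a^{#(n-1)} # a *)
Definition sharp_pow d (f : 'rV[R]_(d + d) -> R[i]) (n : nat) : fsum d :=
  iter n.-1 (fun G => sharp G (fsingle f)) (fsingle f).

Definition sharp_powsum d (f : 'rV[R]_(d + d) -> R[i]) (n : nat) : 'rV[R]_(d + d) -> R[i] :=
  if n == 0%N then (fun _ => 1) else (fun w => csum (fun k => sharp_pow f n k w)).

Definition Pser (Mh : nat -> R) (lam : R) : R :=
  limn (series (fun n => lam ^+ n / Mh n)).

End Defs.

(* Main.v *)
(** Count a product of [p] derivatives of [a], of total order [j], as one term of
    type [(p, j)]. On the region where [a] is elliptic such a term is at most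
    [a^p (C / <w>)^j], and it vanishes for [j > p m]. Differentiating a term of
    type [(p, j)] gives [p] terms of type [(p, j + 1)], and one sharp
    multiplication by [a] at order [l] gives at most [(C p)^l] terms, so that
    the derivatives of order [L] of the [k]-th term of [a^{#n}] are bounded by
    [(C n / <w>)^(2k + L) a^n]. The growth condition on [Mh] yields, for the
    terms [t_n = a^n / Mh n], the inequality [t_(n+1) <= t_n (y / (n+1))^(m s)]
    with [y] of order [<w>^(1/s)], whence [sum_n n^K t_n <= (C y)^K P(a)] for
    the exponents [K <= n m] that occur. Every order thus costs
    [<w>^(1/s - 1)], which is at most [<w>^(-rho)]: the terms of order [2k] and
    [L] sum up to [C^(L+1) P(a) <w>^(-rho (L + 2k))]. The passage from [a'] to
    [a = a' + b] is of the same kind, with [b] counted as a term of order 1.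
    On the whole space the same terms are at most
    [(C n / <w>)^j (C <w>^m)^n], and the factorials in [Mh] turn this into
    [L! <w>^(-L) 2^-n e^(M(c <w>))], which gives the convergence statements. *)

Require Import Defs.
From HB Require Import structures.
From mathcomp Require Import all_boot all_order all_algebra.
From mathcomp Require Import all_classical all_reals all_analysis.
From mathcomp Require Import complex ring lra zify.
Set Implicit Arguments. Unset Strict Implicit. Unset Printing Implicit Defensive.
Import Order.TTheory GRing.Theory Num.Theory.
Import numFieldNormedType.Exports.
Local Open Scope ring_scope.
Local Open Scope classical_set_scope.
Local Open Scope complex_scope.

(** * Iterated partial derivatives and products of derivatives *)

(** Seven real series carry the whole proof: [P(a)], [P(a')], the real and imaginary parts of the
    sharp series, and the three errors. All are instances of one scheme, a double family [f p i]
    with [p] factors and total order [i], summed over [e <= i <= p m] and weighted by [1 / Mh p].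
    Removing a leading term only raises the start [e], and [e] comes back as the extra power of
    [<w>^(-rho)]: it is 1 for [P(a) - P(a')] and 2 for the sharp series, whose terms have even
    order. The vanishing of terms of order above [p m] does more than make sums finite. The moment
    estimate descends about [K / (m s)] steps from the index [n], and such a descent stays within
    the natural numbers precisely because only [K <= n m] occurs. A second constraint shapes the
    constants: undifferentiated factors must be bounded by [v = a(w)] itself and not by [C v], as
    [P(C v)] is not controlled by [P(v)]. All losses are therefore moved into the factor [k] paid
    per order. *)

Section PartialDerivatives.
Variables (R : realType) (n : nat).
Implicit Types (f g : 'rV[R]_n -> R) (w : 'rV[R]_n) (i : 'I_n) (l : seq 'I_n).

Definition pders l f : 'rV[R]_n -> R := foldr (fun i h => pdr i h) f l.

Definition everywhere_diff f := forall w, differentiable f w.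

(* Unlike [smooth_r], this allows the partial derivatives in any order. *)
Definition sm f := forall l, everywhere_diff (pders l f).

Lemma pders_cat l1 l2 f : pders (l1 ++ l2) f = pders l1 (pders l2 f).
Proof. by rewrite /pders foldr_cat. Qed.

Lemma sm_pders l f : sm f -> sm (pders l f).
Proof. by move=> sf l'; rewrite -pders_cat; exact: sf. Qed.

Lemma pdrnE i k f : pdrn i k f = pders (nseq k i) f.
Proof. by elim: k => //= k <-. Qed.

Definition mi_seq (g : 'I_n -> nat) : seq 'I_n :=
  flatten [seq nseq (g i) i | i <- enum 'I_n].

Lemma pdr_miE (g : 'I_n -> nat) f : pdr_mi g f = pders (mi_seq g) f.
Proof.
rewrite /pdr_mi /mi_seq; elim: (enum _) => //= i s ->.
by rewrite pders_cat pdrnE.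
Qed.

Lemma size_mi_seq (g : 'I_n -> nat) : size (mi_seq g) = mabs g.
Proof.
rewrite /mi_seq size_flatten /shape -map_comp sumnE big_map /mabs.
by rewrite big_enum; apply: eq_bigr => i _ /=; rewrite size_nseq.
Qed.

Lemma pdr_cst i (c : R) : pdr i (fun=> c) = fun=> 0.
Proof. by apply/funext => w; rewrite /pdr; exact: derive_cst. Qed.

Lemma pdrD i f g : everywhere_diff f -> everywhere_diff g ->
  pdr i (fun w => f w + g w) = fun w => pdr i f w + pdr i g w.
Proof.
by move=> df dg; apply/funext => w; rewrite /pdr; apply: deriveD; exact: diff_derivable.
Qed.

Lemma pdrZ i (c : R) f : everywhere_diff f ->
  pdr i (fun w => c * f w) = fun w => c * pdr i f w.
Proof.
by move=> df; apply/funext => w; rewrite /pdr; apply: deriveZ; exact: diff_derivable.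
Qed.

Lemma pdrM i f g : everywhere_diff f -> everywhere_diff g ->
  pdr i (fun w => f w * g w) = fun w => f w * pdr i g w + g w * pdr i f w.
Proof.
by move=> df dg; apply/funext => w; rewrite /pdr; apply: deriveM; exact: diff_derivable.
Qed.

Lemma pdersD l f g : sm f -> sm g ->
  pders l (fun w => f w + g w) = fun w => pders l f w + pders l g w.
Proof. by move=> sf sg; elim: l => //= i l ->; rewrite pdrD. Qed.

Lemma pdersZ l (c : R) f : sm f ->
  pders l (fun w => c * f w) = fun w => c * pders l f w.
Proof. by move=> sf; elim: l => //= i l ->; rewrite pdrZ. Qed.

Lemma smD f g : sm f -> sm g -> sm (fun w => f w + g w).
Proof. by move=> sf sg l w; rewrite pdersD//; apply: differentiableD; [exact: sf|exact: sg]. Qed.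

Lemma smZ (c : R) f : sm f -> sm (fun w => c * f w).
Proof. by move=> sf l w; rewrite pdersZ//; apply: differentiableZ; exact: sf. Qed.

Lemma pders_cst l (c : R) : pders l (fun=> c) = if l is [::] then fun=> c else fun=> 0.
Proof.
by elim: l => //= i l ->; case: l => [|? ?]; rewrite pdr_cst.
Qed.

Lemma sm_cst (c : R) : sm (fun=> c).
Proof. by move=> l w; rewrite pders_cst; case: l => [|? ?]; exact: differentiable_cst. Qed.

Lemma sm_sum (I : Type) (r : seq I) (P : pred I) (F : I -> 'rV[R]_n -> R) :
  (forall a, sm (F a)) -> sm (fun w => \sum_(a <- r | P a) F a w).
Proof.
move=> sF; elim: r => [|a r IH].
  by under eq_fun do rewrite big_nil; exact: sm_cst.
under eq_fun do rewrite big_cons; case: (P a) => //; exact: smD.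
Qed.

Lemma pders_sum l (I : Type) (r : seq I) (P : pred I) (F : I -> 'rV[R]_n -> R) :
  (forall a, sm (F a)) ->
  pders l (fun w => \sum_(a <- r | P a) F a w) =
  fun w => \sum_(a <- r | P a) pders l (F a) w.
Proof.
move=> sF; elim: r => [|a r IH].
  under eq_fun do rewrite big_nil; rewrite pders_cst; apply/funext => w.
  by rewrite big_nil; case: l.
under eq_fun do rewrite big_cons; under [RHS]eq_fun do rewrite big_cons.
by case: (P a) => //; rewrite pdersD// ?IH//; exact: sm_sum.
Qed.

(* Combinations, with absolute coefficient sum at most [X], of products of
   [p] iterated partial derivatives of functions of [B] and of total order
   [j]; a base function comes with an order [e] of its own. *)
Inductive dmono (B : nat -> ('rV[R]_n -> R) -> Prop) :
    nat -> nat -> R -> ('rV[R]_n -> R) -> Prop :=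
| dmono_base e f l : B e f -> dmono B 1 (e + size l) 1 (pders l f)
| dmono_one : dmono B 0 0 1 (fun=> 1)
| dmono_zero p j : dmono B p j 0 (fun=> 0)
| dmono_mul p j X f p' j' X' g : dmono B p j X f -> dmono B p' j' X' g ->
    dmono B (p + p') (j + j') (X * X') (fun w => f w * g w)
| dmono_add p j X f X' g : dmono B p j X f -> dmono B p j X' g ->
    dmono B p j (X + X') (fun w => f w + g w)
| dmono_scale p j X f c : dmono B p j X f ->
    dmono B p j (`|c| * X) (fun w => c * f w)
| dmono_le p j X X' f : X <= X' -> dmono B p j X f -> dmono B p j X' f.

Section Dmono.
Variable B : nat -> ('rV[R]_n -> R) -> Prop.

Lemma dmono_ge0 p j X f : dmono B p j X f -> 0 <= X.
Proof.
elim=> // {p j X f}.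
- by move=> *; exact: mulr_ge0.
- by move=> *; exact: addr_ge0.
- by move=> *; exact: mulr_ge0.
- by move=> p j X X' f XX' _ X0; exact: le_trans XX'.
Qed.

Lemma dmono_sum (I : Type) (r : seq I) (P : pred I) (F : I -> 'rV[R]_n -> R)
    (X : I -> R) p j : (forall a, P a -> dmono B p j (X a) (F a)) ->
  dmono B p j (\sum_(a <- r | P a) X a) (fun w => \sum_(a <- r | P a) F a w).
Proof.
move=> dF; elim: r => [|a r IH].
  by rewrite big_nil; under [X in dmono _ _ _ _ X]eq_fun do rewrite big_nil; exact: dmono_zero.
rewrite big_cons; under [X in dmono _ _ _ _ X]eq_fun do rewrite big_cons.
by case: ifPn => // Pa; apply: dmono_add => //; exact: dF.
Qed.

Lemma dmono_exp p j X f k : dmono B p j X f ->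
  dmono B (k * p) (k * j) (X ^+ k) (fun w => f w ^+ k).
Proof.
move=> df; elim: k => [|k IH]; first exact: dmono_one.
rewrite exprS !mulSn; under [X in dmono _ _ _ _ X]eq_fun do rewrite exprS; exact: dmono_mul.
Qed.

(** The vanishing part is a pigeonhole argument: in a product of [p] factors of total order above
    [p m], some factor has order above [m]. *)
Lemma dmono_eval p j X f w (v k : R) (m : nat) : 0 <= v -> 0 <= k ->
  (forall e b l, B e b -> `|pders l b w| <= v * k ^+ (e + size l) /\
     ((m < e + size l)%N -> pders l b w = 0)) ->
  dmono B p j X f ->
  `|f w| <= X * v ^+ p * k ^+ j /\ ((p * m < j)%N -> f w = 0).
Proof.
move=> v0 k0 Bw; elim=> {p j X f} [e b l Bb||p j|p j X f p' j' X' g df [f1 f2] dg [g1 g2]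
  |p j X f X' g df [f1 f2] dg [g1 g2]|p j X f c df [f1 f2]|p j X X' f XX' df [f1 f2]].
- by rewrite mul1r expr1 mul1n; exact: Bw.
- by rewrite mul1r !expr0 normr1 mulr1; split => //; rewrite ltn0.
- by rewrite normr0 !mul0r.
- split.
    rewrite normrM.
    have -> : X * X' * v ^+ (p + p') * k ^+ (j + j') =
      (X * v ^+ p * k ^+ j) * (X' * v ^+ p' * k ^+ j') by rewrite !exprD; ring.
    exact: ler_pM.
  rewrite mulnDl => lt; have [/f2 ->|h] := ltnP (p * m) j; first by rewrite mul0r.
  by rewrite g2 ?mulr0//; lia.
- split; last by move=> h; rewrite f2// g2// addr0.
  by rewrite (le_trans (ler_normD _ _))// mulrDl mulrDl lerD.
- split; last by move=> h; rewrite f2// mulr0.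
  by rewrite normrM -!mulrA ler_wpM2l// mulrA.
- split=> //; apply: (le_trans f1).
  by rewrite -!mulrA ler_wpM2r// mulr_ge0// exprn_ge0.
Qed.

Hypothesis smB : forall e b, B e b -> sm b.

Lemma dmono_diff p j X f : dmono B p j X f -> everywhere_diff f.
Proof.
elim=> {p j X f} [e b l Bb w||p j|p j X f p' j' X' g _ df _ dg w
  |p j X f X' g _ df _ dg w|p j X f c _ df w|//].
- exact: (smB Bb l w).
- by move=> w; exact: differentiable_cst.
- by move=> w; exact: differentiable_cst.
- by apply: differentiableM.
- by apply: differentiableD.
- by apply: differentiableZ.
Qed.

Lemma dmono_pdr i p j X f : dmono B p j X f -> dmono B p j.+1 (p%:R * X) (pdr i f).
Proof.
elim=> {p j X f} [e b l Bb||p j|p j X f p' j' X' g df IHf dg IHg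
  |p j X f X' g df IHf dg IHg|p j X f c df IHf|p j X X' f XX' df IHf].
- by rewrite mulr1 -addnS; exact: (dmono_base (i :: l)).
- by rewrite pdr_cst mul0r; exact: dmono_zero.
- by rewrite pdr_cst mulr0; exact: dmono_zero.
- rewrite pdrM; [|exact: dmono_diff df|exact: dmono_diff dg].
  have -> : (p + p')%:R * (X * X') = X * (p'%:R * X') + X' * (p%:R * X).
    by rewrite natrD; ring.
  apply: dmono_add; first by rewrite -addnS; exact: dmono_mul.
  by rewrite [(p + p')%N]addnC [(j + j')%N]addnC -addnS; exact: dmono_mul.
- rewrite pdrD; [|exact: dmono_diff df|exact: dmono_diff dg].
  by rewrite mulrDr; exact: dmono_add.
- rewrite pdrZ; last exact: dmono_diff df.
  by rewrite mulrCA; exact: dmono_scale.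
- by apply: dmono_le IHf; rewrite ler_wpM2l.
Qed.

Lemma dmono_pders l p j X f : dmono B p j X f ->
  dmono B p (j + size l) (p%:R ^+ size l * X) (pders l f).
Proof.
move=> df; elim: l => [|i l IH] /=; first by rewrite addn0 mul1r.
by rewrite addnS exprS -mulrA; exact: dmono_pdr.
Qed.

Lemma dmono_sm p j X f : dmono B p j X f -> sm f.
Proof. by move=> df l; apply: dmono_diff; exact: dmono_pders df. Qed.

End Dmono.

End PartialDerivatives.

(** * Termwise differentiation of series *)

Section Series.
Variable R : realType.
Implicit Types (x y : nat -> R) (B K : R).

Lemma series_bounded x B : (forall N, \sum_(0 <= n < N) `|x n| <= B) ->
  cvgn (series x) /\ `|limn (series x)| <= B.
Proof.
move=> xB.
have cx : cvgn [normed series x].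
  apply: nondecreasing_is_cvgn.
    by apply: (@nondecreasing_series _ (fun n => `|x n|)) => // n _ _; exact: normr_ge0.
  by exists B => _ [N _ <-]; exact: xB.
split; first exact: (@normed_cvg _ R^o).
apply: (le_trans (@lim_series_norm _ R^o _ cx)).
by apply: limr_le => //; near=> N; exact: xB.
Unshelve. all: by end_near. Qed.

Lemma sum_half_pow N M : \sum_(N <= n < M) (2 ^- n : R) <= 2 * 2 ^- N.
Proof.
have [MN|NM] := leqP M N.
  by rewrite big_geq// mulr_ge0// invr_ge0 exprn_ge0.
suff : \sum_(N <= n < M) (2 ^- n : R) = 2 * 2 ^- N - 2 * 2 ^- M.
  by move=> ->; rewrite gerBl mulr_ge0// invr_ge0 exprn_ge0.
rewrite -(subnKC (ltnW NM)); elim: (M - N)%N => [|k IH].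
  by rewrite addn0 big_geq// subrr.
rewrite addnS big_nat_recr ?leq_addr//= IH exprS.
have : (2 : R) ^+ (N + k) != 0 by rewrite expf_neq0.
move=> h; rewrite invfM mulrA divff// mul1r.
by ring.
Qed.

Lemma half_bound x K : (forall n, `|x n| <= K * 2 ^- n) ->
  forall N M, \sum_(N <= n < M) `|x n| <= K * 2 * 2 ^- N.
Proof.
move=> xK N M; apply: (@le_trans _ _ (\sum_(N <= n < M) K * 2 ^- n)).
  exact: ler_sum.
rewrite -mulr_sumr -mulrA ler_wpM2l ?sum_half_pow//.
by have := xK 0%N; rewrite expr0 invr1 mulr1; exact: le_trans.
Qed.

Lemma half_cvg x K : (forall n, `|x n| <= K * 2 ^- n) ->
  cvgn (series x) /\ `|limn (series x)| <= K * 2.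
Proof.
move=> xK; apply: series_bounded => N.
by have := half_bound xK 0 N; rewrite expr0 invr1 mulr1.
Qed.

Lemma half_tail x K N : (forall n, `|x n| <= K * 2 ^- n) ->
  `|limn (series x) - \sum_(0 <= n < N) x n| <= K * 2 * 2 ^- N.
Proof.
move=> xK; have [cx _] := half_cvg xK.
have -> : limn (series x) - \sum_(0 <= n < N) x n =
    limn (fun M => series x M - \sum_(0 <= n < N) x n).
  by apply/esym/cvg_lim => //; apply: cvgB => //; exact: cvg_cst.
have c2 : cvgn (fun M => series x M - \sum_(0 <= n < N) x n).
  by apply: is_cvgB => //; exact: is_cvg_cst.
rewrite -lim_norm//; apply: limr_le; first exact: is_cvg_norm.
near=> M; have NM : (N <= M)%N by near: M; exact: nbhs_infty_ge.
rewrite /series /= (big_cat_nat _ NM)//= addrAC subrr add0r.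
exact: le_trans (ler_norm_sum _ _ _) (half_bound xK N M).
Unshelve. all: by end_near. Qed.

Lemma series_partial_le x N : (forall n, 0 <= x n) -> cvgn (series x) ->
  \sum_(0 <= n < N) x n <= limn (series x).
Proof.
move=> x0 cx; apply: (nondecreasing_cvgn_le _ cx).
by apply: nondecreasing_series.
Qed.

End Series.

(** * Second order Taylor estimates on balls *)

Section TaylorEstimate.
Variables (R : realType) (n : nat).
Implicit Types (f g : 'rV[R]_n -> R) (w x h : 'rV[R]_n) (i : 'I_n) (l : seq 'I_n).

(** The norm that row vectors carry here is the maximum norm, not the Euclidean [enorm]. *)
Lemma norm_coord w i : `|w 0 i| <= `|w|.
Proof.
have /mapP[j Hj ->] : `|w 0 i| \in [seq `|w p.1 p.2| | p : 'I_1 * 'I_n].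
  by apply/mapP; exists (0, i) => //=; rewrite mem_enum.
by rewrite [leRHS]/Num.norm /= mx_normrE; apply/bigmax_geP; right => /=; exists j.
Qed.

Lemma derive_coords f w h : everywhere_diff f ->
  'D_h f w = \sum_i h 0 i * pdr i f w.
Proof.
move=> df; rewrite deriveE// {1}[h]row_sum_delta linear_sum.
by apply: eq_bigr => i _; rewrite linearZ /pdr deriveE.
Qed.

Lemma mvt_line f w x : everywhere_diff f ->
  exists2 c, 0 <= c <= 1 &
    f x - f w = \sum_i (x - w) 0 i * pdr i f (w + c *: (x - w)).
Proof.
move=> df; set h := x - w; pose phi (t : R) := f (t *: h + w).
(* The difference quotients of [phi] in direction 1 are those of [f] in direction [h], so
   derivability and the derivative transfer by rewriting. *)
have shE (t : R) : (fun s : R => s^-1 *: ((phi \o shift t) (s *: (1 : R)) - phi t)) =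
    (fun s : R => s^-1 *: ((f \o shift (t *: h + w)) (s *: h) - f (t *: h + w))).
  apply/funext => s; rewrite /phi /= scalerDl /GRing.scale /= mulr1.
  by rewrite addrA.
have dphi (t : R) : is_derive t (1 : R) phi (\sum_i h 0 i * pdr i f (t *: h + w)).
  have hd : derivable f (t *: h + w) h by exact: diff_derivable.
  apply: DeriveDef; first by rewrite /derivable shE.
  by rewrite -derive_coords// /derive shE.
have cphi : {within `[(0 : R), 1], continuous phi}.
  apply: continuous_subspaceT => t.
  by apply: differentiable_continuous; apply/derivable1_diffP; case: (dphi t).
have [] := MVT_segment ler01 (fun t _ => dphi t) cphi.
move=> c c01; rewrite subr0 mulr1 /phi scale1r scale0r add0r subrK => E.
by exists c; [rewrite in_itv/= in c01|rewrite E [_ *: h + _]addrC].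
Qed.

Lemma ball_segment w x (r c : R) : `|w| <= r -> `|x| <= r -> 0 <= c <= 1 ->
  `|w + c *: (x - w)| <= r.
Proof.
move=> wr xr /andP[c0 c1].
have -> : w + c *: (x - w) = (1 - c) *: w + c *: x.
  by rewrite scalerBr scalerBl scale1r; rewrite addrCA addrC.
apply: (le_trans (ler_normD _ _)); rewrite !normrZ !ger0_norm ?subr_ge0//.
by have -> : r = (1 - c) * r + c * r by [ring]; rewrite lerD// ler_wpM2l// subr_ge0.
Qed.

Lemma lipschitz_ball f (r b : R) w x : everywhere_diff f ->
  (forall i z, `|z| <= r -> `|pdr i f z| <= b) -> `|w| <= r -> `|x| <= r ->
  `|f x - f w| <= n%:R * b * `|x - w|.
Proof.
move=> df fb wr xr; have [c c01 ->] := mvt_line w x df.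
apply: (le_trans (ler_norm_sum _ _ _)).
apply: (@le_trans _ _ (\sum_(i < n) `|x - w| * b)).
  apply: ler_sum => i _; rewrite normrM ler_pM// ?norm_coord//.
  by apply: fb; exact: ball_segment.
by rewrite sumr_const card_ord -[leLHS]mulr_natl mulrA mulrAC.
Qed.

(** The mean value theorem gives the gradient at an intermediate point, and the Lipschitz bound,
    applied to each partial derivative, moves it back to [w]. *)
Lemma taylor2_ball f (r b : R) w x : sm f ->
  (forall i j z, `|z| <= r -> `|pders [:: i; j] f z| <= b) -> `|w| <= r -> `|x| <= r ->
  `|f x - f w - \sum_i (x - w) 0 i * pdr i f w| <= n%:R ^+ 2 * b * `|x - w| ^+ 2.
Proof.
move=> sf fb wr xr; have [c c01 ->] := mvt_line w x (sf [::]).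
rewrite -sumrB; apply: (le_trans (ler_norm_sum _ _ _)).
apply: (@le_trans _ _ (\sum_(i < n) `|x - w| * (n%:R * b * `|x - w|))).
  apply: ler_sum => i _; rewrite -mulrBr normrM ler_pM ?norm_coord//.
  apply: (le_trans (@lipschitz_ball _ r b _ _ (sf [:: i]) _ wr (ball_segment wr xr c01))).
    by move=> j z; exact: fb.
  have b0 : 0 <= n%:R * b.
    by rewrite mulr_ge0//; exact: le_trans (normr_ge0 _) (fb i i _ wr).
  rewrite ler_wpM2l// addrC addKr normrZ; case/andP: c01 => c0 c1.
  by rewrite ger0_norm// ler_piMl.
by rewrite sumr_const card_ord -[leLHS]mulr_natl le_eqVlt; apply/orP; left; apply/eqP; ring.
Qed.

(** A quadratic remainder is [o(h)], so the differential is zero. This serves for a series minus its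
    expected linear part. *)
Lemma quadratic_diff0 f w (C : R) :
  (forall h, `|h| <= 1 -> `|f (h + w) - f w| <= C * `|h| ^+ 2) ->
  differentiable f w /\ forall i, pdr i f w = 0.
Proof.
move=> fC.
have E : f \o shift w = cst (f w) + (\0 : {linear 'rV[R]_n -> R}) +o_ (0 : 'rV[R]_n) id.
  have N e : 0 < e -> \forall h \near (0 : 'rV[R]_n), `|h| <= e by exact: nbhs0_le.
  apply/(@eqaddoP _ _ _ 'rV[R]_n) => e e0; near=> h.
  rewrite /= ![in leLHS]fctE addr0 /=.
  have h1 : `|h| <= 1 by near: h; exact: (N _ ltr01).
  have h2 : `|h| <= e / (`|C| + 1).
    by near: h; apply: N; rewrite divr_gt0// ltr_wpDl.
  apply: (le_trans (fC h h1)); rewrite expr2 mulrA ler_wpM2r//.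
  apply: (@le_trans _ _ ((`|C| + 1) * `|h|)).
    by rewrite ler_wpM2r// (le_trans (ler_norm _))// lerDl.
  by rewrite mulrC -ler_pdivlMr ?ltr_wpDl.
have c0 : continuous (\0 : 'rV[R]_n -> R) by move=> x; exact: (@cst_continuous 'rV[R]_n R (0 : R) x).
have D0 : 'd f w = (\0 : {linear 'rV[R]_n -> R}) :> ('rV[R]_n -> R).
  exact: diff_unique.
have df : differentiable f w.
  by apply/diff_locallyP; rewrite D0.
by split => // i; rewrite /pdr deriveE// D0.
Unshelve. all: by end_near. Qed.

End TaylorEstimate.

(** * Differentiation of locally summable series *)

Section TermwiseDifferentiation.
Variables (R : realType) (n : nat).
Implicit Types (f g : 'rV[R]_n -> R) (w x h : 'rV[R]_n) (i : 'I_n) (l : seq 'I_n).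

Lemma pdr_coord i j w : pdr i (fun z : 'rV[R]_n => z 0 j) w = (i == j)%:R.
Proof.
have @f : {linear 'rV[R]_n -> R}.
  by exists (fun z : 'rV[R]_n => z 0 j); do 2![eexists]; do ?[constructor];
     rewrite ?mxE// => ? *; rewrite ?mxE//; move=> ?; rewrite !mxE.
rewrite (_ : (fun _ => _) = f) //; rewrite /pdr deriveE.
  by rewrite diff_lin; [rewrite /= mxE eqxx eq_sym|exact: coord_continuous].
exact: differentiable_coord.
Qed.

(** The fixed rate [2^-k], on every ball and for every derivative, makes the notion stable under
    differentiation and the tails explicit. *)
Definition locally_summable (u : nat -> 'rV[R]_n -> R) :=
  (forall k, sm (u k)) /\
  forall l (r : R), exists K : R,
    forall k w, `|w| <= r -> `|pders l (u k) w| <= K * 2 ^- k.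

Definition fseries (u : nat -> 'rV[R]_n -> R) : 'rV[R]_n -> R :=
  fun w => limn (series (fun k => u k w)).

Lemma locally_summable_pders u l :
  locally_summable u -> locally_summable (fun k => pders l (u k)).
Proof.
move=> [su bu]; split=> [k|l' r]; first exact: sm_pders.
by have [K KP] := bu (l' ++ l) r; exists K => k w wr; rewrite -pders_cat KP.
Qed.

Lemma locally_summable_cvg u w : locally_summable u -> cvgn (series (fun k => u k w)).
Proof.
move=> [_ /(_ [::] `|w|)[K KP]].
by apply: (half_cvg (K := K) _).1 => k; apply: (KP k w).
Qed.

(** The expected linear part, with the summed partial derivatives as coefficients, is subtracted.
    The second order Taylor remainders of the summands are at most a constant times [|h|^2 2^-k], so
    the difference is quadratic at [w] and has zero differential there. The radius [|w| + 1]
    contains [w + h] for all [|h| <= 1]. *)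
Lemma fseries_pdr_at u w : locally_summable u ->
  differentiable (fseries u) w /\
  forall i, pdr i (fseries u) w = fseries (fun k => pdr i (u k)) w.
Proof.
move=> lu; have [su bu] := lu; set r := `|w| + 1.
have [b bP] : exists b : 'I_n -> 'I_n -> R, forall i j k z, `|z| <= r ->
    `|pders [:: i; j] (u k) z| <= b i j * 2 ^- k.
  exists (fun i j => projT1 (cid (bu [:: i; j] r))) => i j k z zr.
  by case: cid => /= K; exact.
pose K := \sum_i \sum_j `|b i j|.
have bK i j k z : `|z| <= r -> `|pders [:: i; j] (u k) z| <= K * 2 ^- k.
  move=> zr; apply: (le_trans (bP i j k z zr)).
  rewrite ler_wpM2r ?invr_ge0 ?exprn_ge0//.
  rewrite /K (bigD1 i)//= (bigD1 j)//= (le_trans (ler_norm _))//.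
  by rewrite -addrA lerDl addr_ge0 ?sumr_ge0// => a _; rewrite sumr_ge0.
pose G i := fseries (fun k => pdr i (u k)) w.
pose lin (z : 'rV[R]_n) := \sum_i z 0 i * G i.
have dcoord i : everywhere_diff (fun z : 'rV[R]_n => z 0 i * G i).
  by move=> z; apply: differentiableM; [exact: differentiable_coord|exact: differentiable_cst].
have dlin : everywhere_diff lin.
  move=> z; rewrite /lin.
  rewrite (_ : (fun _ => _) = \sum_i (fun z : 'rV[R]_n => z 0 i * G i)); last first.
    by apply/funext => y; rewrite fct_sumE.
  by apply: differentiable_sum => i; exact: dcoord.
have plin i : pdr i lin w = G i.
  rewrite /lin /pdr.
  rewrite (_ : (fun _ => _) = \sum_i (fun z : 'rV[R]_n => z 0 i * G i)); last first.
    by apply/funext => y; rewrite fct_sumE.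
  rewrite derive_sum; last by move=> j; apply: diff_derivable; exact: dcoord.
  rewrite (bigD1 i)//= big1 => [|j ji]; rewrite -/(pdr i _ w).
    rewrite addr0 (@pdrM _ _ i (fun z : 'rV[R]_n => z 0 i) (fun=> G i)).
    - by rewrite pdr_cst pdr_coord eqxx mulr0 add0r mulr1.
    - by move=> z; exact: differentiable_coord.
    - by move=> z; exact: differentiable_cst.
  rewrite (@pdrM _ _ i (fun z : 'rV[R]_n => z 0 j) (fun=> G j)).
  - by rewrite pdr_cst pdr_coord eq_sym (negbTE ji) !mulr0 addr0.
  - by move=> z; exact: differentiable_coord.
  - by move=> z; exact: differentiable_cst.
pose f' z := fseries u z + (-1) * lin z.
have [df' pf'] : differentiable f' w /\ forall i, pdr i f' w = 0.
  apply: (@quadratic_diff0 _ _ _ _ (n%:R ^+ 2 * K * 2)) => h h1.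
  have cu z : cvgn (series (fun k => u k z)) by exact: locally_summable_cvg.
  have cd i : cvgn (series (fun k => pdr i (u k) w)).
    exact: locally_summable_cvg (locally_summable_pders [:: i] lu).
  pose v k := u k (h + w) - u k w - \sum_i h 0 i * pdr i (u k) w.
  have vK k : `|v k| <= n%:R ^+ 2 * K * `|h| ^+ 2 * 2 ^- k.
    have := @taylor2_ball _ _ (u k) r (K * 2 ^- k) w (h + w) (su k) (fun i j z => bK i j k z).
    rewrite addrK => H; rewrite (le_trans (H _ _))//.
    - by rewrite /r lerDl.
    - by rewrite /r (le_trans (ler_normD _ _))// addrC lerD2l.
    - by rewrite le_eqVlt; apply/orP; left; apply/eqP; ring.
  have [cv /le_trans] := half_cvg vK.
  have -> : limn (series v) = f' (h + w) - f' w; last first.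
    by apply; rewrite le_eqVlt; apply/orP; left; apply/eqP; ring.
  apply/cvg_lim => //.
  have -> : f' (h + w) - f' w = fseries u (h + w) - fseries u w - \sum_i h 0 i * G i.
    rewrite /f' /lin.
    have -> : \sum_i (h + w) 0 i * G i = \sum_i h 0 i * G i + \sum_i w 0 i * G i.
      by rewrite -big_split; apply: eq_bigr => i _ /=; rewrite mxE mulrDl.
    by ring.
  have -> : series v = fun N => series (fun k => u k (h + w)) N -
      series (fun k => u k w) N - \sum_i h 0 i * series (fun k => pdr i (u k) w) N.
    apply/funext => N; rewrite /series /= /v !sumrB; congr (_ - _).
    by rewrite exchange_big /=; apply: eq_bigr => i _; rewrite mulr_sumr.
  apply: cvgB; first by apply: cvgB; exact: cu.
  elim: (index_enum 'I_n) => [|i js IH].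
    by rewrite big_nil; under eq_fun do rewrite big_nil; exact: cvg_cst.
  rewrite big_cons; under eq_fun do rewrite big_cons.
  by apply: cvgD => //; apply: cvgMl_tmp; exact: cd.
have FE : fseries u = fun z => f' z + lin z.
  by apply/funext => z; rewrite /f' mulN1r subrK.
split; first by rewrite FE; apply: differentiableD.
move=> i; rewrite FE /pdr deriveD; [|exact: diff_derivable|exact: diff_derivable].
by rewrite -/(pdr i f' w) pf' add0r -/(pdr i lin w) plin.
Qed.

Lemma fseries_pders u l : locally_summable u ->
  pders l (fseries u) = fseries (fun k => pders l (u k)).
Proof.
move=> lu; elim: l => //= i l ->; apply/funext => w.
by have [_ ->] := fseries_pdr_at w (locally_summable_pders l lu).
Qed.

Lemma fseries_sm u : locally_summable u -> sm (fseries u).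
Proof.
move=> lu l w; rewrite fseries_pders//.
by have [] := fseries_pdr_at w (locally_summable_pders l lu).
Qed.

End TermwiseDifferentiation.

(** * Moments of the coefficient sequence *)

Section Moments.
Variable R : realType.

(** Induction on [n]: [(n + 1)^q <= e n^q] for [q <= n], because [(1 + 1/n)^q <= e^(q/n)]. *)
Lemma ffact_lower (n q : nat) : (q <= n)%N ->
  n%:R ^+ q <= expR 1 ^+ q * (n ^_ q)%:R :> R.
Proof.
elim: n q => [|n IH] [|q] qn //; rewrite ?ffactn0 ?expr0 ?mul1r//.
rewrite ffactSS natrM exprS [expR 1 ^+ _]exprS.
suff h : n.+1%:R ^+ q <= expR 1 * (expR 1 ^+ q * (n ^_ q)%:R) :> R.
  rewrite [leRHS](_ : _ = n.+1%:R * (expR 1 * (expR 1 ^+ q * (n ^_ q)%:R))); last by ring.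
  by rewrite ler_wpM2l.
apply: (@le_trans _ _ (expR 1 * n%:R ^+ q)); last by rewrite ler_wpM2l ?expR_ge0// IH.
case: n qn {IH} => [|n] qn.
  by move: qn; rewrite ltnS leqn0 => /eqP->; rewrite !expr0 mulr1 -expR0 ler_expR.
have n0 : (n.+1%:R : R) != 0 by rewrite pnatr_eq0.
have -> : n.+2%:R = (1 + n.+1%:R^-1) * n.+1%:R :> R.
  by rewrite mulrDl mulVf// mul1r -[n.+2]addn1 natrD.
rewrite exprMn ler_wpM2r ?exprn_ge0//.
apply: (@le_trans _ _ (expR n.+1%:R^-1 ^+ q)).
  by rewrite lerXn2r ?expR_ge1Dx// ?nnegrE ?expR_ge0// addr_ge0// invr_ge0.
rewrite -expRM_natl ler_expR -ler_pdivlMr ?invr_gt0 ?ltr0n// invrK mul1r ler_nat.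
by rewrite -ltnS.
Qed.

Lemma nat_ceil (sg : R) (K : nat) : 0 < sg -> exists q : nat,
  [/\ K%:R <= sg * q%:R, sg * q%:R <= K%:R + sg &
      forall n : nat, K%:R <= sg * n%:R -> (q <= n)%N].
Proof.
move=> sg0.
have ex : exists q : nat, K%:R <= sg * q%:R.
  exists (Num.bound (K%:R / sg)); rewrite mulrC -ler_pdivrMr//.
  by apply/ltW/archi_boundP; rewrite divr_ge0// ltW.
case: (ex_minnP ex) => q Kq qmin; exists q; split => //.
case: q Kq qmin => [|q] Kq qmin; first by rewrite mulr0 addr_ge0// ltW.
have /negP : ~~ (K%:R <= sg * q%:R).
  by apply/negP => /qmin; rewrite ltnn.
by move/negP; rewrite -ltNge => /ltW h; rewrite -natr1 mulrDr mulr1 lerD2r.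
Qed.

Variables (t : nat -> R) (y sg : R).
Hypotheses (t0 : forall n, 0 <= t n) (y1 : 1 <= y) (sg0 : 0 < sg).
Hypothesis tS : forall n, t n.+1 <= t n * (y / n.+1%:R) `^ sg.

Let y0 : 0 < y. Proof. exact: lt_le_trans y1. Qed.

Lemma shift_bound (n q : nat) : (q <= n)%N ->
  t n <= t (n - q) * (y ^+ q / (n ^_ q)%:R) `^ sg.
Proof.
elim: q => [|q IH] qn.
  by rewrite subn0 ffactn0 expr0 divr1 powR1 mulr1.
apply: (le_trans (IH (ltnW qn))).
have -> : (n - q = (n - q.+1).+1)%N by lia.
apply: (@le_trans _ _ (t (n - q.+1) * (y / (n - q.+1).+1%:R) `^ sg * (y ^+ q / (n ^_ q)%:R) `^ sg)).
  by rewrite ler_wpM2r ?powR_ge0.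
rewrite -mulrA ler_wpM2l// -powRM ?divr_ge0 ?exprn_ge0 ?(ltW y0)//.
rewrite ffactnSr natrM; have -> : (n - q = (n - q.+1).+1)%N by lia.
set a := y / _ * _; set b := y ^+ q.+1 / _.
by have -> : a = b by rewrite /a /b invfM exprS; ring.
Qed.

(** The descent costs [expR (sg * q)] and an extra [expR] never above [K + sg <= (1 + sg) K] for
    [K >= 1] in the exponent, that is, this base once for each of the [K] powers. *)
Definition moment_const : R := expR (1 + sg).

(* If [n <= y] then [t n] suffices. If [n > y], go down [q = ceil (K / sg)]
   steps in the recursion [tS]: each step gains about [(y / n) ^ sg]. *)
Lemma moment_pointwise (K : nat) : exists q : nat, forall n : nat,
  K%:R <= sg * n%:R -> (q <= n)%N /\
  n%:R ^+ K * t n <= (moment_const * y) ^+ K * (t n + t (n - q)).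
Proof.
have [q [Kq qK qmin]] := nat_ceil K sg0; exists q => n Kn.
have qn := qmin n Kn; split => //.
have E1 : 1 <= moment_const by rewrite -expR0 ler_expR addr_ge0// ltW.
have [ny|yn] := leP n%:R y.
  apply: (@le_trans _ _ ((moment_const * y) ^+ K * t n)).
    rewrite ler_wpM2r// lerXn2r ?nnegrE ?mulr_ge0 ?expR_ge0 ?(ltW y0)//.
    by rewrite (le_trans ny)// ler_peMl// ltW.
  by rewrite ler_wpM2l ?lerDl// exprn_ge0// mulr_ge0 ?expR_ge0// ltW.
apply: (@le_trans _ _ ((moment_const * y) ^+ K * t (n - q))); last first.
  by rewrite ler_wpM2l ?lerDr// exprn_ge0// mulr_ge0 ?expR_ge0// ltW.
(* For [K = 0] the minimality of [q] gives [q = 0] and nothing is to be shown; only for [K >= 1] can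
   the additive [sg] be absorbed into a multiple of [K]. *)
case: K => [|K] in Kq qK qmin Kn *.
  have -> : q = 0%N by apply/eqP; rewrite -leqn0; apply: qmin; rewrite mulr0.
  by rewrite subn0 !expr0 mul1r.
have n0 : (0 : R) < n%:R by exact: lt_trans yn.
set z := n%:R / y.
have z1 : 1 <= z by rewrite /z ler_pdivlMr// mul1r ltW.
have z0 : 0 < z by exact: lt_le_trans z1.
have nE : n%:R = z * y by rewrite /z divfK// gt_eqF.
apply: (le_trans (ler_wpM2l _ (shift_bound qn))); first by rewrite exprn_ge0 ?ltW.
rewrite mulrCA [leRHS]mulrC ler_wpM2l//.
(* By [ffact_lower] the base is at most [(e / z)^q]. Then [sg * q <= K.+1 + sg] bounds the power of
   [e], and [K.+1 <= sg * q] with [z >= 1] bounds the power of [z]. *)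
have h1 : (y ^+ q / (n ^_ q)%:R) `^ sg <= expR (K.+1%:R + sg) * z ^- K.+1.
  apply: (@le_trans _ _ (((expR 1 / z) ^+ q) `^ sg)).
    have pos : (0 : R) < (n ^_ q)%:R by rewrite ltr0n ffact_gt0.
    apply: ge0_ler_powR; rewrite ?nnegrE; first exact: ltW.
    - by rewrite divr_ge0// exprn_ge0// ltW.
    - by rewrite exprn_ge0// divr_ge0 ?expR_ge0// ltW.
    rewrite ler_pdivrMr// /z invf_div mulrA [expR 1 * y]mulrC -mulrA exprMn.
    rewrite -mulrA; apply: ler_peMr; first by rewrite exprn_ge0// ltW.
    rewrite expr_div_n mulrAC ler_pdivlMr ?exprn_gt0// mul1r.
    exact: ffact_lower.
  have e0 : (0 : R) < expR 1 / z by rewrite divr_gt0 ?expR_gt0.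
  rewrite -powR_mulrn ?(ltW e0)// -powRrM.
  rewrite powRM ?expR_ge0 ?invr_ge0 ?(ltW z0)//.
  apply: ler_pM; rewrite ?powR_ge0//.
    by rewrite -expRM mulrC; rewrite mulr1 ler_expR [q%:R * _]mulrC.
  rewrite -powR_inv1 ?(ltW z0)// -powRrM mulN1r powRN lef_pV2 ?posrE ?exprn_gt0 ?powR_gt0//.
  rewrite -powR_mulrn ?(ltW z0)//; apply: ler_powR => //.
  by rewrite mulrC.
apply: (le_trans (ler_wpM2l _ h1)); first by rewrite exprn_ge0// ltW.
rewrite nE exprMn mulrCA [z ^+ _ * _]mulrC -!mulrA mulrCA.
rewrite [y ^+ _ * (_ * _)]mulrCA.
rewrite divff ?mulr1 ?expf_neq0 ?gt_eqF//.
rewrite exprMn ler_wpM2r ?exprn_ge0 ?(ltW y0)//.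
rewrite /moment_const -expRM_natl ler_expR.
by rewrite -natr1; have := ltW sg0; have := ler0n R K; nra.
Qed.

(** The factor 2 counts the two contributions [t n] and [t (n - q)] of the pointwise estimate, each
    summing to at most [P]. *)
Lemma moment_sum (K N : nat) (P : R) : (forall N, \sum_(0 <= n < N) t n <= P) ->
  \sum_(0 <= n < N | K%:R <= sg * n%:R) n%:R ^+ K * t n <=
  (moment_const * y) ^+ K * (2 * P).
Proof.
move=> tP; have [q qP] := moment_pointwise K.
have E0 : 0 <= (moment_const * y) ^+ K by rewrite exprn_ge0// mulr_ge0 ?expR_ge0// ltW.
apply: (@le_trans _ _ (\sum_(0 <= n < N | (q <= n)%N)
    (moment_const * y) ^+ K * (t n + t (n - q)))).
  rewrite big_mkcond [leRHS]big_mkcond; apply: ler_sum => n _.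
  case: ifPn => [Kn|_]; first by have [-> ?] := qP n Kn.
  by case: ifP => // _; rewrite mulr_ge0// addr_ge0.
rewrite -mulr_sumr ler_wpM2l// big_split/= mulr2n mulrDl !mul1r lerD//.
  apply: le_trans (tP N); rewrite big_mkcond; apply: ler_sum => n _.
  by case: ifP.
apply: le_trans (tP (N - q)%N); rewrite big_mkcond/=.
elim: N => [|N IH]; first by rewrite big_geq// big_geq.
rewrite big_nat_recr//=; case: leqP => qN.
  by rewrite subSn// big_nat_recr//= lerD2r.
by rewrite addr0; have -> : (N.+1 - q = N - q)%N by lia.
Qed.

(* [kap] is the size of a logarithmic derivative, and [x n i] the contribution
   of total order [i + L] to the [n]-th term. *)
Lemma family_sum (x : nat -> nat -> R) (kap : R) (m L e N : nat) (P : R) :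
  0 <= kap -> m%:R <= sg -> moment_const * y * kap <= 2^-1 ->
  (forall n i, `|x n i| <= (kap * n%:R) ^+ (i + L) * t n) ->
  (forall n i, (n * m < i + L)%N -> x n i = 0) ->
  (forall N, \sum_(0 <= n < N) t n <= P) ->
  \sum_(0 <= n < N) `|\sum_(e <= i < (n * m).+1) x n i| <=
    (moment_const * y * kap) ^+ (e + L) * (4 * P).
Proof.
move=> k0 ms th2 xb xz tP; set th := moment_const * y * kap.
have th0 : 0 <= th by rewrite !mulr_ge0 ?expR_ge0 ?(ltW y0).
have P0 : 0 <= P by have := tP 0%N; rewrite big_geq.
(* The inner range depends on [n]; it is enlarged to a common one so that the two sums can be
   exchanged. *)
pose I := (N * m).+1.
have ub n : (n < N)%N -> `|\sum_(e <= i < (n * m).+1) x n i| <= \sum_(e <= i < I) `|x n i|.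
  move=> nN; apply: (le_trans (ler_norm_sum _ _ _)).
  have [eI|Ie] := leqP e (n * m).+1; last first.
    by rewrite big_geq ?(ltnW Ie)// sumr_ge0.
  rewrite [leRHS](@big_cat_nat _ _ _ (n * m).+1)//= ?lerDl ?sumr_ge0//.
  by rewrite ltnS leq_mul2r (ltnW nN) orbT.
apply: (@le_trans _ _ (\sum_(0 <= n < N) \sum_(e <= i < I) `|x n i|)).
  by rewrite big_nat [leRHS]big_nat; apply: ler_sum => n /andP[_ nN]; exact: ub.
rewrite exchange_big/=.
apply: (@le_trans _ _ (\sum_(e <= i < I) th ^+ (i + L) * (2 * P))).
  apply: ler_sum => i _.
  apply: (@le_trans _ _ (kap ^+ (i + L) *
      \sum_(0 <= n < N | (i + L)%:R <= sg * n%:R) n%:R ^+ (i + L) * t n)).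
    rewrite mulr_sumr [leRHS]big_mkcond; apply: ler_sum => n _.
    case: ifPn => [_|]; first by rewrite mulrA -exprMn.
    (* Indices outside the range of [moment_sum] contribute zero: [sg * n < i + L] and [m <= sg]
       give [n * m < i + L]. *)
    rewrite -ltNge => h; rewrite xz ?normr0//.
    rewrite -(ltr_nat R); apply: le_lt_trans h.
    by rewrite natrM mulrC ler_wpM2r.
  apply: (le_trans (ler_wpM2l _ (moment_sum (i + L) N tP))); first exact: exprn_ge0.
  suff -> : kap ^+ (i + L) * ((moment_const * y) ^+ (i + L) * (2 * P)) = th ^+ (i + L) * (2 * P) by [].
  by rewrite /th !exprMn; ring.
rewrite -mulr_suml [_ ^+ (e + L) * _](_ : _ = 2 * th ^+ (e + L) * (2 * P)); last by ring.
rewrite ler_wpM2r ?mulr_ge0//.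
(* As [th <= 1/2], the sum over the orders is geometric and costs another factor 2, whence the 4 in
   the conclusion. *)
apply: (@le_trans _ _ (\sum_(e <= i < I) (th ^+ (e + L) * 2 ^+ e) * 2 ^- i)).
  rewrite big_nat [leRHS]big_nat; apply: ler_sum => i /andP[ei _].
  rewrite -{1}(subnKC ei) -addnA [(i - e + L)%N]addnC addnA exprD.
  rewrite -mulrA ler_wpM2l ?exprn_ge0//.
  have -> : 2 ^+ e * 2 ^- i = 2^-1 ^+ (i - e) :> R.
    by rewrite -{1}(subnKC ei) exprD exprVn invfM mulrA divff ?mul1r// expf_neq0.
  by rewrite lerXn2r// nnegrE invr_ge0.
rewrite -mulr_sumr; apply: (le_trans (ler_wpM2l _ (sum_half_pow _ e I))).
  by rewrite mulr_ge0// exprn_ge0.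
have h : (2 : R) ^+ e != 0 by rewrite expf_neq0.
by rewrite -mulrA [2 ^+ e * _]mulrCA divff// mulr1 mulrC.
Qed.

End Moments.

(** * Weight sequences *)

Section Weights.
Variable R : realType.
Implicit Types (A M : nat -> R).

Lemma bin_le_pow2 (p k : nat) : ('C(p, k) <= 2 ^ p)%N.
Proof.
elim: p k => [|p IH] [|k]; rewrite ?bin0 ?expn_gt0//.
by rewrite binS expnS mul2n -addnn leq_add.
Qed.

Lemma exp_le_fact (X : R) (p : nat) : 0 <= X -> X ^+ p <= expR X * p`!%:R.
Proof.
move=> X0; case: p => [|p]; first by rewrite expr0 mulr1 -expR0 ler_expR.
rewrite -ler_pdivrMr ?ltr0n ?fact_gt0//.
by apply: le_trans (expR_ge1Dxn p X0); rewrite lerDr.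
Qed.

Lemma bernoulli_mixed (S r : R) (n : nat) : 0 <= S -> 0 <= r ->
  n.+1%:R * r * S ^+ n <= (S + r) ^+ n.+1.
Proof.
move=> S0 r0; elim: n => [|n IH]; first by rewrite expr0 mulr1 mul1r expr1 lerDr.
rewrite [(S + r) ^+ _]exprS [(S + r) * _]mulrDl.
have -> : n.+2%:R * r * S ^+ n.+1 = S * (n.+1%:R * r * S ^+ n) + r * S ^+ n.+1.
  by rewrite -[n.+2]addn1 natrD exprS; ring.
by rewrite lerD ?ler_wpM2l// lerXn2r ?nnegrE ?addr_ge0// lerDl.
Qed.

(* [n! * (r_1 * ... * r_n) <= (r_1 + ... + r_n) ^ n] for the ratios
   [r_j = A_(j-1) / A_j], whose product telescopes. *)
Lemma fact_ratio_le A (J n : nat) : (forall p, 0 < A p) ->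
  n`!%:R * (A J / A (J + n)%N) <= (\sum_(J.+1 <= p < (J + n).+1) A p.-1 / A p) ^+ n.
Proof.
move=> A0; elim: n => [|n IH].
  by rewrite expr0 addn0 divff ?gt_eqF// mulr1.
rewrite addnS big_nat_recr/= ?ltnS ?leq_addr//.
set S := \sum_(_ <= _ < _) _.
have S0 : 0 <= S by apply: sumr_ge0 => p _; rewrite divr_ge0// ltW.
have r0 : 0 <= A (J + n)%N / A (J + n).+1 by rewrite divr_ge0// ltW.
apply: le_trans (bernoulli_mixed n S0 r0).
rewrite factS natrM.
have -> : n.+1%:R * n`!%:R * (A J / A (J + n).+1) =
   n.+1%:R * (A (J + n)%N / A (J + n).+1) * (n`!%:R * (A J / A (J + n)%N)).
  have h : A (J + n)%N != 0 by rewrite gt_eqF.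
  have h' : A (J + n).+1 != 0 by rewrite gt_eqF.
  by field; rewrite h h'.
by rewrite ler_wpM2l// mulr_ge0.
Qed.

(** The ratios beyond some [J] sum to at most [h / 2] by (M.3)', so [fact_ratio_le] bounds
    [(p - J)!] by [(h / 2)^(p - J) A_p / A_J]. The loss [2^p] in [p! <= 2^p J! (p - J)!] is what the
    half in [h / 2] pays for. *)
Lemma fact_prec A : weight_seq A -> cond_M3' A ->
  forall h : R, 0 < h -> exists C : R, 0 < C /\
    forall p, p`!%:R <= C * h ^+ p * A p.
Proof.
move=> [_ A0] [B AB] h h0.
pose u n := \sum_(1 <= p < n) A p.-1 / A p.
have r0 p : 0 <= A p.-1 / A p by rewrite divr_ge0// ltW.
have ubu : has_sup (range u).
  split; first by exists (u 0%N); exists 0%N.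
  by exists B => _ [n _ <-]; exact: AB.
have [_ [J _ <-] uJ] := sup_adherent (divr_gt0 h0 (ltr0n R 2)) ubu.
have tail n : \sum_(J.+1 <= p < (J + n).+1) A p.-1 / A p <= h / 2.
  have : u (J + n).+1 <= sup (range u).
    by apply: ub_le_sup; [case: ubu|exists (J + n).+1].
  have -> : u (J + n).+1 = u J.+1 + \sum_(J.+1 <= p < (J + n).+1) A p.-1 / A p.
    by rewrite /u (@big_cat_nat _ _ _ J.+1)//= ltnS leq_addr.
  have : u J <= u J.+1.
    case: (J) => [|J']; first by rewrite /u !big_geq.
    by rewrite /u [leRHS]big_nat_recr//= lerDl; exact: (r0 J'.+1).
  by move: uJ; lra.
(* [C1] collects the factors left over when [p >= J]; [C2] covers the finitely many [p < J]. *)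
pose C1 : R := 2 ^+ J * J`!%:R / (h ^+ J * A J).
pose C2 : R := \sum_(0 <= p < J) p`!%:R / (h ^+ p * A p).
have hA p : 0 < h ^+ p * A p by rewrite mulr_gt0 ?exprn_gt0.
have C10 : 0 < C1 by rewrite divr_gt0// mulr_gt0 ?exprn_gt0 ?ltr0n ?fact_gt0.
have C2t p : 0 <= p`!%:R / (h ^+ p * A p) by rewrite divr_ge0 ?ltW.
have C20 : 0 <= C2 by apply: sumr_ge0 => p _; exact: C2t.
exists (C1 + C2); split; first by rewrite ltr_wpDr.
move=> p; rewrite -mulrA -ler_pdivrMr//.
have [Jp|pJ] := leqP J p; last first.
  apply: (@le_trans _ _ C2); last by rewrite lerDr ltW.
  rewrite /C2 (@big_cat_nat _ _ _ p)//= ?(ltnW pJ)//.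
  by rewrite (big_ltn pJ) addrCA lerDl addr_ge0// sumr_ge0.
apply: (@le_trans _ _ C1); last by rewrite lerDl.
rewrite ler_pdivrMr// -(bin_fact Jp) !natrM.
set n := (p - J)%N; have pE : p = (J + n)%N by rewrite /n subnKC.
apply: (@le_trans _ _ (2 ^+ p * (J`!%:R * n`!%:R))).
  by rewrite ler_wpM2r ?mulr_ge0// -natrX ler_nat bin_le_pow2.
have := fact_ratio_le J n A0; rewrite -pE => H.
have H2 : n`!%:R * (A J / A p) <= (h / 2) ^+ n.
  apply: (le_trans H); rewrite lerXn2r ?nnegrE//.
  - by apply: sumr_ge0.
  - by rewrite divr_ge0// ltW.
  - by rewrite pE; exact: tail.
have H3 : n`!%:R <= (h / 2) ^+ n * A p / A J.
  by rewrite ler_pdivlMr// -ler_pdivrMr// mulrA in H2 *.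
apply: (@le_trans _ _ (2 ^+ p * (J`!%:R * ((h / 2) ^+ n * A p / A J)))).
  by rewrite ler_wpM2l ?exprn_ge0// ler_wpM2l.
have nz : A J != 0 by rewrite gt_eqF.
have nzh : h != 0 by rewrite gt_eqF.
rewrite le_eqVlt; apply/orP; left; apply/eqP.
rewrite /C1 {1 3}pE !exprD expr_div_n.
by field; rewrite ?expf_neq0 ?nz ?nzh ?pnatr_eq0.
Qed.

(** * The associated function of a weight sequence *)

Section AssociatedFunction.
Variable M : nat -> R.
Hypotheses (M0 : forall p, 0 < M p)
  (Mexp : forall t : R, 0 <= t -> exists C, forall p, t ^+ p / M p <= C).

Lemma lnp_ge0 (x : R) : 0 <= lnp x.
Proof. by rewrite /lnp le_max lexx. Qed.

Lemma ler_lnp (x y : R) : x <= y -> lnp x <= lnp y.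
Proof.
move=> xy; have [x0|x0] := leP x 0; first by rewrite {1}/lnp ln0// maxxx lnp_ge0.
rewrite /lnp ge_max !le_max lexx/= orbC ler_ln ?xy// ?posrE//.
exact: lt_le_trans xy.
Qed.

(** Boundedness keeps [assoc_fun] from being the default value of [sup]. *)
Lemma assoc_has_ubound (t : R) : 0 <= t ->
  has_ubound (range (fun p : nat => lnp (t ^+ p / M p))).
Proof.
by move=> /Mexp[C CP]; exists (lnp C) => _ [p _ <-]; exact: ler_lnp.
Qed.

Lemma lnp_le_assoc (t : R) p : 0 <= t -> lnp (t ^+ p / M p) <= assoc_fun M t.
Proof. by move=> t0; apply: ub_le_sup; [exact: assoc_has_ubound|exists p]. Qed.

Lemma assoc_ge0 (t : R) : 0 <= t -> 0 <= assoc_fun M t.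
Proof. by move=> t0; exact: le_trans (lnp_ge0 _) (lnp_le_assoc 0 t0). Qed.

Lemma pow_le_exp_assoc (t : R) p : 0 <= t -> t ^+ p / M p <= expR (assoc_fun M t).
Proof.
move=> t0; have [x0|x0] := leP (t ^+ p / M p) 0.
  by rewrite (le_trans x0)// expR_ge0.
rewrite -{1}[t ^+ p / M p]lnK ?posrE// ler_expR.
by apply: le_trans (lnp_le_assoc p t0); rewrite /lnp le_max lexx orbT.
Qed.

Lemma ler_assoc (t t' : R) : 0 <= t -> t <= t' -> assoc_fun M t <= assoc_fun M t'.
Proof.
move=> t0 tt'; have t'0 := le_trans t0 tt'.
apply: ge_sup; first by exists (lnp (t ^+ 0 / M 0%N)); exists 0%N.
move=> _ [p _ <-]; apply: le_trans (lnp_le_assoc p t'0).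
by apply: ler_lnp; rewrite ler_wpM2r ?invr_ge0 ?(ltW (M0 p))// lerXn2r.
Qed.

(** One of [3 a], [3 b], [3 c] is at least [t]; monotonicity applies to that one and the other two
    terms are nonnegative. This splits [M(L <w>)] into weights in [x] and [xi] and a constant. *)
Lemma assoc_le_sum (t a b c : R) : 0 <= t -> 0 <= a -> 0 <= b -> 0 <= c ->
  t <= a + b + c -> assoc_fun M t <= assoc_fun M (3 * a) + assoc_fun M (3 * b) + assoc_fun M (3 * c).
Proof.
move=> t0 a0 b0 c0 tabc.
have A0 := @assoc_ge0 (3 * a) (mulr_ge0 (ler0n _ _) a0).
have B0 := @assoc_ge0 (3 * b) (mulr_ge0 (ler0n _ _) b0).
have C0 := @assoc_ge0 (3 * c) (mulr_ge0 (ler0n _ _) c0).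
have [ta|ta] := leP t (3 * a); first by have := ler_assoc t0 ta; lra.
have [tb|tb] := leP t (3 * b); first by have := ler_assoc t0 tb; lra.
have [tc|tc] := leP t (3 * c); first by have := ler_assoc t0 tc; lra.
lra.
Qed.

End AssociatedFunction.

Section Norms.
Variable n : nat.
Implicit Types w : 'rV[R]_n.

Lemma enorm_ge0 w : 0 <= enorm w. Proof. exact: sqrtr_ge0. Qed.

Lemma enorm_sqr w : enorm w ^+ 2 = \sum_(i < n) w ord0 i ^+ 2.
Proof. by rewrite sqr_sqrtr// sumr_ge0// => i _; exact: sqr_ge0. Qed.

Lemma japan_sqr w : japan w ^+ 2 = 1 + enorm w ^+ 2.
Proof. by rewrite sqr_sqrtr// addr_ge0// sqr_ge0. Qed.

Lemma japan_ge1 w : 1 <= japan w.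
Proof.
rewrite -[leLHS]sqrtr1 ler_sqrt ?lerDl ?sqr_ge0//.
by rewrite addr_ge0// sqr_ge0.
Qed.

Lemma japan_gt0 w : 0 < japan w. Proof. exact: lt_le_trans (japan_ge1 w). Qed.

Lemma japan_le w : japan w <= 1 + enorm w.
Proof.
have e0 := enorm_ge0 w; rewrite -(@ler_pXn2r _ 2)// ?nnegrE ?(ltW (japan_gt0 w)) ?addr_ge0//.
by rewrite japan_sqr; nra.
Qed.

Lemma enorm_le_japan w : enorm w <= japan w.
Proof.
rewrite -(@ler_pXn2r _ 2)// ?nnegrE ?(ltW (japan_gt0 w)) ?enorm_ge0//.
by rewrite japan_sqr lerDr.
Qed.

Lemma coord_le_enorm w i : `|w 0 i| <= enorm w.
Proof.
rewrite -(@ler_pXn2r _ 2)// ?nnegrE ?enorm_ge0// enorm_sqr real_normK ?num_real//.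
by rewrite (bigD1 i)//= lerDl sumr_ge0// => j _; exact: sqr_ge0.
Qed.

Lemma enorm_le_norm w : enorm w <= n%:R * `|w|.
Proof.
rewrite -(@ler_pXn2r _ 2)// ?nnegrE ?enorm_ge0 ?mulr_ge0// enorm_sqr.
apply: (@le_trans _ _ (\sum_(i < n) `|w| ^+ 2)).
  apply: ler_sum => i _; rewrite -[leLHS]real_normK ?num_real//.
  by rewrite lerXn2r ?nnegrE//; exact: norm_coord.
rewrite sumr_const card_ord -[leLHS]mulr_natl exprMn ler_wpM2r ?exprn_ge0//.
by rewrite -natrX ler_nat; case: n => // k; rewrite expnS leq_pmulr.
Qed.

Lemma japan_le_norm w : japan w <= 1 + n%:R * `|w|.
Proof. by apply: (le_trans (japan_le w)); rewrite lerD2l enorm_le_norm. Qed.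

End Norms.

Section PhaseSpace.
Variable d : nat.
Implicit Types w : 'rV[R]_(d + d).

Lemma enorm_split w : enorm w ^+ 2 = enorm (xpart w) ^+ 2 + enorm (xipart w) ^+ 2.
Proof.
rewrite !enorm_sqr big_split_ord /=.
by congr (_ + _); apply: eq_bigr => i _; rewrite mxE.
Qed.

Lemma japan_split w : japan w <= enorm (xipart w) + enorm (xpart w) + 1.
Proof.
have h1 := enorm_ge0 (xpart w); have h2 := enorm_ge0 (xipart w).
rewrite -(@ler_pXn2r _ 2)// ?nnegrE ?(ltW (japan_gt0 w)) ?addr_ge0//.
by rewrite japan_sqr enorm_split; nra.
Qed.

Lemma Qc_japan (B : R) w : Qc B w -> B <= japan w.
Proof.
move=> QB; rewrite leNgt; apply/negP => jB; apply: QB.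
have h1 := enorm_ge0 (xpart w); have h2 := enorm_ge0 (xipart w).
have aux (v : 'rV[R]_d) : enorm v ^+ 2 <= enorm w ^+ 2 -> japan v < B.
  move=> vw; apply: le_lt_trans jB.
  by rewrite -(@ler_pXn2r _ 2)// ?nnegrE ?(ltW (japan_gt0 _))// !japan_sqr lerD2l.
by split; apply: aux; rewrite enorm_split ?lerDl ?lerDr sqr_ge0.
Qed.

Lemma Qc_le (B B' : R) w : B' <= B -> Qc B w -> Qc B' w.
Proof. by move=> BB' QB [h1 h2]; apply: QB; split; exact: lt_le_trans BB'. Qed.

End PhaseSpace.

End Weights.

(** * Complex-valued symbols *)

Section ComplexValues.
Variable R : realType.
Implicit Types (z u : R[i]).

Lemma cabs_ge0 z : 0 <= cabs z.
Proof. by case: z => a b; exact: sqrtr_ge0. Qed.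

Lemma cabsM z u : cabs (z * u) = cabs z * cabs u.
Proof. exact: Normc.normcM. Qed.

Lemma cabsV z : cabs z^-1 = (cabs z)^-1.
Proof. exact: Normc.normcV. Qed.

Lemma cabsi : cabs ('i%R : R[i]) = 1.
Proof. by rewrite -complexiE /cabs /= expr0n/= add0r expr1n sqrtr1. Qed.

Lemma cabs_exp z k : cabs (z ^+ k) = cabs z ^+ k.
Proof.
elim: k => [|k IH]; first by rewrite !expr0 /cabs Normc.normc1.
by rewrite !exprS cabsM IH.
Qed.

Lemma cabs_Vi k : cabs ('i ^- k : R[i]) = 1.
Proof. by rewrite cabsV cabs_exp cabsi expr1n invr1. Qed.

Lemma cabsE z : cabs z = Num.sqrt (reC z ^+ 2 + imC z ^+ 2).
Proof. by case: z. Qed.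

Lemma cabs_le z : cabs z <= `|reC z| + `|imC z|.
Proof.
rewrite -(@ler_pXn2r _ 2)// ?nnegrE ?cabs_ge0 ?addr_ge0//.
rewrite cabsE sqr_sqrtr ?addr_ge0 ?sqr_ge0//.
rewrite -[reC z ^+ 2]real_normK ?num_real// -[imC z ^+ 2]real_normK ?num_real//.
by have := normr_ge0 (reC z); have := normr_ge0 (imC z); nra.
Qed.

Lemma reC_le_cabs z : `|reC z| <= cabs z.
Proof.
rewrite -(@ler_pXn2r _ 2)// ?nnegrE ?cabs_ge0//.
by rewrite cabsE sqr_sqrtr ?addr_ge0 ?sqr_ge0// real_normK ?num_real// lerDl sqr_ge0.
Qed.

Lemma cabsR (x : R) : cabs x%:C = `|x|.
Proof. by rewrite cabsE /= expr0n/= addr0 sqrtr_sqr. Qed.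

Lemma reCM z u : reC (z * u) = reC z * reC u - imC z * imC u.
Proof. by case: z; case: u. Qed.

Lemma imCM z u : imC (z * u) = reC z * imC u + imC z * reC u.
Proof. by case: z; case: u. Qed.

Lemma reCD z u : reC (z + u) = reC z + reC u.
Proof. by case: z; case: u. Qed.

Lemma imCD z u : imC (z + u) = imC z + imC u.
Proof. by case: z; case: u. Qed.

Lemma reC_sum (I : Type) (r : seq I) (P : pred I) (F : I -> R[i]) :
  reC (\sum_(i <- r | P i) F i) = \sum_(i <- r | P i) reC (F i).
Proof. by elim/big_rec2: _ => // i y1 y2 _ <-; rewrite reCD. Qed.

Lemma imC_sum (I : Type) (r : seq I) (P : pred I) (F : I -> R[i]) :
  imC (\sum_(i <- r | P i) F i) = \sum_(i <- r | P i) imC (F i).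
Proof. by elim/big_rec2: _ => // i y1 y2 _ <-; rewrite imCD. Qed.

Lemma complex_eq z u : reC z = reC u -> imC z = imC u -> z = u.
Proof. by case: z; case: u => a b a' b' /= -> ->. Qed.

Lemma csumM z (u : nat -> R[i]) :
  cvgn (series (fun k => reC (u k))) -> cvgn (series (fun k => imC (u k))) ->
  csum (fun k => z * u k) = z * csum u.
Proof.
move=> cr ci; apply: complex_eq; rewrite /csum ?reCM ?imCM /=.
- rewrite -[X in limn X](_ : (fun N => reC z * series (fun k => reC (u k)) N -
     imC z * series (fun k => imC (u k)) N) = _); last first.
    apply/funext => N; rewrite /series /= !mulr_sumr -sumrB.
    by apply: eq_bigr => k _; rewrite reCM.
  by apply/cvg_lim => //; apply: cvgB; apply: cvgMl_tmp.
- rewrite -[X in limn X](_ : (fun N => reC z * series (fun k => imC (u k)) N +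
     imC z * series (fun k => reC (u k)) N) = _); last first.
    apply/funext => N; rewrite /series /= !mulr_sumr -big_split/=.
    by apply: eq_bigr => k _; rewrite imCM.
  by apply/cvg_lim => //; apply: cvgD; apply: cvgMl_tmp.
Qed.

Lemma csum_finite (u : nat -> R[i]) (N : nat) : (forall k, (N <= k)%N -> u k = 0) ->
  csum u = \sum_(0 <= k < N) u k.
Proof.
move=> u0.
have lim0 (x : nat -> R) : (forall k, (N <= k)%N -> x k = 0) ->
    limn (series x) = \sum_(0 <= k < N) x k.
  move=> x0; apply/cvg_lim => //; apply: cvg_near_cst; near=> M.
  have NM : (N <= M)%N by near: M; exact: nbhs_infty_ge.
  rewrite /series /= (big_cat_nat _ NM)//= [X in _ + X]big_nat [X in _ + X]big1 ?addr0//.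
  by move=> k /andP[Nk _]; exact: x0.
apply: complex_eq; rewrite /csum /= ?reC_sum ?imC_sum; apply: lim0 => k Nk.
  by rewrite u0.
by rewrite u0.
Unshelve. all: by end_near. Qed.

End ComplexValues.

Section ComplexDerivatives.
Variables (R : realType) (n : nat).
Implicit Types (f : 'rV[R]_n -> R[i]) (w : 'rV[R]_n) (l : seq 'I_n).

Definition smC f := sm (fun v => reC (f v)) /\ sm (fun v => imC (f v)).

Definition pdersC l f : 'rV[R]_n -> R[i] :=
  fun w => pders l (fun v => reC (f v)) w +i* pders l (fun v => imC (f v)) w.

Lemma pdcE (g : 'I_n -> nat) f : pdc g f = pdersC (mi_seq g) f.
Proof. by rewrite /pdc /pdersC !pdr_miE. Qed.

Lemma smC_smooth f : smC f -> smooth f.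
Proof. by case=> sr si; split=> g w; rewrite pdr_miE; [exact: sr|exact: si]. Qed.

Lemma pdersC_cat l1 l2 f : pdersC (l1 ++ l2) f = pdersC l1 (pdersC l2 f).
Proof. by rewrite /pdersC !pders_cat. Qed.

Lemma smC_pdersC l f : smC f -> smC (pdersC l f).
Proof. by case=> sr si; split; exact: sm_pders. Qed.

Lemma sm_lin2 (a b : R) (f g : 'rV[R]_n -> R) : sm f -> sm g ->
  sm (fun v => a * f v + b * g v).
Proof. by move=> sf sg; apply: (smD (smZ a sf) (smZ b sg)). Qed.

Lemma pders_lin2 l (a b : R) (f g : 'rV[R]_n -> R) : sm f -> sm g ->
  pders l (fun v => a * f v + b * g v) = fun v => a * pders l f v + b * pders l g v.
Proof.
by move=> sf sg; rewrite (pdersD l (smZ a sf) (smZ b sg)) !pdersZ.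
Qed.

Lemma reCM_fun (z : R[i]) f : (fun v => reC (z * f v)) =
  (fun v => reC z * reC (f v) + (- imC z) * imC (f v)).
Proof. by apply/funext => v; rewrite reCM mulNr. Qed.

Lemma imCM_fun (z : R[i]) f : (fun v => imC (z * f v)) =
  (fun v => reC z * imC (f v) + imC z * reC (f v)).
Proof. by apply/funext => v; rewrite imCM. Qed.

Lemma smCM (z : R[i]) f : smC f -> smC (fun v => z * f v).
Proof.
case=> sr si; split; [rewrite reCM_fun|rewrite imCM_fun]; exact: sm_lin2.
Qed.

Lemma pdersCM l (z : R[i]) f : smC f ->
  pdersC l (fun v => z * f v) = fun v => z * pdersC l f v.
Proof.
case=> sr si; apply/funext => w; apply: complex_eq.
  by rewrite reCM /= reCM_fun pders_lin2// mulNr.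
by rewrite imCM /= imCM_fun pders_lin2.
Qed.

Lemma DcE (g : 'I_n -> nat) f : Dc g f = fun w => 'i ^- (mabs g) * pdersC (mi_seq g) f w.
Proof. by rewrite /Dc pdcE. Qed.

Lemma cabs_Dc (g : 'I_n -> nat) f w : cabs (Dc g f w) = cabs (pdersC (mi_seq g) f w).
Proof. by rewrite DcE cabsM cabs_Vi mul1r. Qed.

End ComplexDerivatives.

Section PhaseSpaceDerivatives.
Variables (R : realType) (d : nat).
Implicit Types (f : 'rV[R]_(d + d) -> R[i]) (al be : 'I_d -> nat).

Definition xi_seq al : seq 'I_(d + d) := mi_seq (mjoin (fun=> 0%N) al).
Definition x_seq be : seq 'I_(d + d) := mi_seq (mjoin be (fun=> 0%N)).

Lemma size_xi_seq al : size (xi_seq al) = mabs al.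
Proof.
rewrite size_mi_seq /mabs big_split_ord/= big1 ?add0n => [|i _].
  apply: eq_bigr => i _; rewrite /mjoin.
  by case: fintype.splitP => j /= E; [have := ltn_ord j; rewrite -E; lia|congr al; apply: val_inj => /=; lia].
by rewrite /mjoin; case: fintype.splitP => j //= E; have := ltn_ord i; rewrite E; lia.
Qed.

Lemma size_x_seq be : size (x_seq be) = mabs be.
Proof.
rewrite size_mi_seq /mabs big_split_ord/= [X in (_ + X)%N]big1 ?addn0 => [|i _].
  apply: eq_bigr => i _; rewrite /mjoin.
  by case: fintype.splitP => j /= E; [congr be; apply: val_inj => /=; lia|have := ltn_ord i; rewrite E; lia].
by rewrite /mjoin; case: fintype.splitP => j //= E; have := ltn_ord j; rewrite -E; lia.
Qed.

Lemma DxE be f : Dx be f = fun w => 'i ^- (mabs be) * pdersC (x_seq be) f w.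
Proof. by rewrite /Dx DcE -size_mi_seq size_x_seq. Qed.

Lemma DxiE al f : Dxi al f = fun w => 'i ^- (mabs al) * pdersC (xi_seq al) f w.
Proof. by rewrite /Dxi DcE -size_mi_seq size_xi_seq. Qed.

Lemma pxiE al f : pxi al f = pdersC (xi_seq al) f.
Proof. by rewrite /pxi pdcE. Qed.

Lemma DxiDxE al be f : smC f -> Dxi al (Dx be f) =
  fun w => 'i ^- (mabs al) * ('i ^- (mabs be) * pdersC (xi_seq al ++ x_seq be) f w).
Proof.
move=> sf; rewrite DxiE DxE pdersCM; last exact: smC_pdersC.
by rewrite pdersC_cat.
Qed.

Lemma cabs_DxiDx al be f w : smC f ->
  cabs (Dxi al (Dx be f) w) = cabs (pdersC (xi_seq al ++ x_seq be) f w).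
Proof. by move=> sf; rewrite DxiDxE// !cabsM !cabs_Vi !mul1r. Qed.

Lemma size_xi_x_seq al be : size (xi_seq al ++ x_seq be) = (mabs al + mabs be)%N.
Proof. by rewrite size_cat size_xi_seq size_x_seq. Qed.

End PhaseSpaceDerivatives.

(** * Symbol classes *)

Section SymbolClasses.
Variables (R : realType) (d : nat) (A M : nat -> R) (beur : bool).
Hypotheses (A0 : forall p, 0 < A p)
  (Afact : forall h : R, 0 < h -> exists C : R, 0 < C /\ forall p, p`!%:R <= C * h ^+ p * A p)
  (M0 : forall p, 0 < M p)
  (Mexp : forall t : R, 0 <= t -> exists C, forall p, t ^+ p / M p <= C).
Local Notation V := 'rV[R]_(d + d).
Implicit Types (w : V) (f : V -> R) (F : V -> R[i]) (u : nat -> V -> R) (U : nat -> V -> R[i]).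

(* A factorial bound on the derivatives serves for all [h] at once, because
   [p! <= C_h h^p A_p] for every [h > 0]. *)
Definition symb_bound (L K : R) f := forall l w,
  `|pders l f w| * japan w ^+ size l <= (size l)`!%:R * K * expR (assoc_fun M (L * japan w)).

Lemma symb_bound_ge0 L K f : symb_bound L K f -> 0 <= K.
Proof.
move=> /(_ [::] 0); rewrite expr0 mulr1 mul1r => h.
by have := le_trans (normr_ge0 _) h; rewrite pmulr_lge0// expR_gt0.
Qed.

Lemma symb_bound_mono L L' K K' f : 0 <= L -> L <= L' -> K <= K' ->
  symb_bound L K f -> symb_bound L' K' f.
Proof.
move=> L0 LL' KK' fK l w; apply: (le_trans (fK l w)).
have K0 := symb_bound_ge0 fK; have j0 := ltW (japan_gt0 w).
rewrite ler_pM ?expR_ge0 ?mulr_ge0//; first by rewrite ler_wpM2l.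
by rewrite ler_expR ler_assoc// ?mulr_ge0// ler_wpM2r.
Qed.

(** Since [X^a <= e^X a!] and factorials are below [C h^a A_a] for each [h], geometric factors in
    derivative bounds are harmless for every [h], in both cases. *)
Lemma pow_le_weights (X h : R) : 0 <= X -> 0 < h -> exists C : R, 0 < C /\
  forall a b, X ^+ (a + b) <= C * h ^+ (a + b) * A a * A b.
Proof.
move=> X0 h0; have [C [C0 CP]] := Afact h0.
exists ((expR X * C) ^+ 2); split; first by rewrite exprn_gt0// mulr_gt0 ?expR_gt0.
have one a : X ^+ a <= expR X * C * (h ^+ a * A a).
  apply: (le_trans (exp_le_fact a X0)).
  by rewrite -!mulrA ler_wpM2l ?expR_ge0// mulrA; exact: CP.
move=> a b; have -> : (expR X * C) ^+ 2 * h ^+ (a + b) * A a * A b =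
  (expR X * C * (h ^+ a * A a)) * (expR X * C * (h ^+ b * A b)) by rewrite exprD; ring.
by rewrite exprD ler_pM ?exprn_ge0.
Qed.

Lemma fact_le_weights (h : R) : 0 < h -> exists C : R, 0 < C /\
  forall a b, (a + b)`!%:R <= C * h ^+ (a + b) * A a * A b.
Proof.
move=> h0; have [C [C0 CP]] := Afact (divr_gt0 h0 (ltr0n R 2)).
exists (C ^+ 2); split; first by rewrite exprn_gt0.
move=> a b; apply: (@le_trans _ _ (2 ^+ (a + b) * (a`!%:R * b`!%:R))).
  rewrite -natrX -!natrM ler_nat -{1}(bin_fact (leq_addr b a)) addKn.
  by rewrite leq_mul2r bin_le_pow2 orbT.
apply: (@le_trans _ _ (2 ^+ (a + b) * ((C * (h / 2) ^+ a * A a) * (C * (h / 2) ^+ b * A b)))).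
  by rewrite ler_wpM2l ?exprn_ge0// ler_pM.
rewrite le_eqVlt; apply/orP; left; apply/eqP.
have -> : h ^+ (a + b) = 2 ^+ (a + b) * (h / 2) ^+ (a + b).
  by rewrite -exprMn mulrCA divff ?mulr1.
by rewrite [(h / 2) ^+ (a + b)]exprD; ring.
Qed.

Lemma cabs_pdersC_symb L K F : symb_bound L K (fun v => reC (F v)) ->
  symb_bound L K (fun v => imC (F v)) -> forall l w,
  cabs (pdersC l F w) * japan w ^+ size l <=
    2 * ((size l)`!%:R * K * expR (assoc_fun M (L * japan w))).
Proof.
move=> gr gi l w; have j0 := ltW (japan_gt0 w).
apply: (@le_trans _ _ ((`|reC (pdersC l F w)| + `|imC (pdersC l F w)|) * japan w ^+ size l)).
  by rewrite ler_wpM2r ?exprn_ge0// cabs_le.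
by rewrite mulrDl mulr2n mulrDl mul1r lerD; [|exact: gr|exact: gi].
Qed.

(** The condition [3 L <= m] comes from [assoc_le_sum], and the constant part of that splitting is
    the factor [expR (assoc_fun M m)]. The constant [Cst] does not depend on [F], so the norm is
    linear in [K]; this is what makes seminorms summable later. *)
Lemma symb_gbound (h m : R) : 0 < h -> 0 < m -> exists Cst : R, 0 <= Cst /\
  forall r L K F, r <= 1 -> 0 <= L -> 3 * L <= m -> smC F ->
  symb_bound L K (fun v => reC (F v)) -> symb_bound L K (fun v => imC (F v)) ->
  gbound A M r h m F (K * Cst).
Proof.
move=> h0 m0; have [C [C0 CP]] := fact_le_weights h0.
exists (2 * C * expR (assoc_fun M m)); split.
  by rewrite !mulr_ge0 ?expR_ge0// ltW.
move=> r L K F r1 L0 Lm sF gr gi al be w.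
have K0 := symb_bound_ge0 gr.
rewrite cabs_DxiDx//; set l := xi_seq al ++ x_seq be.
have sl : size l = (mabs al + mabs be)%N by exact: size_xi_x_seq.
have j1 := japan_ge1 w; have j0 := japan_gt0 w.
have wt : 0 < h ^+ (mabs al + mabs be) * A (mabs al) * A (mabs be).
  by rewrite !mulr_gt0 ?exprn_gt0.
rewrite ler_pdivrMr//.
set a := enorm (xipart w); set b := enorm (xpart w).
have a0 : 0 <= a by exact: enorm_ge0.
have b0 : 0 <= b by exact: enorm_ge0.
have Mle : assoc_fun M (L * japan w) <= assoc_fun M (m * a) + assoc_fun M (m * b) + assoc_fun M m.
  have H := @assoc_le_sum _ M M0 Mexp (L * japan w) (L * a) (L * b) L.
  apply: le_trans (H _ _ _ _ _) _; rewrite ?mulr_ge0 ?(ltW j0)//.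
    by rewrite -!mulrDr -[X in _ + X]mulr1 -mulrDr ler_wpM2l//; exact: japan_split.
  by rewrite !mulrA; repeat apply: lerD; apply: ler_assoc; rewrite ?mulr_ge0// ler_wpM2r.
have jr : japan w `^ (r * (mabs al + mabs be)%:R) <= japan w ^+ (mabs al + mabs be).
  rewrite -powR_mulrn ?(ltW j0)//; apply: ler_powR => //.
  by rewrite ler_piMl.
apply: (@le_trans _ _ (2 * ((size l)`!%:R * K * expR (assoc_fun M (L * japan w))) *
    expR (- assoc_fun M (m * a) - assoc_fun M (m * b)))).
  rewrite ler_wpM2r ?expR_ge0//.
  apply: le_trans (cabs_pdersC_symb gr gi l w).
  by rewrite ler_wpM2l ?cabs_ge0// sl.
apply: (@le_trans _ _ (2 * ((size l)`!%:R * K * expR (assoc_fun M m)))).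
  rewrite -mulrA ler_wpM2l// -mulrA ler_wpM2l ?mulr_ge0// -expRD ler_expR.
  by move: Mle; lra.
rewrite sl; have h1 := CP (mabs al) (mabs be).
rewrite [leRHS](_ : _ = K * (2 * (C * h ^+ (mabs al + mabs be) * A (mabs al) * A (mabs be))
   * expR (assoc_fun M m))); last by ring.
rewrite [leLHS](_ : _ = K * (2 * (mabs al + mabs be)`!%:R * expR (assoc_fun M m))); last by ring.
by rewrite ler_wpM2l// ler_wpM2r ?expR_ge0// ler_wpM2l.
Qed.

Definition symb_fun f := if beur then exists L, 0 < L /\ exists K, symb_bound L K f
  else forall L, 0 < L -> exists K, symb_bound L K f.

Definition symb_seq u :=
  if beur then exists L, 0 < L /\ exists K, forall p, symb_bound L (K * 2 ^- p) (u p)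
  else forall L, 0 < L -> exists K, forall p, symb_bound L (K * 2 ^- p) (u p).

Lemma symb_seq_fun u p : symb_seq u -> symb_fun (u p).
Proof.
rewrite /symb_seq /symb_fun; case: beur => [[L [L0 [K H]]]|H L L0].
  by exists L; split => //; exists (K * 2 ^- p).
by have [K HK] := H L L0; exists (K * 2 ^- p).
Qed.

Lemma Gamma_of_symb r F : r <= 1 -> smC F ->
  symb_fun (fun v => reC (F v)) -> symb_fun (fun v => imC (F v)) -> Gamma beur A M r F.
Proof.
move=> r01 sF gr gi; split; first exact: smC_smooth.
move: gr gi; rewrite /symb_fun; case: beur => [[L1 [L10 [K1 H1]]] [L2 [L20 [K2 H2]]]|H1 H2].
  have L0 : 0 < L1 + L2 by rewrite addr_gt0.
  exists (3 * (L1 + L2)); split; first by rewrite mulr_gt0.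
  move=> h h0; have [|Cst [C0 CP]] := @symb_gbound h (3 * (L1 + L2)) h0; first by rewrite mulr_gt0.
  have K10 := symb_bound_ge0 H1; have K20 := symb_bound_ge0 H2.
  exists ((K1 + K2) * Cst); apply: (CP r (L1 + L2)) => //; first exact: ltW.
    by apply: symb_bound_mono H1; rewrite ?lerDl// ltW.
  by apply: symb_bound_mono H2; rewrite ?lerDr// ltW.
(* Any positive [h] would serve here, factorials being dominated for each of them. *)
exists 1; split => // m m0.
have L0 : 0 < m / 3 by rewrite divr_gt0.
have [K1 G1] := H1 _ L0; have [K2 G2] := H2 _ L0.
have K10 := symb_bound_ge0 G1; have K20 := symb_bound_ge0 G2.
have [Cst [C0 CP]] := @symb_gbound 1 m ltr01 m0.
exists ((K1 + K2) * Cst); apply: (CP r (m / 3)) => //.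
- exact: ltW.
- by rewrite mulrCA divff ?mulr1.
- by apply: symb_bound_mono G1; rewrite ?lerDl// ltW.
- by apply: symb_bound_mono G2; rewrite ?lerDr// ltW.
Qed.

Lemma symb_seq_summable u : (forall p, sm (u p)) -> symb_seq u -> locally_summable u.
Proof.
move=> su gu; split => // l r.
have [L [L0 [K KP]]] : exists L, 0 < L /\ exists K, forall p, symb_bound L (K * 2 ^- p) (u p).
  move: gu; rewrite /symb_seq; case: beur => // H; exists 1; split => //; exact: H.
have K0 : 0 <= K by have := symb_bound_ge0 (KP 0%N); rewrite expr0 invr1 mulr1.
exists ((size l)`!%:R * K * expR (assoc_fun M (L * (1 + (d + d)%:R * `|r|)))) => p w wr.
have j1 := japan_ge1 w; have j0 := japan_gt0 w.
apply: (@le_trans _ _ (`|pders l (u p) w| * japan w ^+ size l)).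
  by rewrite ler_peMr// exprn_ege1.
apply: (le_trans (KP p l w)).
rewrite mulrA -mulrA [2 ^- p * _]mulrC mulrA ler_wpM2r ?invr_ge0 ?exprn_ge0//.
rewrite ler_wpM2l ?mulr_ge0// ler_expR; apply: ler_assoc => //.
  by rewrite mulr_ge0// ltW.
rewrite ler_wpM2l ?(ltW L0)//; apply: (le_trans (japan_le_norm w)).
by rewrite lerD2l ler_wpM2l// (le_trans wr)// ler_norm.
Qed.

(** Derivatives pass through the series, and the geometric tail bound is then applied at each point.
    The case [N = 0] concerns the sum itself. *)
Lemma symb_bound_tail u L K N : (forall p, sm (u p)) -> locally_summable u ->
  (forall p, symb_bound L (K * 2 ^- p) (u p)) ->
  symb_bound L (K * 2 * 2 ^- N) (fun w => fseries u w - \sum_(0 <= k < N) u k w).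
Proof.
move=> su lu uK l w.
have sS : sm (fun w => \sum_(0 <= k < N) u k w) by exact: sm_sum.
rewrite (_ : (fun _ => _) = fun w => 1 * fseries u w + (-1) * \sum_(0 <= k < N) u k w); last first.
  by apply/funext => v; rewrite mul1r mulN1r.
rewrite pders_lin2//; last exact: fseries_sm.
rewrite mul1r mulN1r fseries_pders// pders_sum//.
have j0 := japan_gt0 w; set J := japan w ^+ size l.
have J0 : 0 < J by rewrite exprn_gt0.
set E := expR _.
have H k : `|pders l (u k) w| <= (size l)`!%:R * K * E / J * 2 ^- k.
  rewrite mulrAC ler_pdivlMr//; apply: (le_trans (uK k l w)).
  by rewrite -/E le_eqVlt; apply/orP; left; apply/eqP; ring.
have := half_tail N H; rewrite -/(fseries (fun k => pders l (u k)) w) => /(ler_wpM2r (ltW J0)) HH.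
apply: (le_trans HH).
rewrite le_eqVlt; apply/orP; left; apply/eqP.
by field; rewrite ?(lt0r_neq0 J0) ?expf_neq0 ?pnatr_eq0.
Qed.

Lemma symb_fun_tail u N : (forall p, sm (u p)) -> symb_seq u ->
  symb_fun (fun w => fseries u w - \sum_(0 <= k < N) u k w).
Proof.
move=> su gu; have lu := symb_seq_summable su gu; move: gu; rewrite /symb_seq /symb_fun.
case: beur => [[L [L0 [K H]]]|H L L0].
  by exists L; split => //; exists (K * 2 * 2 ^- N); exact: symb_bound_tail.
by have [K HK] := H L L0; exists (K * 2 * 2 ^- N); exact: symb_bound_tail.
Qed.

Lemma symb_fun_fseries u : (forall p, sm (u p)) -> symb_seq u -> symb_fun (fseries u).
Proof.
move=> su gu; have := symb_fun_tail 0 su gu.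
by under eq_fun do rewrite big_geq// subr0.
Qed.

(** Two sequences are treated at once so that real and imaginary parts share [L] and [K]. In the
    Beurling case [L] comes from the sequences and selects the step [m = 3 L]. In the Roumieu case
    the step [h = 1] comes first, the seminorm returns [m], and [L = m / 3] follows from it. *)
Lemma seminorm_symb (q : (V -> R[i]) -> R) u u' : cont_seminorm beur A M 1 q ->
  symb_seq u -> symb_seq u' -> exists L K Cq : R,
  [/\ 0 <= Cq, (forall p, symb_bound L (K * 2 ^- p) (u p)),
      (forall p, symb_bound L (K * 2 ^- p) (u' p)) &
      forall F K', smC F -> symb_fun (fun v => reC (F v)) -> symb_fun (fun v => imC (F v)) ->
       symb_bound L K' (fun v => reC (F v)) -> symb_bound L K' (fun v => imC (F v)) ->
       q F <= Cq * K'].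
Proof.
have r01 : (1 : R) <= 1 by [].
case=> _; rewrite /symb_seq.
have max2 (K1 K2 p2 : R) : 0 <= p2 -> 0 <= K1 * p2 -> 0 <= K2 * p2 ->
   K1 * p2 <= (K1 + K2) * p2 /\ K2 * p2 <= (K1 + K2) * p2.
  by move=> ? ? ?; rewrite mulrDl lerDl lerDr.
have p20 p : (0 : R) <= 2 ^- p by rewrite invr_ge0 exprn_ge0.
have -> : symb_fun = (if beur then fun f => exists L, 0 < L /\ exists K, symb_bound L K f
  else fun f => forall L, 0 < L -> exists K, symb_bound L K f) by rewrite /symb_fun; case: beur.
case: beur => [qc [L1 [L10 [K1 H1]]] [L2 [L20 [K2 H2]]]|qc H1 H2].
  have L0 : 0 < L1 + L2 by rewrite addr_gt0.
  have [|h [C [h0 [C0 qP]]]] := qc (3 * (L1 + L2)); first by rewrite mulr_gt0.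
  have [|Cst [Cst0 CP]] := @symb_gbound h (3 * (L1 + L2)) h0; first by rewrite mulr_gt0.
  exists (L1 + L2), (K1 + K2), (C * Cst); split.
  - by rewrite mulr_ge0.
  - move=> p; have [e1 e2] := max2 K1 K2 _ (p20 p) (symb_bound_ge0 (H1 p)) (symb_bound_ge0 (H2 p)).
    by apply: symb_bound_mono (H1 p); rewrite ?lerDl// ltW.
  - move=> p; have [e1 e2] := max2 K1 K2 _ (p20 p) (symb_bound_ge0 (H1 p)) (symb_bound_ge0 (H2 p)).
    by apply: symb_bound_mono (H2 p); rewrite ?lerDr// ltW.
  move=> F K' sF _ _ gr gi; rewrite -mulrA [Cst * _]mulrC.
  apply: qP; last by apply: (CP 1 (L1 + L2)) => //; exact: ltW.
  split; first exact: smC_smooth.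
  move=> h' h'0; have [|Cst' [_ CP']] := @symb_gbound h' (3 * (L1 + L2)) h'0; first by rewrite mulr_gt0.
  by exists (K' * Cst'); apply: (CP' 1 (L1 + L2)) => //; exact: ltW.
have [m [C [m0 [C0 qP]]]] := qc 1 ltr01.
have L0 : 0 < m / 3 by rewrite divr_gt0.
have L3 : 3 * (m / 3) <= m by rewrite mulrCA divff ?mulr1.
have [K1 G1] := H1 _ L0; have [K2 G2] := H2 _ L0.
have [Cst [Cst0 CP]] := @symb_gbound 1 m ltr01 m0.
exists (m / 3), (K1 + K2), (C * Cst); split.
- by rewrite mulr_ge0.
- move=> p; have [e1 e2] := max2 K1 K2 _ (p20 p) (symb_bound_ge0 (G1 p)) (symb_bound_ge0 (G2 p)).
  by apply: symb_bound_mono (G1 p); rewrite // ltW.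
- move=> p; have [e1 e2] := max2 K1 K2 _ (p20 p) (symb_bound_ge0 (G1 p)) (symb_bound_ge0 (G2 p)).
  by apply: symb_bound_mono (G2 p); rewrite // ltW.
move=> F K' sF fr fi gr gi; rewrite -mulrA [Cst * _]mulrC.
apply: qP; last by apply: (CP 1 (m / 3)) => //; exact: ltW.
split; first exact: smC_smooth.
move=> m' m'0; have L'0 : 0 < m' / 3 by rewrite divr_gt0.
have [Ka Ga] := fr _ L'0; have [Kb Gb] := fi _ L'0.
have Ka0 := symb_bound_ge0 Ga; have Kb0 := symb_bound_ge0 Gb.
have [Cst' [_ CP']] := @symb_gbound 1 m' ltr01 m'0.
exists ((Ka + Kb) * Cst'); apply: (CP' 1 (m' / 3)) => //.
- exact: ltW.
- by rewrite mulrCA divff ?mulr1.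
- by apply: symb_bound_mono Ga; rewrite ?lerDl// ltW.
- by apply: symb_bound_mono Gb; rewrite ?lerDr// ltW.
Qed.

Definition reS U := fun k w => reC (U k w).
Definition imS U := fun k w => imC (U k w).

Definition symb_seqC U := (forall k, smC (U k)) /\ symb_seq (reS U) /\ symb_seq (imS U).

Lemma symb_seqC_limit U : symb_seqC U ->
  smC (fun w => csum (fun k => U k w)) /\
  symb_fun (fun w => reC (csum (fun k => U k w))) /\
  symb_fun (fun w => imC (csum (fun k => U k w))).
Proof.
move=> [sU [gr gi]].
have sr k : sm (reS U k) by case: (sU k).
have si k : sm (imS U k) by case: (sU k).
split; last by split; [exact: (symb_fun_fseries sr gr)|exact: (symb_fun_fseries si gi)].
split; first exact: (fseries_sm (symb_seq_summable sr gr)).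
exact: (fseries_sm (symb_seq_summable si gi)).
Qed.

Lemma symb_seqC_abs_conv U : symb_seqC U -> abs_conv_Gamma beur A M 1 U.
Proof.
move=> gU; have [sU [gr gi]] := gU.
have sr k : sm (reS U k) by case: (sU k).
have si k : sm (imS U k) by case: (sU k).
have r01 : (1 : R) <= 1 by [].
have [sG [Gr Gi]] := symb_seqC_limit gU.
split.
  by move=> k; apply: Gamma_of_symb => //; [exact: (symb_seq_fun k gr)|exact: (symb_seq_fun k gi)].
split.
  move=> q qc; have [L [K [Cq [Cq0 H1 H2 qP]]]] := seminorm_symb qc gr gi.
  exists (Cq * (K * 2)) => N; rewrite -(big_mkord xpredT (fun k => q (U k))).
  have K0 : 0 <= K by have := symb_bound_ge0 (H1 0%N); rewrite expr0 invr1 mulr1.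
  apply: (@le_trans _ _ (\sum_(0 <= k < N) Cq * (K * 2 ^- k))).
    by apply: ler_sum => k _; apply: qP => //; [exact: (symb_seq_fun k gr)|exact: (symb_seq_fun k gi)].
  rewrite -mulr_sumr ler_wpM2l// -mulr_sumr ler_wpM2l//.
  by have := sum_half_pow R 0 N; rewrite expr0 invr1 mulr1.
exists (fun w => csum (fun k => U k w)); split; first exact: Gamma_of_symb.
move=> q qc eps eps0; have [L [K [Cq [Cq0 H1 H2 qP]]]] := seminorm_symb qc gr gi.
have K0 : 0 <= K by have := symb_bound_ge0 (H1 0%N); rewrite expr0 invr1 mulr1.
pose F N := (fun w => csum (fun k => U k w) - fpsum U N w).
have reF N : (fun v => reC (F N v)) = fun w => fseries (reS U) w - \sum_(0 <= k < N) reS U k w.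
  apply/funext => w; rewrite /F reCD; congr (_ + _).
  rewrite -[in RHS]reC_sum big_mkord -/(fpsum U N w); by case: (fpsum U N w).
have imF N : (fun v => imC (F N v)) = fun w => fseries (imS U) w - \sum_(0 <= k < N) imS U k w.
  apply/funext => w; rewrite /F imCD; congr (_ + _).
  rewrite -[in RHS]imC_sum big_mkord -/(fpsum U N w); by case: (fpsum U N w).
have lr := symb_seq_summable sr gr; have li := symb_seq_summable si gi.
have qF N : q (F N) <= Cq * (K * 2 * 2 ^- N).
  apply: qP; rewrite ?reF ?imF; [|exact: symb_fun_tail|exact: symb_fun_tail|exact: symb_bound_tail|exact: symb_bound_tail].
  split; rewrite ?reF ?imF.
    rewrite (_ : (fun _ => _) = fun w => 1 * fseries (reS U) w + (-1) * \sum_(0 <= k < N) reS U k w); last first.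
      by apply/funext => v; rewrite mul1r mulN1r.
    by apply: sm_lin2; [exact: fseries_sm|exact: sm_sum].
  rewrite (_ : (fun _ => _) = fun w => 1 * fseries (imS U) w + (-1) * \sum_(0 <= k < N) imS U k w); last first.
    by apply/funext => v; rewrite mul1r mulN1r.
  by apply: sm_lin2; [exact: fseries_sm|exact: sm_sum].
(* For [N] at least the bound of [X], [2^N > N] makes the tail [Cq * (K * 2) / 2^N] smaller than
   [eps]. *)
pose X := Cq * (K * 2) / eps; have X0 : 0 <= X by rewrite divr_ge0 ?mulr_ge0// ltW.
exists (Num.bound X) => N NX; apply: (le_lt_trans (qF N)).
rewrite mulrA ltr_pdivrMr ?exprn_gt0// [ltRHS]mulrC -ltr_pdivrMr// -/X.
apply: (lt_le_trans (archi_boundP X0)).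
by rewrite -natrX ler_nat (leq_trans NX)// ltnW// ltn_expl.
Qed.

(** A constant lower bound is enough, because the exponential in the lower estimate is at most 1.
    The geometric constant of the upper estimate becomes [h^p] with weights through
    [pow_le_weights], for every [h]. *)
Lemma hypoelliptic_of_symb rho F (B C c0 : R) : rho <= 1 -> smC F ->
  symb_fun (fun v => reC (F v)) -> symb_fun (fun v => imC (F v)) ->
  0 < B -> 0 <= C -> 0 < c0 ->
  (forall w, Qc B w -> c0 <= cabs (F w)) ->
  (forall l w, Qc B w -> cabs (pdersC l F w) <=
     C ^+ (size l + 1) * cabs (F w) / japan w `^ (rho * (size l)%:R)) ->
  hypoelliptic beur A M rho F.
Proof.
move=> rho01 sF gr gi B0 C0 c00 Flow Fup; split; first exact: Gamma_of_symb.
exists B; split => // lower upper.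
have low m : 0 < m -> lower c0 m.
  move=> m0 w QB; apply: le_trans (Flow w QB); apply: ler_piMr; first exact: ltW.
  have h1 := @assoc_ge0 _ M Mexp (m * enorm (xpart w)).
  have h2 := @assoc_ge0 _ M Mexp (m * enorm (xipart w)).
  rewrite -expR0 ler_expR -opprD oppr_le0 addr_ge0 ?h1 ?h2 ?mulr_ge0 ?enorm_ge0 ?(ltW m0)//.
have up h : 0 < h -> exists C : R, 0 < C /\ upper h C.
  move=> h0; have [C' [C'0 CP]] := pow_le_weights C0 h0.
  exists ((C + 1) * C'); split; first by rewrite mulr_gt0// ltr_wpDl.
  move=> al be w QB; rewrite cabs_DxiDx//.
  apply: (le_trans (Fup _ w QB)); rewrite size_xi_x_seq powRN.
  rewrite ler_wpM2r ?invr_ge0 ?powR_ge0// ler_wpM2r ?cabs_ge0//.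
  rewrite addn1 exprS -!mulrA ler_pM ?exprn_ge0 ?lerDl//.
  by rewrite !mulrA; exact: CP.
case: beur; split.
- by exists c0, 1; split => //; split => //; exact: low.
- exact: up.
- by move=> m m0; exists c0; split => //; exact: low.
- by have [C' [C'0 H]] := up 1 ltr01; exists 1, C'.
Qed.

End SymbolClasses.

(** * The function P and sums of families *)

Section Coefficients.
Variables (R : realType) (m : nat) (s C0 : R) (Mh : nat -> R).
Hypotheses (m1 : (1 <= m)%N) (s1 : 1 < s) (C01 : 1 <= C0).
Hypotheses (Mh0 : forall n, 0 < Mh n) (Mh00 : Mh 0%N = 1).
Hypothesis MhC : forall n k, (k <= n)%N ->
  Mh k / ((k * m)`!)%:R `^ s <= C0 ^+ (n - k) * (Mh n / ((n * m)`!)%:R `^ s).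

Local Notation fp k := (((k)`!)%:R `^ s : R).

Lemma fp_gt0 k : 0 < fp k.
Proof. by rewrite powR_gt0// ltr0n fact_gt0. Qed.

Lemma fp_mul_le (i q : nat) : fp i * fp q <= fp (i + q).
Proof.
rewrite -powRM// -natrM; apply: ge0_ler_powR; rewrite ?nnegrE//.
  by rewrite ltW// (lt_trans ltr01).
rewrite ler_nat -(bin_fact (leq_addr q i)) addKn.
by rewrite leq_pmull// bin_gt0 leq_addr.
Qed.

Lemma fact_le_fp k : k`!%:R <= fp k.
Proof.
rewrite -[leLHS]powRr1//; apply: ler_powR; last exact: ltW.
by rewrite ler1n fact_gt0.
Qed.

Lemma Mh_lower p : (Mh p)^-1 <= C0 ^+ p / fp (p * m).
Proof.
have := MhC (leq0n p); rewrite Mh00 mul0n subn0 fact0 powR1 divr1 => h.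
by rewrite -[leLHS]mul1r ler_pdivrMr// mulrAC -mulrA.
Qed.

(** Only [(p m)!^s >= p!] is used of the growth of [Mh]: the series is dominated by an exponential
    one, taken at [2 C0 x] to leave [2^-p]. *)
Lemma coef_bound (x : R) : 0 <= x -> forall p, x ^+ p / Mh p <= expR (2 * C0 * x) * 2 ^- p.
Proof.
move=> x0 p; have C00 : 0 <= C0 by exact: le_trans C01.
apply: (@le_trans _ _ (x ^+ p * (C0 ^+ p / fp (p * m)))).
  by rewrite ler_wpM2l ?exprn_ge0// Mh_lower.
apply: (@le_trans _ _ (x ^+ p * (C0 ^+ p / p`!%:R))).
  rewrite ler_wpM2l ?exprn_ge0// ler_wpM2l ?exprn_ge0//.
  rewrite lef_pV2 ?posrE ?fp_gt0 ?ltr0n ?fact_gt0//.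
  apply: le_trans (fact_le_fp _); rewrite ler_nat; apply: leq_fact.
  by rewrite leq_pmulr.
rewrite mulrA ler_pdivrMr ?ltr0n ?fact_gt0// mulrAC ler_pdivlMr ?exprn_gt0//.
have -> : x ^+ p * C0 ^+ p * 2 ^+ p = (2 * C0 * x) ^+ p by rewrite !exprMn; ring.
by apply: exp_le_fact; rewrite !mulr_ge0.
Qed.

Lemma Pser_cvg (x : R) : cvgn (series (fun p => x ^+ p / Mh p)).
Proof.
apply: (half_cvg (K := expR (2 * C0 * `|x|)) _).1 => p.
rewrite normrM normrX [`|(Mh p)^-1|]ger0_norm ?invr_ge0 ?(ltW (Mh0 p))//.
exact: coef_bound.
Qed.

Lemma Pser_partial (x : R) N : 0 <= x -> \sum_(0 <= p < N) x ^+ p / Mh p <= Pser Mh x.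
Proof.
move=> x0; apply: series_partial_le; last exact: Pser_cvg.
by move=> p; rewrite divr_ge0 ?exprn_ge0 ?(ltW (Mh0 p)).
Qed.

Lemma Pser_ge1 (x : R) : 0 <= x -> 1 <= Pser Mh x.
Proof.
move=> x0; apply: le_trans (Pser_partial 1 x0).
by rewrite big_nat1 expr0 Mh00 divr1.
Qed.

(** Continuity follows from differentiability of power series, which asks for convergence of the
    series and its first two formal derivatives at radius [|x| + 1]. Each formal derivative brings a
    factor [p + 1 <= 2^p], absorbed by doubling the radius. *)
Lemma Pser_continuous : continuous (Pser Mh).
Proof.
have b (x : R) : 1 <= x -> forall p, `|x ^+ p / Mh p| <= expR (2 * C0 * x) * 2 ^- p.
  move=> x1 p; have x0 : 0 <= x by exact: le_trans x1.
  rewrite ger0_norm ?divr_ge0 ?exprn_ge0 ?(ltW (Mh0 p))//.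
  exact: coef_bound.
pose c p := (Mh p)^-1.
have c0 p : 0 <= c p by rewrite invr_ge0 ltW.
have Sle (k : nat) : k.+1%:R <= 2 ^+ k :> R by rewrite -natrX ler_nat ltn_expl.
have cv0 (x : R) : 1 <= x -> cvgn (pseries c x).
  move=> x1; apply: (half_cvg (K := expR (2 * C0 * x)) _).1 => p.
  by rewrite /c [X in `|X|]mulrC; exact: b.
have cv1 (x : R) : 1 <= x -> cvgn (pseries (pseries_diffs c) x).
  move=> x1; have x0 : 0 <= x by exact: le_trans x1.
  have x2 : 1 <= 2 * x by lra.
  apply: (half_cvg (K := expR (2 * C0 * (2 * x))) _).1 => p.
  rewrite /pseries_diffs ger0_norm; last by rewrite !mulr_ge0 ?exprn_ge0.
  apply: (@le_trans _ _ ((2 * x) ^+ p.+1 / Mh p.+1)).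
    rewrite [leLHS](_ : _ = p.+1%:R * x ^+ p * c p.+1); last by rewrite mulrAC.
    rewrite ler_wpM2r// exprMn ler_pM ?exprn_ge0//.
      by apply: (le_trans (Sle p)); rewrite ler_eXn2l// ltr1n.
    by rewrite exprS ler_peMl// exprn_ge0.
  apply: (le_trans (ler_norm _)); apply: (le_trans (b _ x2 p.+1)).
  rewrite ler_wpM2l ?expR_ge0// lef_pV2 ?posrE ?exprn_gt0//.
  by rewrite ler_eXn2l// ltr1n.
have cv2 (x : R) : 1 <= x -> cvgn (pseries (pseries_diffs (pseries_diffs c)) x).
  move=> x1; have x0 : 0 <= x by exact: le_trans x1.
  have x2 : 1 <= 4 * x by lra.
  apply: (half_cvg (K := expR (2 * C0 * (4 * x))) _).1 => p.
  rewrite /pseries_diffs ger0_norm; last by rewrite !mulr_ge0 ?exprn_ge0.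
  apply: (@le_trans _ _ ((4 * x) ^+ p.+2 / Mh p.+2)).
    rewrite [leLHS](_ : _ = p.+1%:R * p.+2%:R * x ^+ p * c p.+2); last by rewrite /= mulrA mulrAC.
    rewrite ler_wpM2r// exprMn ler_pM ?mulr_ge0 ?exprn_ge0//.
      have -> : (4 : R) = 2 * 2 by ring.
      rewrite exprMn ler_pM//.
        by apply: (le_trans (Sle p)); rewrite ler_eXn2l ?ltr1n// ltnW.
      by apply: (le_trans (Sle p.+1)); rewrite ler_eXn2l// ltr1n.
    by rewrite !exprS mulrA ler_peMl ?exprn_ge0// -expr2 exprn_ege1.
  apply: (le_trans (ler_norm _)); apply: (le_trans (b _ x2 p.+2)).
  rewrite ler_wpM2l ?expR_ge0// lef_pV2 ?posrE ?exprn_gt0//.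
  by rewrite ler_eXn2l ?ltr1n// ltnW.
move=> x; have K1 : 1 <= `|x| + 1 by rewrite lerDr.
have K0 : 0 <= `|x| + 1 by exact: le_trans K1.
have := @pseries_snd_diffs R c (`|x| + 1) x (cv0 _ K1) (cv1 _ K1) (cv2 _ K1).
rewrite (ger0_norm K0) ltrDl ltr01 => /(_ isT) H.
have -> : Pser Mh = fun x => limn (pseries c x).
  apply/funext => z; rewrite /Pser /pseries; congr (limn (series _)).
  by apply/funext => p; rewrite mulrC.
by apply: differentiable_continuous; apply/derivable1_diffP; case: H.
Qed.

(** Each of the [k] additional factors is at least [p m + 1 >= p + 1]. *)
Lemma fact_step (p k : nat) : ((p.+1 ^ k) * (p * m)`! <= (p * m + k)`!)%N.
Proof.
elim: k => [|k IH]; first by rewrite expn0 mul1n addn0.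
rewrite addnS factS expnS -mulnA leq_mul//.
by rewrite ltnS (leq_trans _ (leq_addr _ _))// leq_pmulr.
Qed.

(** This is the recursion [tS] of the moment estimates with [sg = m s]. The growth condition for
    consecutive indices gives the ratio [C0 v ((p m)! / (p m + m)!)^s], and [fact_step] bounds the
    quotient of factorials by [(p + 1)^(-m)]. *)
Lemma coef_ratio (v y : R) p : 0 <= v -> 0 <= y -> C0 * v <= y `^ (m%:R * s) ->
  v ^+ p.+1 / Mh p.+1 <= v ^+ p / Mh p * (y / p.+1%:R) `^ (m%:R * s).
Proof.
move=> v0 y0 vy; have := MhC (leqnSn p); rewrite subSnn expr1 => H.
have f1 := fp_gt0 (p * m); have f2 := fp_gt0 (p.+1 * m).
have H1 : (Mh p.+1)^-1 <= C0 * (Mh p)^-1 * (fp (p * m) / fp (p.+1 * m)).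
  rewrite -[leLHS]mul1r ler_pdivrMr//.
  have := ler_wpM2r (_ : 0 <= fp (p * m) / Mh p) H.
  rewrite divr_ge0 ?(ltW f1) ?(ltW (Mh0 p))// => /(_ isT).
  have -> : Mh p / fp (p * m) * (fp (p * m) / Mh p) = 1.
    by rewrite mulrA divfK ?gt_eqF// divff// gt_eqF.
  by move=> h; apply: (le_trans h); rewrite le_eqVlt; apply/orP; left; apply/eqP; ring.
have pS : (0 : R) < p.+1%:R `^ (m%:R * s) by rewrite powR_gt0.
have H2 : fp (p * m) / fp (p.+1 * m) <= (p.+1%:R `^ (m%:R * s))^-1.
  rewrite ler_pdivrMr// mulrC ler_pdivlMr//.
  rewrite powRrM powR_mulrn// -powRM ?exprn_ge0//.
  apply: ge0_ler_powR; rewrite ?nnegrE ?mulr_ge0 ?exprn_ge0//.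
    by rewrite ltW// (lt_trans ltr01).
  rewrite mulrC -natrX -natrM ler_nat mulSn [(m + _)%N]addnC; exact: fact_step.
have C00 : 0 <= C0 by exact: le_trans C01.
have M0 : 0 <= (Mh p)^-1 by rewrite invr_ge0 ltW.
apply: (@le_trans _ _ (v ^+ p.+1 * (C0 * (Mh p)^-1 * (p.+1%:R `^ (m%:R * s))^-1))).
  rewrite ler_wpM2l ?exprn_ge0//; apply: (le_trans H1).
  by rewrite ler_wpM2l ?mulr_ge0.
rewrite powRM ?invr_ge0// -[p.+1%:R^-1]powR_inv1// -powRrM mulN1r powRN.
rewrite exprS [leLHS](_ : _ = v ^+ p / Mh p * ((C0 * v) * (p.+1%:R `^ (m%:R * s))^-1)); last by ring.
rewrite ler_wpM2l ?mulr_ge0 ?exprn_ge0// ler_wpM2r ?invr_ge0// ltW//.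
Qed.

(* [i!^(s-1)] dominates every geometric sequence since [s > 1]. *)
Lemma fact_absorb (X : R) : 0 <= X -> exists K1 : R, 0 <= K1 /\
  forall i : nat, X ^+ i * i`!%:R / fp i <= K1.
Proof.
move=> X0; have e0 : 0 < s - 1 by rewrite subr_gt0.
exists ((expR (X `^ (s - 1)^-1)) `^ (s - 1)); split; first exact: powR_ge0.
move=> i; have f0 : (0 : R) < i`!%:R by rewrite ltr0n fact_gt0.
(* With [Z = X^(1/(s-1))] the expression is [(Z^i / i!)^(s-1)], and [Z^i / i! <= e^Z]. *)
have -> : X ^+ i * i`!%:R / fp i = ((X `^ (s - 1)^-1) ^+ i / i`!%:R) `^ (s - 1).
  rewrite powRM ?exprn_ge0 ?powR_ge0 ?invr_ge0//.
  rewrite -[(X `^ _) ^+ i]powR_mulrn ?powR_ge0// -!powRrM.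
  have -> : (s - 1)^-1 * (i%:R * (s - 1)) = i%:R by rewrite mulrCA mulVf ?mulr1 ?gt_eqF.
  rewrite powR_mulrn// -mulrA; congr (_ * _).
  have -> : (i`!%:R : R) ^-1 = i`!%:R `^ (-1) by rewrite powR_inv1// ltW.
  rewrite -powRrM mulN1r.
  have -> : fp i = i`!%:R `^ (s - 1) * i`!%:R.
    by rewrite -[X in _ = _ * X]powRr1 ?(ltW f0)// -powRD ?subrK// (gt_eqF f0) implybT.
  by rewrite powRN invfM mulrCA divff ?mulr1// gt_eqF.
apply: ge0_ler_powR; rewrite ?nnegrE ?expR_ge0 ?(ltW e0)//.
  by rewrite divr_ge0 ?exprn_ge0 ?powR_ge0// ltW.
by rewrite ler_pdivrMr//; apply: exp_le_fact; exact: powR_ge0.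
Qed.

End Coefficients.

(** * Families graded by order: global bounds and bounds on the elliptic region *)

Section Families.
Variables (R : realType) (d m : nat) (s C0 : R) (Mh M : nat -> R) (beur : bool).
Hypotheses (m1 : (1 <= m)%N) (s1 : 1 < s) (C01 : 1 <= C0).
Hypotheses (Mh0 : forall n, 0 < Mh n) (Mh00 : Mh 0%N = 1).
Hypothesis MhC : forall n k, (k <= n)%N ->
  Mh k / ((k * m)`!)%:R `^ s <= C0 ^+ (n - k) * (Mh n / ((n * m)`!)%:R `^ s).
Hypotheses (M0 : forall p, 0 < M p)
  (Mexp : forall t : R, 0 <= t -> exists C, forall p, t ^+ p / M p <= C).

(** In terms of associated functions: that of [q!^s] at [X t] exceeds [M(L t)] by at most a
    constant. *)
Definition growth (X L : R) := exists CM : R, 0 <= CM /\ forall q t, 0 <= t ->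
  (X * t) ^+ q / (q`!)%:R `^ s <= CM * expR (assoc_fun M (L * t)).

Hypothesis grow : if beur then forall X, 0 <= X -> exists L, 0 < L /\ growth X L
  else forall X, 0 <= X -> forall L, 0 < L -> growth X L.

Local Notation V := 'rV[R]_(d + d).
Local Notation fp k := (((k)`!)%:R `^ s : R).
Implicit Types (w : V) (Bs : nat -> (V -> R) -> Prop).

Definition base_at Bs (v k : R) w := forall e b l, Bs e b ->
  `|pders l b w| <= v * k ^+ (e + size l) /\ ((m < e + size l)%N -> pders l b w = 0).

Variables (Bs : nat -> (V -> R) -> Prop) (D : R) (e : nat) (f : nat -> nat -> V -> R).
Hypotheses (smB : forall e b, Bs e b -> sm b) (D1 : 1 <= D)
  (fam : forall p i, dmono Bs p i ((D * p%:R) ^+ i) (f p i)).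

Definition fam_term p w := (\sum_(e <= i < (p * m).+1) f p i w) / Mh p.

Let D0 : 0 <= D. Proof. exact: le_trans D1. Qed.

Lemma fam_sm p i : sm (f p i). Proof. exact: dmono_sm (fam p i). Qed.

Lemma fam_term_sm p : sm (fam_term p).
Proof.
rewrite /fam_term; under eq_fun do rewrite mulrC.
by apply: smZ; apply: sm_sum => i; exact: fam_sm.
Qed.

Lemma pders_fam_term l p w :
  pders l (fam_term p) w = \sum_(e <= i < (p * m).+1) (pders l (f p i) w / Mh p).
Proof.
rewrite /fam_term; under eq_fun do rewrite mulrC.
have sf i : sm (f p i) by exact: fam_sm.
rewrite pdersZ; last exact: sm_sum.
by rewrite pders_sum// mulrC mulr_suml.
Qed.

(** The count [p^(size l)] produced by the derivatives fits into [(D p)^(i + size l)] because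
    [D >= 1]. *)
Lemma fam_eval v k w l p i : 0 <= v -> 0 <= k -> base_at Bs v k w ->
  `|pders l (f p i) w| <= (D * k * p%:R) ^+ (i + size l) * v ^+ p /\
  ((p * m < i + size l)%N -> pders l (f p i) w = 0).
Proof.
move=> v0 k0 Bw; have [H1 H2] := dmono_eval v0 k0 Bw (dmono_pders smB l (fam p i)).
split => //; apply: (le_trans H1).
rewrite (_ : (D * k * p%:R) ^+ _ = (D * p%:R) ^+ (i + size l) * k ^+ (i + size l)); last first.
  by rewrite -exprMn; congr (_ ^+ _); ring.
rewrite [leRHS]mulrAC ler_wpM2r ?exprn_ge0// ler_wpM2r ?exprn_ge0//.
rewrite mulrC [leRHS]exprD ler_wpM2l ?exprn_ge0 ?mulr_ge0//.
rewrite lerXn2r ?nnegrE ?mulr_ge0//.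
by rewrite ler_peMl.
Qed.

Section GlobalBound.
Variables (Cv Ck : R).
Hypotheses (Cv1 : 1 <= Cv) (Ck1 : 1 <= Ck)
  (BsG : forall w, base_at Bs (Cv * japan w ^+ m) (Ck / japan w) w).

(** Per factor [p]: [(D Ck)^m] from at most [p m] orders, [Cv] from the size of the bases, [e^2]
    from using [p^i <= e^p i!] twice, [C0] from [Mh_lower], and 4 to leave the decay [4^-p]. *)
Definition fam_rate : R := 4 * ((D * Ck) ^+ m * Cv * expR 1 ^+ 2 * C0).

Lemma fam_rate_ge1 : 1 <= fam_rate.
Proof.
have e1 : 1 <= expR 1 :> R by rewrite -expR0 ler_expR.
apply: mulr_ege1; first by rewrite ler1n.
by rewrite !(mulr_ege1, exprn_ege1).
Qed.

(** Write [p m = i + q]. The powers of [<w>] left after the order [i] is spent are [<w>^q], and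
    [(p m)!^s >= i!^s q!^s]. Hence [q!^s] turns [<w>^q] into the exponential of [M], the surplus of
    [i!^s] over [i!] absorbs the geometric factors of order [i], and [p^(size l)] is paid by
    [(size l)!] and [e^p]. *)
Lemma fam_symb_at L : 0 <= L -> growth fam_rate L ->
  exists K, forall p, symb_bound M L (K * 2 ^- p) (fam_term p).
Proof.
move=> L0 [CM [CM0 CMP]].
have X1 := fam_rate_ge1; have X0 : 0 <= fam_rate by exact: le_trans X1.
have [K1 [K10 K1P]] := fact_absorb s1 X0.
exists (m.+1%:R * K1 * CM) => p l w.
set J := japan w; have J1 : 1 <= J by exact: japan_ge1.
have J0 : 0 < J by exact: lt_le_trans J1.
set E := expR (assoc_fun M _); have E0 : 0 <= E by exact: expR_ge0.
have Cv0 : 0 <= Cv by exact: le_trans Cv1.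
have Ck0 : 0 <= Ck by exact: le_trans Ck1.
have C00 : 0 <= C0 by exact: le_trans C01.
have term i : `|pders l (f p i) w / Mh p| * J ^+ size l <=
    (size l)`!%:R * (4 ^- p * (K1 * (CM * E))).
  have [H1 H2] := @fam_eval (Cv * J ^+ m) (Ck / J) w l p i
    (mulr_ge0 Cv0 (exprn_ge0 _ (ltW J0))) (divr_ge0 Ck0 (ltW J0)) (BsG w).
  have [ile|ile] := leqP (i + size l) (p * m); last first.
    by rewrite H2// mul0r normr0 mul0r !mulr_ge0 ?invr_ge0 ?exprn_ge0.
  have ipm : (i <= p * m)%N by exact: leq_trans (leq_addr _ _) ile.
  set q := (p * m - i)%N; have pmE : (p * m = i + q)%N by rewrite /q subnKC.
  rewrite normrM [`|(Mh p)^-1|]ger0_norm ?invr_ge0 ?(ltW (Mh0 p))//.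
  have B1 : `|pders l (f p i) w| * J ^+ size l <=
      (size l)`!%:R * (i`!%:R * ((D * Ck) ^+ m * Cv * expR 1 ^+ 2) ^+ p * J ^+ q).
    apply: (le_trans (ler_wpM2r (exprn_ge0 _ (ltW J0)) H1)).
    have JE : (J ^+ m) ^+ p = J ^+ i * J ^+ q.
      by rewrite -exprM mulnC pmE exprD.
    rewrite [leLHS](_ : _ = (D * Ck) ^+ (i + size l) * (p%:R ^+ i * p%:R ^+ size l) *
       Cv ^+ p * J ^+ q); last first.
      rewrite [(Cv * _) ^+ p]exprMn JE.
      have -> : (D * (Ck / J) * p%:R) ^+ (i + size l) =
        (D * Ck) ^+ (i + size l) * (p%:R ^+ i * p%:R ^+ size l) / (J ^+ i * J ^+ size l).
        by rewrite -!exprD -exprVn -!exprMn; congr (_ ^+ _); ring.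
      by field; rewrite !expf_neq0 ?gt_eqF.
    have e1 : p%:R ^+ i * p%:R ^+ size l <= (expR 1 ^+ 2) ^+ p * (i`!%:R * (size l)`!%:R) :> R.
      have ep k : p%:R ^+ k <= expR 1 ^+ p * k`!%:R :> R.
        by rewrite -expRM_natl mulr1; exact: exp_le_fact.
      have -> : (expR 1 ^+ 2) ^+ p * (i`!%:R * (size l)`!%:R) =
        (expR 1 ^+ p * i`!%:R) * (expR 1 ^+ p * (size l)`!%:R) :> R.
        by rewrite -exprM mulnC exprM; ring.
      by rewrite ler_pM ?exprn_ge0.
    have e2 : (D * Ck) ^+ (i + size l) <= ((D * Ck) ^+ m) ^+ p.
      by rewrite -exprM mulnC ler_weXn2l// mulr_ege1.
    apply: (@le_trans _ _ (((D * Ck) ^+ m) ^+ p * ((expR 1 ^+ 2) ^+ p * (i`!%:R * (size l)`!%:R)) *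
       Cv ^+ p * J ^+ q)).
      rewrite ler_wpM2r ?exprn_ge0 ?(ltW J0)// ler_wpM2r ?exprn_ge0//.
      by rewrite ler_pM ?mulr_ge0 ?exprn_ge0 ?mulr_ge0.
    rewrite le_eqVlt; apply/orP; left; apply/eqP; rewrite !exprMn; ring.
  have B2 : (Mh p)^-1 <= C0 ^+ p / (fp i * fp q).
    apply: (le_trans (Mh_lower Mh0 Mh00 MhC p)); rewrite ler_wpM2l ?exprn_ge0//.
    rewrite lef_pV2 ?posrE ?mulr_gt0 ?fp_gt0// pmE.
    exact: fp_mul_le.
  rewrite mulrAC; apply: (@le_trans _ _ ((size l)`!%:R * (i`!%:R *
     ((D * Ck) ^+ m * Cv * expR 1 ^+ 2) ^+ p * J ^+ q) * (C0 ^+ p / (fp i * fp q)))).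
    by rewrite ler_pM ?mulr_ge0 ?exprn_ge0 ?invr_ge0 ?(ltW J0) ?(ltW (Mh0 p)).
  rewrite -mulrA ler_wpM2l//.
  set Y := (D * Ck) ^+ m * Cv * expR 1 ^+ 2 * C0.
  have Y0 : 0 <= Y by rewrite !mulr_ge0 ?exprn_ge0 ?mulr_ge0 ?expR_ge0.
  rewrite [leLHS](_ : _ = 4 ^- p * (fam_rate ^+ p * (i`!%:R * J ^+ q / (fp i * fp q)))); last first.
    have -> : fam_rate ^+ p = 4 ^+ p * Y ^+ p by rewrite -exprMn.
    have -> : Y ^+ p = ((D * Ck) ^+ m * Cv * expR 1 ^+ 2) ^+ p * C0 ^+ p by rewrite -exprMn.
    have h4 : (4 : R) ^+ p != 0 by rewrite expf_neq0.
    by field; rewrite ?gt_eqF ?fp_gt0.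
  rewrite ler_wpM2l ?invr_ge0 ?exprn_ge0//.
  apply: (@le_trans _ _ ((fam_rate ^+ i * i`!%:R / fp i) * ((fam_rate * J) ^+ q / fp q))).
    apply: (@le_trans _ _ (fam_rate ^+ (i + q) * (i`!%:R * J ^+ q / (fp i * fp q)))).
      rewrite ler_wpM2r ?divr_ge0 ?mulr_ge0 ?exprn_ge0 ?(ltW J0) ?powR_ge0//.
      by rewrite ler_weXn2l// -pmE leq_pmulr.
    rewrite le_eqVlt; apply/orP; left; apply/eqP.
    by rewrite [fam_rate ^+ (i + q)]exprD [(fam_rate * J) ^+ q]exprMn invfM; ring.
  apply: ler_pM; last by apply: CMP; exact: ltW.
  - by apply: divr_ge0; [apply: mulr_ge0; [exact: exprn_ge0|exact: ler0n]|exact: powR_ge0].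
  - by apply: divr_ge0; [apply/exprn_ge0/mulr_ge0 => //; exact: ltW|exact: powR_ge0].
  - exact: K1P.
rewrite pders_fam_term.
apply: (@le_trans _ _ (\sum_(e <= i < (p * m).+1) (size l)`!%:R * (4 ^- p * (K1 * (CM * E))))).
  rewrite -[leLHS]mulr1 -[leLHS]mulrA mulr1.
  apply: (@le_trans _ _ ((\sum_(e <= i < (p * m).+1) `|pders l (f p i) w / Mh p|) * J ^+ size l)).
    by rewrite ler_wpM2r ?exprn_ge0 ?(ltW J0)// ler_norm_sum.
  by rewrite mulr_suml; apply: ler_sum => i _; exact: term.
set T := (size l)`!%:R * _; have T0 : 0 <= T.
  by rewrite !mulr_ge0// invr_ge0 exprn_ge0.
rewrite big_const_nat iter_addr_0 -[leLHS]mulr_natr.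
(* There are at most [p m + 1 <= (m + 1) 2^p] orders; half of the decay [4^-p] pays for them. *)
apply: (@le_trans _ _ (T * (m.+1%:R * 2 ^+ p))).
  rewrite ler_wpM2l// -natrX -natrM ler_nat (leq_trans (leq_subr _ _))//.
  by rewrite mulSn -add1n leq_add ?expn_gt0// mulnC leq_mul2l (ltnW (ltn_expl p (ltnSn 1))) orbT.
have -> : T = (size l)`!%:R * ((2 ^- p * 2 ^- p) * (K1 * (CM * E))).
  have E4 : 4 = 2 * 2 :> R by ring.
  by rewrite /T {1}E4 exprMn invfM.
rewrite le_eqVlt; apply/orP; left; apply/eqP; field.
by rewrite expf_neq0.
Qed.

Lemma fam_symb_seq : symb_seq M beur fam_term.
Proof.
have X0 : 0 <= fam_rate by exact: le_trans fam_rate_ge1.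
move: grow; rewrite /symb_seq; case: beur => [/(_ _ X0)[L [L0 G]]|/(_ _ X0) G L L0].
  by exists L; split => //; exact: fam_symb_at (ltW L0) G.
exact: fam_symb_at (ltW L0) (G L L0).
Qed.

Lemma fam_summable : locally_summable fam_term.
Proof. exact: (symb_seq_summable M0 Mexp fam_term_sm fam_symb_seq). Qed.

(* On the region [W] where the base functions are controlled by a positive
   symbol [v] of order [m], the [y]-scale of the moment lemma is [<w>^(1/s)],
   so that each order costs [<w>^(1/s - 1)], which is less than [<w>^(-rho)]. *)
Section Region.
Variables (rho : R) (W : V -> Prop) (v : V -> R) (Cw : R).
Hypotheses (rhos : s^-1 < 1 - rho) (rho0 : 0 <= rho) (Cw1 : 1 <= Cw)
  (v0 : forall w, W w -> 0 <= v w <= Cw * japan w ^+ m)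
  (BsW : forall w, W w -> base_at Bs (v w) (Ck / japan w) w).

Lemma fam_region : exists C B : R, 1 <= C /\ 0 < B /\ forall w l, W w -> B <= japan w ->
  `|pders l (fseries fam_term) w| <=
    (C / japan w `^ rho) ^+ (e + size l) * (4 * Pser Mh (v w)).
Proof.
have s0 : 0 < s by exact: lt_trans ltr01 s1.
have m0 : (0 : R) < m%:R by rewrite ltr0n.
have mR : (1 : R) <= m%:R by rewrite ler1n.
pose sg := m%:R * s; have sg0 : 0 < sg by rewrite mulr_gt0.
have sg1 : 1 <= sg by rewrite mulr_ege1// ltW.
have msg : m%:R <= sg by rewrite ler_peMr// ltW.
have Ck0 : 0 <= Ck by exact: le_trans Ck1.
pose Cy := C0 * Cw; have Cy1 : 1 <= Cy by rewrite mulr_ege1.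
have Cy0 : 0 <= Cy by exact: le_trans Cy1.
pose C := moment_const sg * Cy * D * Ck.
have E1 : 1 <= moment_const sg by rewrite -expR0 ler_expR addr_ge0// ltW.
have C1 : 1 <= C by rewrite /C !mulr_ege1.
have C0' : 0 <= C by exact: le_trans C1.
pose dl := 1 - s^-1; have dl0 : 0 < dl by rewrite subr_gt0 (lt_le_trans rhos)// gerBl.
(* Chosen so that [C <w>^(-dl) <= 1/2] for [<w> >= B], the smallness that [family_sum] requires. *)
pose B := (2 * C) `^ dl^-1.
have C20 : 0 < 2 * C by rewrite mulr_gt0// (lt_le_trans ltr01).
exists C, (1 + B); split => //; split; first by rewrite ltr_pwDl ?powR_ge0.
move=> w l Ww Bj; set J := japan w.
have J1 : 1 <= J by exact: japan_ge1.
have J0 : 0 < J by exact: lt_le_trans J1.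
have /andP[vw0 vwC] := v0 Ww.
(* Since [v(w) <= Cw <w>^m], this gives [y^(m s) >= C0 v(w)], the hypothesis of [coef_ratio]. *)
pose y := Cy * J `^ s^-1.
have y1 : 1 <= y.
  by rewrite mulr_ege1// -[leLHS](powRr0 J) ler_powR// invr_ge0 ltW.
have y0 : 0 <= y by exact: le_trans y1.
have vy : C0 * v w <= y `^ sg.
  apply: (@le_trans _ _ (Cy * J ^+ m)).
    by rewrite /Cy -mulrA ler_wpM2l// (le_trans ler01).
  rewrite powRM ?powR_ge0// -powRrM.
  have -> : s^-1 * sg = m%:R by rewrite /sg mulrCA mulVf ?mulr1// gt_eqF.
  rewrite powR_mulrn ?(ltW J0)// ler_wpM2r ?exprn_ge0 ?(ltW J0)//.
  by rewrite -[leLHS]powRr1//; apply: ler_powR.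
pose t p := v w ^+ p / Mh p.
have t0 p : 0 <= t p by rewrite divr_ge0 ?exprn_ge0 ?(ltW (Mh0 p)).
have tS p : t p.+1 <= t p * (y / p.+1%:R) `^ sg by apply: (coef_ratio m1 s1 C01 Mh0 MhC).
have tP N : \sum_(0 <= p < N) t p <= Pser Mh (v w).
  exact: (Pser_partial m1 s1 C01 Mh0 Mh00 MhC).
have P0 : 0 <= Pser Mh (v w) by apply: le_trans (tP 0%N); rewrite big_geq.
pose kap := D * (Ck / J).
have kap0 : 0 <= kap by rewrite mulr_ge0// divr_ge0// ltW.
have thE : moment_const sg * y * kap = C * J `^ (- dl).
  have -> : J `^ (- dl) = J `^ s^-1 / J.
    rewrite /dl opprB powRD; last by rewrite (gt_eqF J0) implybT.
    by rewrite powR_inv1// ltW.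
  by rewrite /C /kap /y; ring.
have th2 : moment_const sg * y * kap <= 2^-1.
  rewrite thE powRN ler_pdivrMr ?powR_gt0// -ler_pdivrMl ?invr_gt0// invrK.
  have -> : 2 * C = B `^ dl.
    by rewrite /B -powRrM mulVf ?gt_eqF// powRr1// ltW.
  apply: ge0_ler_powR; rewrite ?nnegrE ?powR_ge0 ?(ltW dl0) ?(ltW J0)//.
  by apply: le_trans Bj; rewrite lerDr.
pose x p i := pders l (f p i) w / Mh p.
have xev p i := @fam_eval (v w) (Ck / J) w l p i vw0 (divr_ge0 Ck0 (ltW J0)) (BsW Ww).
have xb p i : `|x p i| <= (kap * p%:R) ^+ (i + size l) * t p.
  have [H _] := xev p i.
  rewrite normrM [`|(Mh p)^-1|]ger0_norm ?invr_ge0 ?(ltW (Mh0 p))//.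
  by rewrite /t mulrA ler_wpM2r ?invr_ge0 ?(ltW (Mh0 p)).
have xz p i : (p * m < i + size l)%N -> x p i = 0.
  by move=> h; rewrite /x (xev p i).2// mul0r.
have := fun N => @family_sum R t y sg t0 y1 sg0 tS x kap m (size l) e N _ kap0 msg th2 xb xz tP.
rewrite fseries_pders; last exact: fam_summable.
rewrite /fseries (_ : (fun k => pders l (fam_term k) w) =
  fun k => \sum_(e <= i < (k * m).+1) x k i); last first.
  by apply/funext => k; exact: pders_fam_term.
move=> H; apply: (le_trans (series_bounded H).2).
rewrite ler_wpM2r ?mulr_ge0//.
have th0 : 0 <= C * J `^ (- dl) by rewrite mulr_ge0 ?powR_ge0.
rewrite thE lerXn2r ?nnegrE ?divr_ge0 ?powR_ge0//.
rewrite ler_wpM2l// -powRN; apply: ler_powR => //.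
by rewrite lerN2 lerBrDr -lerBrDl ltW.
Qed.

End Region.
End GlobalBound.
End Families.

(** * Elliptic polynomials *)

Section Polynomials.
Variables (R : realType) (n : nat).
Local Notation V := 'rV[R]_n.
Implicit Types (w : V).

Definition coord_base (e : nat) (b : V -> R) := e = 0%N /\ exists i, b = fun w => w 0 i.

Lemma pders_coord l i : pders l (fun w : V => w 0 i) =
  match l with [::] => fun w => w 0 i | [:: j] => fun=> (j == i)%:R | _ => fun=> 0 end.
Proof.
case/lastP: l => // l j; rewrite -cats1 pders_cat /=.
have -> : pdr j (fun w : V => w 0 i) = fun=> (j == i)%:R.
  by apply/funext => w; exact: pdr_coord.
by rewrite pders_cst; case: l => [|k [|k' l]].
Qed.

Lemma sm_coord_base e b : coord_base e b -> sm b.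
Proof.
move=> [_ [i ->]] l w; rewrite pders_coord.
case: l => [|j [|? ?]]; [exact: differentiable_coord|exact: differentiable_cst|exact: differentiable_cst].
Qed.

(** A coordinate is a symbol of order 1. This is the input of [dmono_eval] with [v = <w>],
    [k = 1 / <w>] and 1 for [m], so the calculus of products also yields the bounds for
    monomials. *)
Lemma coord_base_eval w e b l : coord_base e b ->
  `|pders l b w| <= japan w * (japan w)^-1 ^+ (e + size l) /\
  ((1 < e + size l)%N -> pders l b w = 0).
Proof.
move=> [-> [i ->]]; rewrite pders_coord add0n.
have J0 := japan_gt0 w.
case: l => [|j [|? ?]] /=.
- by split=> //; rewrite expr0 mulr1 (le_trans (coord_le_enorm w i))// enorm_le_japan.
- rewrite expr1 divff ?(lt0r_neq0 J0)//; split=> //.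
  by case: (j == i); rewrite ?normr1 ?normr0.
- by split=> //; rewrite normr0 mulr_ge0 ?exprn_ge0 ?invr_ge0 ?(ltW J0).
Qed.

Lemma mono_dmono k (g : {ffun 'I_n -> 'I_k}) :
  dmono coord_base (mdeg g) 0 1 (fun w => mono w g).
Proof.
rewrite /mdeg /mono; elim: (index_enum 'I_n) => [|i r IH].
  rewrite big_nil; under [X in dmono _ _ _ _ X]eq_fun do rewrite big_nil.
  exact: dmono_one.
rewrite big_cons; under [X in dmono _ _ _ _ X]eq_fun do rewrite big_cons.
have H : dmono coord_base 1 0 1 (fun w : V => w 0 i).
  by apply: (@dmono_base _ _ coord_base 0 (fun w : V => w 0 i) [::]); split => //; exists i.
have := dmono_exp (g i) H; rewrite muln1 muln0 expr1n => Hi.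
by have := dmono_mul Hi IH; rewrite mul1r.
Qed.

Lemma mono_sm k (g : {ffun 'I_n -> 'I_k}) : sm (fun w : V => mono w g).
Proof. exact: dmono_sm sm_coord_base _ _ _ _ (mono_dmono g). Qed.

Lemma mono_eval k (g : {ffun 'I_n -> 'I_k}) l w (q : nat) : (mdeg g <= q)%N ->
  `|pders l (fun w : V => mono w g) w| <=
    q.+1%:R ^+ q * japan w ^+ q * (japan w)^-1 ^+ size l /\
  ((q < size l)%N -> pders l (fun w : V => mono w g) w = 0).
Proof.
move=> gq; have J1 := japan_ge1 w; have J0 := japan_gt0 w.
have iJ0 : 0 <= (japan w)^-1 by rewrite invr_ge0 ltW.
have [H1 H2] := dmono_eval (ltW J0) iJ0 (@coord_base_eval w) (dmono_pders sm_coord_base l (mono_dmono g)).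
rewrite add0n muln1 mulr1 in H1 H2.
have [lg|gl] := leqP (size l) (mdeg g); last first.
  by rewrite H2// normr0 !mulr_ge0 ?exprn_ge0// ltW.
split; last by move=> ql; have := leq_ltn_trans (leq_trans lg gq) ql; rewrite ltnn.
apply: (le_trans H1); rewrite ler_wpM2r ?exprn_ge0// ler_pM ?exprn_ge0 ?(ltW J0)//.
  (* The base is [q + 1] because raising the exponent to [q] needs a base of at least 1, also for
     [q = 0]. *)
  apply: (@le_trans _ _ (q.+1%:R ^+ size l)).
    by rewrite lerXn2r ?nnegrE// ler_nat (leq_trans gq).
  by rewrite ler_weXn2l ?ler1n// (leq_trans lg).
by rewrite ler_weXn2l.
Qed.

Lemma poly_sm k (c : {ffun 'I_n -> 'I_k} -> R) (P : pred {ffun 'I_n -> 'I_k}) :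
  sm (fun w : V => \sum_(g | P g) c g * mono w g).
Proof. by apply: sm_sum => g; apply: smZ; exact: mono_sm. Qed.

Lemma poly_bound k (c : {ffun 'I_n -> 'I_k} -> R) (P : pred {ffun 'I_n -> 'I_k}) (q : nat) :
  (forall g, P g -> (mdeg g <= q)%N) -> exists C : R, 1 <= C /\ forall l w,
  `|pders l (fun w : V => \sum_(g | P g) c g * mono w g) w| <=
    C * japan w ^+ q * (japan w)^-1 ^+ size l /\
  ((q < size l)%N -> pders l (fun w : V => \sum_(g | P g) c g * mono w g) w = 0).
Proof.
move=> Pq; exists (1 + \sum_(g | P g) `|c g| * q.+1%:R ^+ q).
have S0 : 0 <= \sum_(g | P g) `|c g| * (q.+1%:R : R) ^+ q.
  by apply: sumr_ge0 => g _; rewrite mulr_ge0.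
split; first by rewrite lerDl.
move=> l w; have J0 := japan_gt0 w.
rewrite pders_sum; last by move=> g; apply: smZ; exact: mono_sm.
split; last first.
  move=> ql; apply: big1 => g Pg; rewrite pdersZ; last exact: mono_sm.
  by rewrite (mono_eval l w (Pq g Pg)).2// mulr0.
apply: (@le_trans _ _ ((\sum_(g | P g) `|c g| * q.+1%:R ^+ q) * (japan w ^+ q * (japan w)^-1 ^+ size l))).
  rewrite mulr_suml; apply: (le_trans (ler_norm_sum _ _ _)); apply: ler_sum => g Pg.
  rewrite pdersZ; last exact: mono_sm.
  rewrite normrM -mulrA ler_wpM2l// mulrA; exact: (mono_eval l w (Pq g Pg)).1.
by rewrite -mulrA ler_wpM2r ?lerDr// mulr_ge0 ?exprn_ge0 ?invr_ge0 ?(ltW J0).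
Qed.

End Polynomials.

(** * Lower bounds for elliptic polynomials *)

Section Elliptic.
Variables (R : realType) (n m : nat) (c : {ffun 'I_n -> 'I_m.+1} -> R).
Local Notation V := 'rV[R]_n.
Implicit Types (w : V).

Definition poly_lower w := \sum_(g : {ffun 'I_n -> 'I_m.+1} | (mdeg g < m)%N) c g * mono w g.

Lemma poly_split w : poly_eval c w = poly_princ c w + poly_lower w.
Proof.
rewrite /poly_eval (bigID (fun g => mdeg g == m))/=; congr (_ + _).
  by apply: eq_bigl => g; case: eqVneq => [->|]; rewrite ?leqnn ?andbF.
by apply: eq_bigl => g; rewrite ltn_neqAle andbC.
Qed.

Lemma mono_scale k (t : R) w (g : {ffun 'I_n -> 'I_k}) :
  mono (t *: w) g = t ^+ mdeg g * mono w g.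
Proof.
rewrite /mono /mdeg.
under eq_bigr do rewrite mxE exprMn.
by rewrite big_split/= prodrXr.
Qed.

Lemma princ_scale (t : R) w : poly_princ c (t *: w) = t ^+ m * poly_princ c w.
Proof.
rewrite /poly_princ mulr_sumr; apply: eq_bigr => g /eqP gm.
by rewrite mono_scale gm; ring.
Qed.

Hypotheses (n0 : (0 < n)%N) (m1 : (1 <= m)%N) (ell : elliptic_shubin c).

(** The minimum over the compact unit sphere of the maximum norm is positive by ellipticity;
    homogeneity of degree [m] extends the bound to all [w]. *)
Lemma princ_sphere : exists c1 : R, 0 < c1 /\ forall w, c1 * `|w| ^+ m <= `|poly_princ c w|.
Proof.
have cP : continuous (fun w => `|poly_princ c w|).
  move=> w; apply: continuous_comp; last exact: norm_continuous.
  exact/differentiable_continuous/(poly_sm c (fun g => mdeg g == m) [::]).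
pose S := [set w : V | `|w| = 1].
have Sne : S !=set0.
  pose e : V := const_mx 1; exists e; rewrite /S /=; apply/eqP; rewrite eq_le; apply/andP; split.
    rewrite /Num.norm /= mx_normrE; apply/bigmax_leP; split => // -[i j] _ /=.
    by rewrite mxE normr1.
  by have := norm_coord e (Ordinal n0); rewrite mxE normr1.
have Scl : closed S.
  rewrite (_ : S = (fun w : V => `|w|) @^-1` [set 1]) //.
  apply: closed_comp; last exact: closed_eq.
  by move=> w _; exact: norm_continuous.
have Sb : bounded_set S.
  exists 1; split; first exact: num_real.
  by move=> M M1 w /= ->; exact: ltW.
have Sc := bounded_closed_compact Sb Scl.
have [w0 w0S w0min] := EVT_min_rV Sne Sc (continuous_subspaceT cP).
have w01 : `|w0| = 1 by move: w0S; rewrite inE.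
have w0n : w0 != 0 by rewrite -normr_gt0 w01.
exists `|poly_princ c w0|; split; first by rewrite normr_gt0; exact: ell.
move=> w; have [->|wn] := eqVneq w 0.
  by rewrite normr0 expr0n gtn_eqF// mulr0.
have wN : `|w| != 0 by rewrite normr_eq0.
have wE : w = `|w| *: (`|w|^-1 *: w) by rewrite scalerA divff// scale1r.
rewrite {2}wE princ_scale normrM normrX normr_id mulrC ler_wpM2l ?exprn_ge0//.
apply: w0min; rewrite inE /S /= normrZ ger0_norm ?invr_ge0// mulVf//.
Qed.

(** The lower order part is at most half the lower bound of the modulus of the principal part once
    [<w>] is large. A negative principal part would then make the polynomial negative, so its
    positivity on [W] also fixes the sign of the principal part. *)
Lemma elliptic_lower (W : V -> Prop) : (forall w, W w -> 0 < poly_eval c w) ->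
  exists cl B : R, 0 < cl /\ 0 < B /\ forall w, W w -> B <= japan w ->
    cl * japan w ^+ m <= poly_eval c w /\ cl * japan w ^+ m <= poly_princ c w.
Proof.
move=> aW; have [c1 [c10 c1P]] := princ_sphere.
have deg_lower (g : {ffun 'I_n -> 'I_m.+1}) : (mdeg g < m)%N -> (mdeg g <= m.-1)%N.
  by move=> gm; rewrite -ltnS prednK.
have [C [C1 CP]] := poly_bound c deg_lower.
have C0 : 0 <= C by exact: le_trans C1.
have nR : (0 : R) < n%:R by rewrite ltr0n.
(* For [<w> >= 2], the inequality [<w> <= 1 + n |w|] improves to [<w> <= 2 n |w|]. *)
pose c2 := c1 / (2 * n%:R) ^+ m.
have c20 : 0 < c2 by rewrite divr_gt0// exprn_gt0// mulr_gt0.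
(* From [<w> >= 2 C / c2] on, the lower part [C <w>^(m-1)] is at most [(c2 / 2) <w>^m]. *)
exists (c2 / 2), (2 + 2 * C / c2); split; first by rewrite divr_gt0.
split; first by rewrite ltr_pwDl// divr_ge0 ?mulr_ge0// ltW.
move=> w Ww Bw; have J1 := japan_ge1 w; have J0 := japan_gt0 w.
have J2 : 2 <= japan w.
  by apply: le_trans Bw; rewrite lerDl divr_ge0 ?mulr_ge0// ltW.
have JC : 2 * C / c2 <= japan w by apply: le_trans Bw; rewrite lerDr.
have Jm : 0 < japan w ^+ m by rewrite exprn_gt0.
have p1 : c2 * japan w ^+ m <= `|poly_princ c w|.
  apply: le_trans (c1P w).
  rewrite /c2 -mulrA ler_wpM2l ?(ltW c10)// mulrC -expr_div_n lerXn2r ?nnegrE//.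
    by rewrite divr_ge0 ?mulr_ge0// ltW.
  rewrite ler_pdivrMr ?mulr_gt0//; have := japan_le_norm w; lra.
have l1 : `|poly_lower w| <= c2 / 2 * japan w ^+ m.
  have := (CP [::] w).1; rewrite /= expr0 mulr1 => h; apply: (le_trans h).
  rewrite -{2}(prednK m1) exprS mulrA ler_wpM2r ?exprn_ge0 ?(ltW J0)//.
  by move: JC; rewrite ler_pdivrMr//; lra.
have ap := aW w Ww; have aE := poly_split w.
have c2J : 0 < c2 * japan w ^+ m by rewrite mulr_gt0.
move: l1 p1; rewrite [c2 / 2 * _]mulrAC.
set X := c2 * _; move=> /ler_normlP[l1 l2] p1.
have [p0|p0] := leP 0 (poly_princ c w).
  rewrite (ger0_norm p0) in p1; rewrite aE.
  by split; lra.
rewrite (ltr0_norm p0) in p1.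
exfalso; lra.
Qed.

End Elliptic.

(** * Sharp powers *)

Section SharpPowers.
Variables (R : realType) (d m : nat).
Local Notation V := 'rV[R]_(d + d).
Local Notation mult L := {ffun 'I_d -> 'I_L.+1}.
Implicit Types (w : V) (f h : V -> R).

Definition nat_mult L (al : mult L) : 'I_d -> nat := fun i => al i.

Definition bidiff_coef L (al be : mult L) : R :=
  (-1) ^+ mabs (nat_mult be) / ((mfact (nat_mult al) * mfact (nat_mult be) * 2 ^ L)%N)%:R.

(** The order [L] part of the sharp product with [D] replaced by the plain derivatives; only a
    factor of modulus 1 is lost, and the operator becomes real. *)
Definition bidiff L f h : V -> R := fun w =>
  \sum_(al : mult L) \sum_(be : mult L | (mabs (nat_mult al) + mabs (nat_mult be) == L)%N)
    bidiff_coef al be * pders (xi_seq (nat_mult al) ++ x_seq (nat_mult be)) f w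
      * pders (xi_seq (nat_mult be) ++ x_seq (nat_mult al)) h w.

Lemma bidiff_coef_le1 L (al be : mult L) : `|bidiff_coef al be| <= 1.
Proof.
rewrite normrM normrX normrN1 expr1n mul1r ger0_norm ?invr_ge0//.
rewrite invf_le1 ?ltr0n ?ler1n !muln_gt0 expn_gt0 !prodn_gt0// => i; exact: fact_gt0.
Qed.

Lemma leq_expW (a b k : nat) : (a <= b)%N -> (a ^ k <= b ^ k)%N.
Proof. by case: k => // k ab; rewrite leq_exp2r. Qed.

(** There are at most [(L + 1)^(2 d) <= 4^(d L)] pairs of multi-indices, the coefficients are at
    most 1 in modulus, and [L] derivatives of a product of [p] factors cost [p^L]; the single factor
    [h] costs nothing. *)
Lemma bidiff_dmono (B : nat -> (V -> R) -> Prop) L f h p j X :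
  (forall e b, B e b -> sm b) -> dmono B p j X f -> dmono B 1 0 1 h ->
  dmono B p.+1 (j + 2 * L) ((4 ^ d)%:R ^+ L * p%:R ^+ L * X) (bidiff L f h).
Proof.
move=> smB df dh; have X0 := dmono_ge0 df.
have c0 : 0 <= p%:R ^+ L * X by rewrite mulr_ge0 ?exprn_ge0.
apply: (@dmono_le _ _ _ _ _ (\sum_(al : mult L)
  \sum_(be : mult L | (mabs (nat_mult al) + mabs (nat_mult be) == L)%N) p%:R ^+ L * X)).
  apply: (@le_trans _ _ (\sum_(al : mult L) \sum_(be : mult L) p%:R ^+ L * X)).
    apply: ler_sum => al _; rewrite big_mkcond; apply: ler_sum => be _.
    by case: ifP.
  rewrite !sumr_const card_ffun !card_ord -mulrnA -[leLHS]mulr_natl -[leRHS]mulrA ler_wpM2r//.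
  rewrite -natrX ler_nat -expnMn -expnM mulnC expnM leq_expW//.
  by rewrite (_ : 4 = 2 * 2)%N// expnMn leq_mul// ltn_expl.
apply: dmono_sum => al _; apply: dmono_sum => be /eqP alL.
have sz : size (xi_seq (nat_mult al) ++ x_seq (nat_mult be)) = L by rewrite size_xi_x_seq.
have sz' : size (xi_seq (nat_mult be) ++ x_seq (nat_mult al)) = L.
  by rewrite size_xi_x_seq addnC.
have := dmono_pders smB (xi_seq (nat_mult al) ++ x_seq (nat_mult be)) df.
have := dmono_pders smB (xi_seq (nat_mult be) ++ x_seq (nat_mult al)) dh.
rewrite sz sz' expr1n mulr1 add0n => d2 /(dmono_scale (bidiff_coef al be)) d1.
have := dmono_mul d1 d2; rewrite addn1 mulr1.
have -> : (j + L + L = j + 2 * L)%N by lia.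
by apply: dmono_le; rewrite ler_piMl// bidiff_coef_le1.
Qed.

Lemma geom_binomial (N j : nat) : (\sum_(s < j.+1) N ^ s <= N.+1 ^ j)%N.
Proof.
elim: j => [|j IH]; first by rewrite big_ord_recl big_ord0.
rewrite big_ord_recl expn0 expnS mulSn.
under eq_bigr do rewrite /= expnS.
rewrite -big_distrr/= leq_add ?expn_gt0// leq_mul2l IH orbT//.
Qed.

(* The [k]-th term of [a^{# (p + 1)}] is ['i ^- k * sharp_coef a p k]. The index
   [j - s - 0] matches the summand [k = 0] in the definition of [sharp]. *)
Fixpoint sharp_coef (a : V -> R) (p : nat) : nat -> V -> R :=
  match p with
  | 0 => fun k => if k == 0%N then a else fun=> 0
  | p'.+1 => fun j w => \sum_(s < j.+1) bidiff (j - s - 0) (sharp_coef a p' s) a w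
  end.

Definition single_base (a : V -> R) (e : nat) (b : V -> R) := e = 0%N /\ b = a.

Lemma single_base_sm a : sm a -> forall e b, single_base a e b -> sm b.
Proof. by move=> sa e b [_ ->]. Qed.

Lemma single_base_dmono a : dmono (single_base a) 1 0 1 a.
Proof. exact: (@dmono_base _ _ (single_base a) 0 a [::]). Qed.

(** In the induction the exponents of [4^d] add up to [k], and those of [p + 1] to [k + s]. The sum
    over [s] of [(p + 1)^s] is at most [(p + 2)^k], so each of the [k] steps costs two factors
    [p + 2], in keeping with its derivative order 2. *)
Lemma sharp_coef_dmono a p k : sm a ->
  dmono (single_base a) p.+1 (2 * k) (((4 ^ d) * p.+1 ^ 2)%:R ^+ k) (sharp_coef a p k).
Proof.
move=> sa; elim: p k => [|p IH] k /=.
  case: eqP => [->|k0]; first by rewrite expr0; exact: single_base_dmono.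
  by apply: (dmono_le _ (dmono_zero _ _ _)); exact: exprn_ge0.
have step (s : 'I_k.+1) : dmono (single_base a) p.+2 (2 * k)
    ((4 ^ d)%:R ^+ (k - s) * p.+1%:R ^+ (k - s) * ((4 ^ d) * p.+1 ^ 2)%:R ^+ s)
    (bidiff (k - s - 0) (sharp_coef a p s) a).
  have := bidiff_dmono (k - s - 0) (single_base_sm sa) (IH s) (single_base_dmono a).
  have sk : (s <= k)%N by rewrite -ltnS.
  by rewrite -mulnDr subn0 subnKC.
apply: (dmono_le _ (dmono_sum (P := xpredT) _ (fun s _ => step s))).
rewrite [leLHS](_ : _ = (\sum_(s < k.+1) (4 ^ d) ^ (k - s) * p.+1 ^ (k - s) * ((4 ^ d) * p.+1 ^ 2) ^ s)%N%:R); last first.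
  by rewrite natr_sum; apply: eq_bigr => s _; rewrite !(natrM, natrX).
rewrite -natrX ler_nat.
apply: (@leq_trans (\sum_(s < k.+1) (4 ^ d) ^ k * (p.+1 ^ k * p.+1 ^ s))%N).
  apply: leq_sum => s _; have sk : (s <= k)%N by rewrite -ltnS.
  have kE x : (x ^ k = x ^ (k - s) * x ^ s)%N by rewrite -expnD subnK.
  rewrite (kE (4 ^ d)%N) (kE p.+1) expnMn -[((p.+1 ^ 2) ^ s)%N]expnM mul2n -addnn expnD.
  by rewrite mulnACA !mulnA.
rewrite -!big_distrr/= expnMn leq_mul2l; apply/orP; right.
rewrite -expnM mul2n -addnn expnD leq_mul ?leq_expW//; exact: geom_binomial.
Qed.

Lemma bidiff0 f h : bidiff 0 f h = fun w => f w * h w.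
Proof.
have al0 (al : mult 0) : al = [ffun=> ord0] by apply/ffunP => i; rewrite ffunE ord1.
have n0 (al : mult 0) : nat_mult al = fun=> 0%N.
  by apply/funext => i; rewrite (al0 al) /nat_mult ffunE.
have m0 : mabs (fun _ : 'I_d => 0%N) = 0%N by rewrite /mabs big1.
have f0 : mfact (fun _ : 'I_d => 0%N) = 1%N by rewrite /mfact big1.
have s0 (l : seq 'I_(d + d)) : size l = 0%N -> l = [::] by case: l.
apply/funext => w; rewrite /bidiff.
rewrite (big_pred1 [ffun=> ord0]); last by move=> al; rewrite [al]al0 /= eqxx.
rewrite (big_pred1 [ffun=> ord0]); last by move=> al; rewrite [al]al0 !n0 m0 /= eqxx.
rewrite /bidiff_coef !n0 m0 f0 expr0 !muln1 divr1 mul1r.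
have -> : xi_seq (fun _ : 'I_d => 0%N) = [::] by apply: s0; rewrite size_xi_seq.
by have -> : x_seq (fun _ : 'I_d => 0%N) = [::] by apply: s0; rewrite size_x_seq.
Qed.

Lemma sharp_coef0 a p : sharp_coef a p 0 = fun w => a w ^+ p.+1.
Proof.
elim: p => [|p IH] /=; first by apply/funext => w; rewrite expr1.
apply/funext => w; rewrite big_ord_recl big_ord0 addr0 bidiff0 IH.
by rewrite [RHS]exprSr.
Qed.

Lemma smC_real f : sm f -> smC (fun v => (f v)%:C).
Proof. by move=> sf; split => //; exact: (sm_cst 0). Qed.

Lemma pdersC_real l f : pdersC l (fun v => (f v)%:C) = fun w => (pders l f w)%:C.
Proof.
apply/funext => w; apply: complex_eq => //=.
by rewrite (pders_cst l 0); case: l.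
Qed.

Lemma pdersC_scaled l (z : R[i]) f : sm f ->
  pdersC l (fun v => z * (f v)%:C) = fun w => z * (pders l f w)%:C.
Proof. by move=> sf; rewrite pdersCM ?pdersC_real//; exact: smC_real. Qed.

Lemma smC_scaled (z : R[i]) f : sm f -> smC (fun v => z * (f v)%:C).
Proof. by move=> sf; apply: smCM; exact: smC_real. Qed.

(** The operators [D_x] contribute [i^-|be|] on the left factor and [i^-|al|] on the right one,
    which is [i^-L] for every pair. *)
Lemma bidiff_complex L (z : R[i]) f h w : sm f -> sm h ->
  \sum_(al : mult L) \sum_(be : mult L | (mabs (nat_mult al) + mabs (nat_mult be) == L)%N)
     (((-1) ^+ mabs (nat_mult be)) / ((mfact (nat_mult al) * mfact (nat_mult be) * 2 ^ L)%N)%:R)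
        * pxi (nat_mult al) (Dx (nat_mult be) (fun v => z * (f v)%:C)) w
        * pxi (nat_mult be) (Dx (nat_mult al) (fun v => (h v)%:C)) w =
  z * 'i ^- L * (bidiff L f h w)%:C.
Proof.
move=> sf sh; rewrite /bidiff rmorph_sum/= mulr_sumr; apply: eq_bigr => al _.
rewrite rmorph_sum/= mulr_sumr; apply: eq_bigr => be /eqP abL.
have cE : (bidiff_coef al be)%:C = (-1) ^+ mabs (nat_mult be) /
    ((mfact (nat_mult al) * mfact (nat_mult be) * 2 ^ L)%N)%:R :> R[i].
  by rewrite /bidiff_coef rmorphM fmorphV rmorphXn rmorphN rmorph1 rmorph_nat.
have gen a b : (a + b)%N = L -> 'i ^- L = 'i ^- a * 'i ^- b :> R[i].
  by move=> <-; rewrite exprD invfM.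
move: (bidiff_coef al be) cE => cc <-; rewrite !rmorphM/=.
rewrite !pxiE !DxE.
have E1 (l l' : seq 'I_(d + d)) (y : R[i]) : pdersC l (fun v => y * pdersC l' (fun v => z * (f v)%:C) v) w
   = y * (z * (pders (l ++ l') f w)%:C).
  rewrite pdersCM; last by apply: smC_pdersC; exact: smC_scaled.
  by rewrite -pdersC_cat pdersC_scaled.
have E2 (l l' : seq 'I_(d + d)) (y : R[i]) : pdersC l (fun v => y * pdersC l' (fun v => (h v)%:C) v) w
   = y * (pders (l ++ l') h w)%:C.
  rewrite pdersCM; last by apply: smC_pdersC; exact: smC_real.
  by rewrite -pdersC_cat pdersC_real.
rewrite E1 E2 (gen _ _ abL).
by ring.
Qed.

Lemma sharp_single (F : fsum R d) (g : nat -> V -> R) a j w : sm a -> (forall k, sm (g k)) ->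
  (forall k, F k = fun v => 'i ^- k * (g k v)%:C) ->
  sharp F (fsingle (fun v => (a v)%:C)) j w =
  'i ^- j * (\sum_(s < j.+1) bidiff (j - s - 0) (g s) a w)%:C.
Proof.
move=> sa sg FE; rewrite /sharp rmorph_sum/= mulr_sumr; apply: eq_bigr => s _.
have sj : (s <= j)%N by rewrite -ltnS.
rewrite big_ord_recl [X in _ + X]big1 ?addr0 => [|k _].
  rewrite FE /fsingle /= (bidiff_complex (j - s - 0) ('i ^- s) w (sg s) sa).
  congr (_ * _); rewrite -invfM -exprD; congr (_ ^- _).
  by rewrite subn0 subnKC.
apply: big1 => al _; apply: big1 => be _.
rewrite (_ : fsingle _ (lift ord0 k) = fun=> 0)//.
have D0 l : pdersC l (fun=> 0 : R[i]) = fun=> (0 : R[i]).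
  apply/funext => v; apply: complex_eq => //=;
  by rewrite (pders_cst l 0); case: l.
rewrite [X in _ * X](_ : _ = 0) ?mulr0// pxiE DxE D0.
rewrite (_ : (fun w => _ * 0) = fun=> 0) ?D0//.
by apply/funext => v; rewrite mulr0.
Qed.

Lemma sharp_powE a p : sm a -> forall k,
  sharp_pow (fun v => (a v)%:C) p.+1 k = fun w => 'i ^- k * (sharp_coef a p k w)%:C.
Proof.
move=> sa; rewrite /sharp_pow /=; elim: p => [|p IH] k /=; apply/funext => w.
  rewrite /fsingle; case: eqP => [->|_]; first by rewrite expr0 invr1 mul1r.
  by rewrite mulr0.
apply: sharp_single => // k'.
exact: dmono_sm (single_base_sm sa) _ _ _ _ (sharp_coef_dmono p k' sa).
Qed.

End SharpPowers.

(** * The three series *)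

Section ConcreteFamilies.
Variables (R : realType) (d m : nat) (Mh : nat -> R).
Hypothesis m1 : (1 <= m)%N.
Local Notation V := 'rV[R]_(d + d).
Implicit Types (w : V) (a b : V -> R) (ep : nat -> R).

Lemma dmono_weaken0 (B : nat -> (V -> R) -> Prop) p j X : 0 <= X -> dmono B p j X (fun=> 0).
Proof. by move=> X0; apply: (dmono_le X0); exact: dmono_zero. Qed.

Definition pow_fam a (p i : nat) : V -> R := if i == 0%N then fun w => a w ^+ p else fun=> 0.

Lemma pow_famP a p i : dmono (single_base a) p i ((1 * p%:R) ^+ i) (pow_fam a p i).
Proof.
rewrite /pow_fam mul1r; case: eqP => [->|_].
  by have := dmono_exp p (single_base_dmono a); rewrite muln1 muln0 expr1n expr0.
by apply: dmono_weaken0; exact: exprn_ge0.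
Qed.

Lemma pow_fam_term a p w : fam_term m Mh 0 (pow_fam a) p w = a w ^+ p / Mh p.
Proof.
rewrite /fam_term big_nat_recl//= big1 ?addr0// => i _.
Qed.

Definition pair_base a b (e : nat) (f : V -> R) := (e = 0%N /\ f = a) \/ (e = 1%N /\ f = b).

(** The binomial terms of [(a + b)^p]. As [b] counts as order 1, its exponent [i] is the total
    order, and starting at [i = 1] removes [a^p]. *)
Definition diff_fam a b (p i : nat) : V -> R :=
  fun w => 'C(p, i)%:R * (a w ^+ (p - i) * b w ^+ i).

Lemma bin_le_exp (p i : nat) : ('C(p, i) <= p ^ i)%N.
Proof.
elim: p i => [|p IH] [|i]; rewrite ?bin0//.
rewrite binS; apply: (@leq_trans (p ^ i.+1 + p ^ i)); first by rewrite leq_add.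
by rewrite expnS -mulSnr expnS leq_mul2l leq_expW ?orbT.
Qed.

Lemma diff_famP a b p i : dmono (pair_base a b) p i ((1 * p%:R) ^+ i) (diff_fam a b p i).
Proof.
rewrite mul1r; have [ip|pi] := leqP i p; last first.
  rewrite (_ : diff_fam a b p i = fun=> 0); first by apply: dmono_weaken0; exact: exprn_ge0.
  by apply/funext => w; rewrite /diff_fam bin_small// mul0r.
have da : dmono (pair_base a b) 1 0 1 a.
  by apply: (@dmono_base _ _ (pair_base a b) 0 a [::]); left.
have db : dmono (pair_base a b) 1 1 1 b.
  by apply: (@dmono_base _ _ (pair_base a b) 1 b [::]); right.
have := dmono_scale 'C(p, i)%:R (dmono_mul (dmono_exp (p - i) da) (dmono_exp i db)).
rewrite !muln1 muln0 add0n subnK// !expr1n !mulr1 ger0_norm//.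
by apply: dmono_le; rewrite -natrX ler_nat bin_le_exp.
Qed.

Lemma diff_fam_term a b p w :
  fam_term m Mh 1 (diff_fam a b) p w = ((a w + b w) ^+ p - a w ^+ p) / Mh p.
Proof.
rewrite /fam_term; congr (_ / _).
rewrite exprDn big_ord_recl /= subn0 expr0 mulr1 bin0 mulr1n addrAC subrr add0r.
have pm : (p <= p * m)%N by rewrite leq_pmulr.
rewrite big_add1/= (big_cat_nat _ pm)//= [X in _ + X]big_nat [X in _ + X]big1 ?addr0.
  rewrite big_mkord; apply: eq_bigr => i _.
  by rewrite /diff_fam mulr_natl.
by move=> i /andP[ip _]; rewrite /diff_fam bin_small ?mul0r// ltnS.
Qed.

Definition sharp_full a (p k : nat) : V -> R :=
  match p with 0 => if k == 0%N then fun=> 1 else fun=> 0 | p'.+1 => sharp_coef a p' k end.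

(** The [k]-th term of a sharp power has derivative order [2 k] and is placed there, with zeros at
    odd orders. The numbers [ep k] will be the real or the imaginary parts of [i^-k]. *)
Definition sharp_fam a ep (p i : nat) : V -> R :=
  if odd i then fun=> 0 else fun w => ep i./2 * sharp_full a p i./2 w.

Lemma sharp_full_dmono a p k : sm a ->
  dmono (single_base a) p (2 * k) (((4 ^ d)%:R * p%:R) ^+ (2 * k)) (sharp_full a p k).
Proof.
move=> sa; case: p => [|p] /=.
  case: eqP => [->|_]; first exact: dmono_one.
  by apply: dmono_weaken0; rewrite exprn_ge0// mulr_ge0.
apply: dmono_le (sharp_coef_dmono p k sa).
rewrite exprM -!natrM -!natrX ler_nat leq_expW// expnMn leq_mul2r.
by apply/orP; right; rewrite expnS expn1 leq_pmulr// expn_gt0.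
Qed.

Lemma sharp_famP a ep p i : sm a -> (forall k, `|ep k| <= 1) ->
  dmono (single_base a) p i (((4 ^ d)%:R * p%:R) ^+ i) (sharp_fam a ep p i).
Proof.
move=> sa ep1; rewrite /sharp_fam; case: ifPn => [_|].
  by apply: dmono_weaken0; rewrite exprn_ge0// mulr_ge0.
move=> /even_halfK iE; have := dmono_scale (ep i./2) (sharp_full_dmono p i./2 sa).
rewrite mul2n iE; apply: dmono_le.
by rewrite ler_piMl// exprn_ge0// mulr_ge0.
Qed.

Lemma even_sum (h : nat -> R) (N : nat) :
  \sum_(0 <= i < N.+1) (if odd i then 0 else h i./2) = \sum_(0 <= k < N./2.+1) h k.
Proof.
elim: N => [|N IH]; first by rewrite !big_nat1.
rewrite big_nat_recr//= IH uphalf_half; case: (boolP (odd N)) => oN /=.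
  by rewrite [in RHS]big_nat_recr.
by rewrite addr0.
Qed.

Lemma even_sum_fam a ep p w : \sum_(0 <= i < (p * m).+1) sharp_fam a ep p i w =
  \sum_(0 <= k < (p * m)./2.+1) ep k * sharp_full a p k w.
Proof.
by rewrite -even_sum; apply: eq_bigr => i _; rewrite /sharp_fam; case: ifP.
Qed.

Lemma sharp_fam0 a ep p w : sm a -> sharp_fam a ep p 0 w = ep 0%N * a w ^+ p.
Proof.
move=> sa; rewrite /sharp_fam /= /sharp_full; case: p => [|p]; first by rewrite expr0.
by rewrite sharp_coef0.
Qed.

Lemma sharp_fam_term2 a ep p w : sm a ->
  fam_term m Mh 2 (sharp_fam a ep) p w =
  fam_term m Mh 0 (sharp_fam a ep) p w - ep 0%N * a w ^+ p / Mh p.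
Proof.
move=> sa; rewrite /fam_term -mulrBl; congr (_ / _).
rewrite [in RHS]big_ltn// sharp_fam0// addrAC subrr add0r.
case: (posnP (p * m)) => [->|pm]; first by rewrite !big_geq.
by rewrite [in RHS]big_ltn// /sharp_fam /= add0r.
Qed.

Section Sharp.
Variable a : V -> R.
Hypotheses (sa : sm a) (az : forall l w, (m < size l)%N -> pders l a w = 0).

(** Only the vanishing half of [dmono_eval] matters; the sum of all derivatives of order at most [m]
    at [w] is a crude bound that makes it applicable. *)
Lemma sharp_full_zero p k w : (p * m < 2 * k)%N -> sharp_full a p k w = 0.
Proof.
move=> pk.
have H := @dmono_eval _ _ (single_base a) _ _ _ _ w
  (\sum_(j < m.+1) \sum_(t : j.-tuple 'I_(d + d)) `|pders t a w|) 1 m _ ler01 _ (sharp_full_dmono p k sa).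
apply: (H _ _).2 => //; first by apply: sumr_ge0 => j _; exact: sumr_ge0.
move=> e b l [-> ->]; rewrite add0n expr1n mulr1; split; last exact: az.
have [lm|ml] := leqP (size l) m; last by rewrite az// normr0; apply: sumr_ge0 => j _; exact: sumr_ge0.
rewrite (bigD1 (Ordinal (lm : (size l < m.+1)%N)))//= (bigD1 (in_tuple l))//=.
by rewrite -addrA lerDl addr_ge0 ?sumr_ge0// => j _; exact: sumr_ge0.
Qed.

Lemma sharp_powsumE p w : sharp_powsum (fun v => (a v)%:C) p w =
  \sum_(0 <= k < (p * m)./2.+1) 'i ^- k * (sharp_full a p k w)%:C.
Proof.
rewrite /sharp_powsum; case: p => [|p] /=.
  by rewrite big_nat1 expr0 invr1 mul1r.
rewrite -csum_finite => [|k kN].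
  by congr csum; apply/funext => k; rewrite sharp_powE.
  have -> : sharp_coef a p k w = 0 by apply: (@sharp_full_zero p.+1); lia.
  by rewrite mulr0.
Qed.

Lemma re_sharp_term p w : 
  reC (sharp_powsum (fun v => (a v)%:C) p w / (Mh p)%:C) =
  fam_term m Mh 0 (sharp_fam a (fun k => reC ('i ^- k))) p w.
Proof.
rewrite sharp_powsumE -fmorphV reCM /= mulr0 subr0 /fam_term even_sum_fam; congr (_ * _).
rewrite reC_sum; apply: eq_bigr => k _.
by rewrite reCM /= mulr0 subr0.
Qed.

Lemma im_sharp_term p w : 
  imC (sharp_powsum (fun v => (a v)%:C) p w / (Mh p)%:C) =
  fam_term m Mh 0 (sharp_fam a (fun k => imC ('i ^- k))) p w.
Proof.
rewrite sharp_powsumE -fmorphV imCM /= mulr0 add0r /fam_term even_sum_fam; congr (_ * _).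
rewrite imC_sum; apply: eq_bigr => k _.
by rewrite imCM /= mulr0 add0r.
Qed.

End Sharp.

Lemma re_Vi_le1 k : `|reC ('i ^- k : R[i])| <= 1.
Proof. by apply: (le_trans (reC_le_cabs _)); rewrite cabs_Vi. Qed.

Lemma im_le_cabs (z : R[i]) : `|imC z| <= cabs z.
Proof.
rewrite -(@ler_pXn2r _ 2)// ?nnegrE ?cabs_ge0//.
by rewrite cabsE sqr_sqrtr ?addr_ge0 ?sqr_ge0// real_normK ?num_real// lerDr sqr_ge0.
Qed.

Lemma im_Vi_le1 k : `|imC ('i ^- k : R[i])| <= 1.
Proof. by apply: (le_trans (im_le_cabs _)); rewrite cabs_Vi. Qed.

(** A polynomial symbol of order [m - e]: the missing [e] orders count as already spent. *)
Definition order_base (C : R) (e : nat) b := forall l w,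
  `|pders l b w| <= C * japan w ^+ m * (japan w)^-1 ^+ (e + size l) /\
  ((m < e + size l)%N -> pders l b w = 0).

Lemma order_base_le C C' e b : C <= C' -> order_base C e b -> order_base C' e b.
Proof.
move=> CC' ob l w; have [h1 h2] := ob l w; split=> //; apply: (le_trans h1).
have J0 := ltW (japan_gt0 w).
by rewrite -!mulrA ler_wpM2r// mulr_ge0 ?exprn_ge0 ?invr_ge0.
Qed.

Lemma base_global (Bs : nat -> (V -> R) -> Prop) (C Ck : R) : 1 <= Ck -> 0 <= C ->
  (forall e b, Bs e b -> order_base C e b) ->
  forall w, base_at m Bs (C * japan w ^+ m) (Ck / japan w) w.
Proof.
move=> Ck1 C0 BC w e b l Bb; have [h1 h2] := BC _ _ Bb l w; split=> //.
have J0 := japan_gt0 w; have iJ0 : 0 <= (japan w)^-1 by rewrite invr_ge0 ltW.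
apply: (le_trans h1); rewrite ler_wpM2l ?mulr_ge0 ?exprn_ge0 ?(ltW J0)//.
by rewrite lerXn2r ?nnegrE ?mulr_ge0 ?(le_trans ler01 Ck1)// ler_peMl.
Qed.

(** At total order 0 the bound is [v] with constant 1. At positive order the constant [C / cl], from
    comparing [<w>^m] with [v], is hidden in one of the factors [Ck]. *)
Lemma base_region (Bs : nat -> (V -> R) -> Prop) (C Ck cl v : R) w : 1 <= Ck -> 0 <= C ->
  0 < cl -> C / cl <= Ck -> cl * japan w ^+ m <= v ->
  (forall e b, Bs e b -> order_base C e b) -> (forall b, Bs 0%N b -> `|b w| <= v) ->
  base_at m Bs v (Ck / japan w) w.
Proof.
move=> Ck1 C0 cl0 CCk clv BC B0 e b l Bb; have [h1 h2] := BC _ _ Bb l w; split=> //.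
have J0 := japan_gt0 w; have iJ0 : 0 <= (japan w)^-1 by rewrite invr_ge0 ltW.
have v0 : 0 <= v by apply: le_trans clv; rewrite mulr_ge0 ?exprn_ge0 ?ltW.
have [el|] := posnP (e + size l).
  have /eqP : (e + size l == 0)%N by rewrite el.
  move/eqP; rewrite addn_eq0 => /andP[/eqP e0 /eqP/size0nil l0].
  by rewrite el expr0 mulr1 l0 /=; apply: B0; rewrite -e0.
case: (e + size l)%N h1 h2 => // k h1 h2 _; apply: (le_trans h1).
rewrite exprMn mulrA ler_wpM2r ?exprn_ge0//.
apply: (@le_trans _ _ (v * Ck)); last first.
  by rewrite ler_wpM2l// exprS ler_peMr ?exprn_ege1// (le_trans ler01).
apply: (@le_trans _ _ (v * (C / cl))); last by rewrite ler_wpM2l.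
by rewrite mulrCA ler_wpM2l// mulrC ler_pdivlMl.
Qed.

End ConcreteFamilies.

(** * The four assertions *)

Section Assembly.
Variables (R : realType) (beur : bool) (d : nat) (A M : nat -> R) (rho : R)
    (m : nat) (c : {ffun 'I_(d + d) -> 'I_m.+1} -> R) (B1 s C0 : R) (Mh : nat -> R).
Hypotheses (m1 : (1 <= m)%N) (rho0 : 0 <= rho) (rhos : s^-1 < 1 - rho) (s1 : 1 < s) (C01 : 1 <= C0)
  (Mh0 : forall n, 0 < Mh n) (Mh00 : Mh 0%N = 1)
  (MhC : forall n k, (k <= n)%N ->
     Mh k / ((k * m)`!)%:R `^ s <= C0 ^+ (n - k) * (Mh n / ((n * m)`!)%:R `^ s))
  (A0 : forall p, 0 < A p)
  (Afact : forall h : R, 0 < h -> exists C : R, 0 < C /\ forall p, p`!%:R <= C * h ^+ p * A p)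
  (M0 : forall p, 0 < M p)
  (Mexp : forall t : R, 0 <= t -> exists C, forall p, t ^+ p / M p <= C)
  (grow : if beur then forall X, 0 <= X -> exists L, 0 < L /\ growth s M X L
    else forall X, 0 <= X -> forall L, 0 < L -> growth s M X L).

Local Notation V := 'rV[R]_(d + d).
Implicit Types (w : V) (l : seq 'I_(d + d)).

Let a : V -> R := poly_eval c.
Let a' : V -> R := poly_princ c.
Let b : V -> R := poly_lower c.
Let P := Pser Mh.
Let aC : V -> R[i] := fun w => (a w)%:C.

Let sa : sm a. Proof. exact: poly_sm. Qed.
Let sa' : sm a'. Proof. exact: poly_sm. Qed.
Let sb : sm b. Proof. exact: poly_sm. Qed.

Let aE w : a w = a' w + b w. Proof. exact: poly_split. Qed.

(* The lower order part [b] is counted as a term of order 1. *)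
Lemma order_bases : exists C : R, 1 <= C /\
  [/\ order_base m C 0 a, order_base m C 0 a' & order_base m C 1 b].
Proof.
have [C1 [C11 H1]] := @poly_bound R _ _ c (fun g => (mdeg g <= m)%N) m (fun g h => h).
have [C2 [C21 H2]] := @poly_bound R _ _ c (fun g => mdeg g == m) m
   (fun g h => eq_leq (eqP h)).
have lowdeg (g : {ffun 'I_(d + d) -> 'I_m.+1}) : (mdeg g < m)%N -> (mdeg g <= m.-1)%N.
  by move=> gm; rewrite -ltnS prednK.
have [C3 [C31 H3]] := @poly_bound R _ _ c (fun g => (mdeg g < m)%N) m.-1 lowdeg.
have le1 : C1 <= C1 + C2 + C3 by lra.
have le2 : C2 <= C1 + C2 + C3 by lra.
have le3 : C3 <= C1 + C2 + C3 by lra.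
exists (C1 + C2 + C3); split; first by lra.
split.
- by apply: order_base_le le1 _ => l w; rewrite add0n; exact: H1.
- by apply: order_base_le le2 _ => l w; rewrite add0n; exact: H2.
apply: order_base_le le3 _ => l w; have [h1 h2] := H3 l w.
have Jn : japan w != 0 by rewrite gt_eqF// japan_gt0.
split; last by move=> ml; apply: h2; rewrite -ltnS prednK.
apply: (le_trans h1); rewrite add1n exprS -{2}(prednK m1) exprS.
by rewrite le_eqVlt; apply/orP; left; apply/eqP; field.
Qed.

(* An exponent strictly between [rho] and [1 - 1/s]: it is positive even if
   [rho = 0], which makes the error terms small compared with [P (a w)]. *)
Let rho1 := (rho + (1 - s^-1)) / 2.
Let rho01 : rho < rho1. Proof. by rewrite /rho1 ltr_pdivlMr// mulr2n mulrDr mulr1 ltrD2l ltrBrDr -ltrBrDl. Qed.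
Let rho10 : 0 <= rho1. Proof. exact: le_trans (ltW rho01). Qed.
Let rho1p : 0 < rho1. Proof. exact: le_lt_trans rho01. Qed.
Let rho1s : s^-1 < 1 - rho1.
Proof.
rewrite ltrBrDr -ltrBrDl /rho1 ltr_pdivrMr// mulr2n mulrDr mulr1 ltrD2r.
by rewrite ltrBrDr -ltrBrDl.
Qed.


Section Constants.
Variables (Cv Ck cl B0 : R).
Hypotheses (Cv1 : 1 <= Cv) (Ck1 : 1 <= Ck) (cl0 : 0 < cl) (CvCk : Cv / cl <= Ck)
  (oa : order_base m Cv 0 a) (oa' : order_base m Cv 0 a') (ob : order_base m Cv 1 b)
  (low : forall w, Qc B1 w -> B0 <= japan w ->
     cl * japan w ^+ m <= a w /\ cl * japan w ^+ m <= a' w).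

Let W w := Qc B1 w /\ B0 <= japan w.
Let Cv0 : 0 <= Cv. Proof. exact: le_trans Cv1. Qed.

Lemma pos_a w : W w -> 0 < a w.
Proof.
move=> [h1 h2]; have [h _] := low h1 h2; apply: lt_le_trans h.
by rewrite mulr_gt0// exprn_gt0// japan_gt0.
Qed.

Lemma pos_a' w : W w -> 0 < a' w.
Proof.
move=> [h1 h2]; have [_ h] := low h1 h2; apply: lt_le_trans h.
by rewrite mulr_gt0// exprn_gt0// japan_gt0.
Qed.

Lemma upper_of_order (v : V -> R) w : order_base m Cv 0 v -> `|v w| <= Cv * japan w ^+ m.
Proof. by move=> ov; have [h _] := ov [::] w; rewrite expr0 mulr1 in h. Qed.

Lemma single_order (v : V -> R) : order_base m Cv 0 v ->
  forall e f, single_base v e f -> order_base m Cv e f.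
Proof. by move=> ov e f [-> ->]. Qed.

Lemma pair_order : forall e f, pair_base a' b e f -> order_base m Cv e f.
Proof. by move=> e f [[-> ->]|[-> ->]]. Qed.

Lemma pair_base_sm : forall e f, pair_base a' b e f -> sm f.
Proof. by move=> e f [[_ ->]|[_ ->]]. Qed.

Lemma single_symb_seq (v : V -> R) f e D : sm v -> order_base m Cv 0 v -> 1 <= D ->
  (forall p i, dmono (single_base v) p i ((D * p%:R) ^+ i) (f p i)) ->
  symb_seq M beur (fam_term m Mh e f).
Proof.
move=> sv ov D1 fam; have BG := base_global Ck1 Cv0 (single_order ov).
exact: (fam_symb_seq m1 s1 C01 Mh0 Mh00 MhC grow e (single_base_sm sv) D1 fam Cv1 Ck1 BG).
Qed.

Definition region_bound e (u : nat -> V -> R) (v : V -> R) (C B : R) :=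
  forall w l, W w -> B <= japan w ->
    `|pders l (fseries u) w| <= (C / japan w `^ rho1) ^+ (e + size l) * (4 * P (v w)).

Lemma single_region (v : V -> R) f e D : sm v -> order_base m Cv 0 v ->
  (forall w, W w -> cl * japan w ^+ m <= v w) -> 1 <= D ->
  (forall p i, dmono (single_base v) p i ((D * p%:R) ^+ i) (f p i)) ->
  exists C B, 1 <= C /\ 0 < B /\ region_bound e (fam_term m Mh e f) v C B.
Proof.
move=> sv ov lv D1 fam; have BG := base_global Ck1 Cv0 (single_order ov).
have vpos w : W w -> 0 <= v w.
  by move=> Ww; apply: le_trans (lv w Ww); rewrite mulr_ge0 ?exprn_ge0 ?ltW// japan_gt0.
have v0 w : W w -> 0 <= v w <= Cv * japan w ^+ m.
  by move=> Ww; rewrite vpos//= (le_trans (ler_norm _))// upper_of_order.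
have BW w : W w -> base_at m (single_base v) (v w) (Ck / japan w) w.
  move=> Ww; apply: (base_region Ck1 Cv0 cl0 CvCk (lv w Ww) (single_order ov)).
  by move=> _ [_ ->]; rewrite ger0_norm ?vpos.
have [C [B [C1 [B0' H]]]] := fam_region m1 s1 C01 Mh0 Mh00 MhC M0 Mexp grow e
  (single_base_sm sv) D1 fam Cv1 Ck1 BG rho1s rho10 Cv1 v0 BW.
by exists C, B; split => //; split => // w l Ww Bw; exact: H.
Qed.

Let ereV k : R := reC ('i ^- k).
Let eimV k : R := imC ('i ^- k).
Let D : R := (4 ^ d)%:R.
Let D1 : 1 <= D. Proof. by rewrite /D ler1n expn_gt0. Qed.

Let uP := fam_term m Mh 0 (pow_fam a).
Let uP' := fam_term m Mh 0 (pow_fam a').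
Let uR := fam_term m Mh 0 (sharp_fam a ereV).
Let uI := fam_term m Mh 0 (sharp_fam a eimV).
Let uR2 := fam_term m Mh 2 (sharp_fam a ereV).
Let uI2 := fam_term m Mh 2 (sharp_fam a eimV).
Let uD := fam_term m Mh 1 (diff_fam a' b).

Let famR p i := sharp_famP p i sa (@re_Vi_le1 R).
Let famI p i := sharp_famP p i sa (@im_Vi_le1 R).

Lemma region_bounds : exists C B : R, 1 <= C /\ 0 < B /\
  [/\ region_bound 0 uP a C B, region_bound 0 uP' a' C B, region_bound 1 uD a' C B &
   [/\ region_bound 0 uR a C B, region_bound 0 uI a C B, region_bound 2 uR2 a C B &
       region_bound 2 uI2 a C B]].
Proof.
have la w : W w -> cl * japan w ^+ m <= a w by move=> [h1 h2]; have [] := low h1 h2.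
have la' w : W w -> cl * japan w ^+ m <= a' w by move=> [h1 h2]; have [] := low h1 h2.
have P0 x : 0 <= x -> 0 <= P x.
  by move=> x0; apply: le_trans (Pser_ge1 m1 s1 C01 Mh0 Mh00 MhC x0).
have [Ca [Ba [Ca1 [Ba0 Ha]]]] := single_region 0 sa oa la (lexx 1) (pow_famP a).
have [Cb [Bb [Cb1 [Bb0 Hb]]]] := single_region 0 sa' oa' la' (lexx 1) (pow_famP a').
have [Cr [Br [Cr1 [Br0 Hr]]]] := single_region 0 sa oa la D1 famR.
have [Ci [Bi [Ci1 [Bi0 Hi]]]] := single_region 0 sa oa la D1 famI.
have [Cr2 [Br2 [Cr21 [Br20 Hr2]]]] := single_region 2 sa oa la D1 famR.
have [Ci2 [Bi2 [Ci21 [Bi20 Hi2]]]] := single_region 2 sa oa la D1 famI.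
have [Cd [Bd [Cd1 [Bd0 Hd]]]] : exists C B, 1 <= C /\ 0 < B /\ region_bound 1 uD a' C B.
  have BG := base_global Ck1 Cv0 pair_order.
  have v0 w : W w -> 0 <= a' w <= Cv * japan w ^+ m.
    by move=> Ww; rewrite ltW ?pos_a'//= (le_trans (ler_norm _))// upper_of_order.
  have BW w : W w -> base_at m (pair_base a' b) (a' w) (Ck / japan w) w.
    move=> Ww; apply: (base_region Ck1 Cv0 cl0 CvCk (la' w Ww) pair_order).
    by move=> f [[_ ->]|[]//]; rewrite ger0_norm// ltW// pos_a'.
  have [C [B [C1 [B0' H]]]] := fam_region m1 s1 C01 Mh0 Mh00 MhC M0 Mexp grow 1
    pair_base_sm (lexx 1) (diff_famP a' b) Cv1 Ck1 BG rho1s rho10 Cv1 v0 BW.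
  by exists C, B; split => //; split => // w l Ww Bw; exact: H.
pose C := Ca + Cb + Cr + Ci + Cr2 + Ci2 + Cd.
pose B := Ba + Bb + Br + Bi + Br2 + Bi2 + Bd.
have mono e u v C' B' : (forall w, W w -> 0 < v w) -> 1 <= C' -> C' <= C -> B' <= B ->
    region_bound e u v C' B' -> region_bound e u v C B.
  move=> vp C'1 CC BB H w l Ww Bw; apply: (le_trans (H w l Ww (le_trans BB Bw))).
  have j0 : 0 < japan w `^ rho1 by rewrite powR_gt0// japan_gt0.
  have C'0 : 0 <= C' by exact: le_trans C'1.
  rewrite ler_wpM2r ?mulr_ge0 ?P0 ?(ltW (vp _ Ww))//.
  rewrite lerXn2r ?nnegrE ?divr_ge0 ?(ltW j0)//; first exact: le_trans CC.
  by rewrite ler_wpM2r// invr_ge0 ltW.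
exists C, B; split; first by rewrite /C; lra.
split; first by rewrite /B; lra.
split; last split.
- by apply: mono Ha => //; [exact: pos_a|rewrite /C; lra|rewrite /B; lra].
- by apply: mono Hb => //; [exact: pos_a'|rewrite /C; lra|rewrite /B; lra].
- by apply: mono Hd => //; [exact: pos_a'|rewrite /C; lra|rewrite /B; lra].
- by apply: mono Hr => //; [exact: pos_a|rewrite /C; lra|rewrite /B; lra].
- by apply: mono Hi => //; [exact: pos_a|rewrite /C; lra|rewrite /B; lra].
- by apply: mono Hr2 => //; [exact: pos_a|rewrite /C; lra|rewrite /B; lra].
- by apply: mono Hi2 => //; [exact: pos_a|rewrite /C; lra|rewrite /B; lra].
Qed.

Let az l w : (m < size l)%N -> pders l a w = 0.
Proof. by move=> ml; have [_] := oa l w; apply. Qed.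

Let US n w : R[i] := sharp_powsum aC n w / (Mh n)%:C.
Let S w : R[i] := csum (fun n => US n w).
Let Pa w : R[i] := (P (a w))%:C.
Let Pa' w : R[i] := (P (a' w))%:C.

Let cvP (x : R) : cvgn (series (fun p => x ^+ p / Mh p)).
Proof. exact: (Pser_cvg m1 s1 C01 Mh0 Mh00 MhC). Qed.

Lemma fseries_pow v : fseries (fam_term m Mh 0 (pow_fam v)) = fun w : V => P (v w).
Proof.
apply/funext => w; rewrite /fseries /P /Pser; congr (limn (series _)).
by apply/funext => p; rewrite pow_fam_term.
Qed.

Lemma reUS : reS US = uR.
Proof. by apply/funext => p; apply/funext => w; rewrite /reS /US (re_sharp_term Mh m1 sa az). Qed.

Lemma imUS : imS US = uI.
Proof. by apply/funext => p; apply/funext => w; rewrite /imS /US (im_sharp_term Mh m1 sa az). Qed.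

Lemma reSE : (fun w => reC (S w)) = fseries uR.
Proof. by rewrite -reUS. Qed.

Lemma imSE : (fun w => imC (S w)) = fseries uI.
Proof. by rewrite -imUS. Qed.

Let grP : symb_seq M beur uP. Proof. exact: (single_symb_seq 0 sa oa (lexx 1) (pow_famP a)). Qed.
Let grP' : symb_seq M beur uP'. Proof. exact: (single_symb_seq 0 sa' oa' (lexx 1) (pow_famP a')). Qed.
Let grR : symb_seq M beur uR. Proof. exact: (single_symb_seq 0 sa oa D1 famR). Qed.
Let grI : symb_seq M beur uI. Proof. exact: (single_symb_seq 0 sa oa D1 famI). Qed.

Let smP p : sm (uP p).
Proof. exact: (fam_term_sm m Mh 0 (single_base_sm sa) (pow_famP a)). Qed.
Let smP' p : sm (uP' p).
Proof. exact: (fam_term_sm m Mh 0 (single_base_sm sa') (pow_famP a')). Qed.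
Let smR p : sm (uR p).
Proof. exact: (fam_term_sm m Mh 0 (single_base_sm sa) famR). Qed.
Let smI p : sm (uI p).
Proof. exact: (fam_term_sm m Mh 0 (single_base_sm sa) famI). Qed.

Let lsP : locally_summable uP. Proof. exact: (symb_seq_summable M0 Mexp smP grP). Qed.
Let lsP' : locally_summable uP'. Proof. exact: (symb_seq_summable M0 Mexp smP' grP'). Qed.
Let lsR : locally_summable uR. Proof. exact: (symb_seq_summable M0 Mexp smR grR). Qed.
Let lsI : locally_summable uI. Proof. exact: (symb_seq_summable M0 Mexp smI grI). Qed.

Lemma symb_seq_zero : symb_seq M beur (fun (_ : nat) (_ : V) => 0).
Proof.
have H L : exists K, forall p : nat, symb_bound M L (K * 2 ^- p) (fun _ : V => 0).
  exists 0 => p l w; rewrite (pders_cst l 0).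
  by case: l => [|? ?]; rewrite normr0 !mul0r mulr0 mul0r.
rewrite /symb_seq; case: (beur) => [|L _]; last exact: H.
by exists 1; split => //; exact: H.
Qed.

Lemma symb_seqC_US : symb_seqC M beur US.
Proof.
split; last by rewrite reUS imUS.
move=> k; split.
  by rewrite (_ : (fun _ => _) = uR k); [exact: smR|rewrite -reUS].
by rewrite (_ : (fun _ => _) = uI k); [exact: smI|rewrite -imUS].
Qed.

Lemma symb_seqC_real (u : nat -> V -> R) : (forall k, sm (u k)) -> symb_seq M beur u ->
  symb_seqC M beur (fun k w => (u k w)%:C).
Proof.
move=> su gu; split; first by move=> k; exact: smC_real.
by split; [exact: gu|exact: symb_seq_zero].
Qed.

Lemma fseries_sharp2 ep : locally_summable (fam_term m Mh 0 (sharp_fam a ep)) ->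
  fseries (fam_term m Mh 2 (sharp_fam a ep)) =
  fun w => fseries (fam_term m Mh 0 (sharp_fam a ep)) w - ep 0%N * P (a w).
Proof.
move=> ls; apply/funext => w; rewrite /fseries.
rewrite (_ : (fun k => fam_term m Mh 2 _ k w) = fun k =>
  fam_term m Mh 0 (sharp_fam a ep) k w - ep 0%N * (a w ^+ k / Mh k)); last first.
  by apply/funext => k; rewrite sharp_fam_term2// mulrA.
apply/cvg_lim => //.
rewrite (_ : series _ = fun N => series (fun k => fam_term m Mh 0 (sharp_fam a ep) k w) N -
   ep 0%N * series (fun k => a w ^+ k / Mh k) N); last first.
  by apply/funext => N; rewrite /series /= sumrB mulr_sumr.
apply: cvgB; first exact: locally_summable_cvg.
by apply: cvgMl_tmp; exact: cvP.
Qed.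

Lemma fseries_diff : fseries uD = fun w => P (a w) - P (a' w).
Proof.
apply/funext => w; rewrite /fseries.
rewrite (_ : (fun k => uD k w) = fun k => a w ^+ k / Mh k - a' w ^+ k / Mh k); last first.
  by apply/funext => k; rewrite /uD (diff_fam_term Mh m1) -aE mulrBl.
apply/cvg_lim => //.
rewrite (_ : series _ = fun N => series (fun k => a w ^+ k / Mh k) N -
   series (fun k => a' w ^+ k / Mh k) N); last first.
  by apply/funext => N; rewrite /series /= sumrB.
by apply: cvgB; exact: cvP.
Qed.

Lemma reC_Vi0 : ereV 0 = 1. Proof. by rewrite /ereV expr0 invr1. Qed.
Lemma imC_Vi0 : eimV 0 = 0. Proof. by rewrite /eimV expr0 invr1. Qed.

Lemma fseries_uR2 : fseries uR2 = fun w => fseries uR w - P (a w).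
Proof.
rewrite /uR2 fseries_sharp2; last exact: lsR.
by apply/funext => w; rewrite reC_Vi0 mul1r.
Qed.

(** [i^0] has no imaginary part, so the whole imaginary part of the sharp series belongs to the
    error. *)
Lemma fseries_uI2 : fseries uI2 = fseries uI.
Proof.
rewrite /uI2 fseries_sharp2; last exact: lsI.
by apply/funext => w; rewrite imC_Vi0 mul0r subr0.
Qed.

Let sPa : sm (fun w => P (a w)). Proof. by rewrite -fseries_pow; exact: (fseries_sm lsP). Qed.
Let sPa' : sm (fun w => P (a' w)). Proof. by rewrite -fseries_pow; exact: (fseries_sm lsP'). Qed.
Let sR : sm (fseries uR). Proof. exact: fseries_sm. Qed.
Let sI : sm (fseries uI). Proof. exact: fseries_sm. Qed.
Let sR2 : sm (fseries uR2).
Proof.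
rewrite fseries_uR2 (_ : (fun _ => _) = fun w => 1 * fseries uR w + (-1) * P (a w)).
  exact: sm_lin2.
by apply/funext => w; rewrite mul1r mulN1r.
Qed.
Let sD : sm (fseries uD).
Proof.
rewrite fseries_diff (_ : (fun _ => _) = fun w => 1 * P (a w) + (-1) * P (a' w)).
  exact: sm_lin2.
by apply/funext => w; rewrite mul1r mulN1r.
Qed.

Lemma smS : smC S. Proof. by split; rewrite ?reSE ?imSE. Qed.

Lemma pdersC_S l w : pdersC l S w = csum (fun n => pdersC l (US n) w).
Proof.
apply: complex_eq; rewrite /csum /=.
  rewrite reSE fseries_pders// /fseries; congr (limn (series _)).
  by apply/funext => n; rewrite -reUS.
rewrite imSE fseries_pders// /fseries; congr (limn (series _)).
by apply/funext => n; rewrite -imUS.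
Qed.

(** Convergence of the differentiated real and imaginary series allows [i^-|g|] to be pulled out of
    the sum; its modulus is 1. *)
Lemma csum_Dc (g : 'I_(d + d) -> nat) w :
  cabs (csum (fun n => Dc g (sharp_powsum aC n) w / (Mh n)%:C)) = cabs (pdersC (mi_seq g) S w).
Proof.
have MhC0 n : (Mh n)%:C != 0 :> R[i] by rewrite fmorph_eq0 gt_eqF.
have spE n : sharp_powsum aC n = fun v => (Mh n)%:C * US n v.
  by apply/funext => v; rewrite /US mulrCA divff ?mulr1.
have sU n : smC (US n) by case: symb_seqC_US.
rewrite (_ : (fun n => _) = fun n => 'i ^- (mabs g) * pdersC (mi_seq g) (US n) w).
  rewrite csumM; first by rewrite cabsM cabs_Vi mul1r pdersC_S.
    by have := @locally_summable_cvg _ _ _ w (locally_summable_pders (mi_seq g) lsR); rewrite -reUS.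
  by have := @locally_summable_cvg _ _ _ w (locally_summable_pders (mi_seq g) lsI); rewrite -imUS.
apply/funext => n; rewrite DcE {1}spE pdersCM// -!mulrA; congr (_ * _).
by rewrite mulrC divfK.
Qed.

Lemma cabs_pdersC_le l (F : V -> R[i]) w : cabs (pdersC l F w) <=
  `|pders l (fun v => reC (F v)) w| + `|pders l (fun v => imC (F v)) w|.
Proof. exact: cabs_le. Qed.

Lemma pdersN l (f : V -> R) w : sm f -> `|pders l (fun v => - f v) w| = `|pders l f w|.
Proof.
move=> sf; rewrite (_ : (fun _ => _) = fun v => (-1) * f v); last first.
  by apply/funext => v; rewrite mulN1r.
by rewrite pdersZ// mulN1r normrN.
Qed.

Lemma cabs_Pa_S l w : cabs (pdersC l (fun v => Pa v - S v) w) <=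
  `|pders l (fseries uR2) w| + `|pders l (fseries uI2) w|.
Proof.
apply: (le_trans (cabs_pdersC_le _ _ _)).
have -> : (fun v => reC (Pa v - S v)) = fun v => - fseries uR2 v.
  apply/funext => v; rewrite fseries_uR2 opprB -reSE.
  by rewrite reCD; congr (_ + _); case: (S v).
have -> : (fun v => imC (Pa v - S v)) = fun v => - fseries uI2 v.
  apply/funext => v; rewrite fseries_uI2 -imSE.
  by rewrite imCD /= add0r; case: (S v).
by rewrite !pdersN// fseries_uI2.
Qed.

Lemma cabs_Pa'_S l w : cabs (pdersC l (fun v => Pa' v - S v) w) <=
  `|pders l (fseries uD) w| + (`|pders l (fseries uR2) w| + `|pders l (fseries uI2) w|).
Proof.
apply: (le_trans (cabs_pdersC_le _ _ _)).
have -> : (fun v => reC (Pa' v - S v)) = fun v => (-1) * fseries uD v + (-1) * fseries uR2 v.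
  apply/funext => v; rewrite fseries_uR2 fseries_diff -reSE !mulN1r !opprB addrA subrK.
  by rewrite reCD; congr (_ + _); case: (S v).
have -> : (fun v => imC (Pa' v - S v)) = fun v => - fseries uI2 v.
  apply/funext => v; rewrite fseries_uI2 -imSE.
  by rewrite imCD /= add0r; case: (S v).
rewrite pdersN; last by rewrite fseries_uI2.
rewrite pders_lin2// !mulN1r addrA lerD2r.
by apply: (le_trans (ler_normD _ _)); rewrite !normrN.
Qed.

(** As [e <= 2], [e + L <= 3 (L + 1)], so the constants fit into [(K C^3)^(L+1)]; the exponent
    [rho1] is lowered to [rho]. *)
Lemma absorb_constants (C K J Pv : R) (e L : nat) : 1 <= C -> 1 <= K -> 0 <= Pv -> 1 <= J -> (e <= 2)%N ->
  K * (C / J `^ rho1) ^+ (e + L) * Pv <=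
  (K * C ^+ 3) ^+ (L + 1) * Pv / J `^ (rho * (L + e)%:R).
Proof.
move=> C1 K1 P0 J1 e2.
have eL : (e + L <= 3 * (L + 1))%N by rewrite mulnDr addnC leq_add ?leq_pmull// ltnW.
have J0 : 0 < J by exact: lt_le_trans J1.
have C0' : 0 <= C by exact: le_trans C1.
have K0 : 0 <= K by exact: le_trans K1.
rewrite -[leRHS]mulrAC ler_wpM2r// expr_div_n mulrA.
apply: ler_pM; rewrite ?mulr_ge0 ?invr_ge0 ?exprn_ge0 ?powR_ge0//.
  rewrite exprMn ler_pM ?exprn_ge0//; first by rewrite addn1 exprS ler_peMr// exprn_ege1.
  by rewrite -exprM ler_weXn2l.
rewrite lef_pV2 ?posrE ?exprn_gt0 ?powR_gt0//.
rewrite -powR_mulrn ?powR_ge0// -powRrM [(e + L)%N]addnC.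
by apply: ler_powR => //; rewrite ler_wpM2r// ltW.
Qed.

Lemma region_all : exists C B : R, 1 <= C /\ 0 < B /\ forall w, Qc B w ->
  [/\ W w, C / japan w `^ rho1 <= 4^-1 & forall l, let X e := (C / japan w `^ rho1) ^+ (e + size l) in
   [/\ `|pders l (fun v => P (a v)) w| <= X 0%N * (4 * P (a w)),
       `|pders l (fun v => P (a' v)) w| <= X 0%N * (4 * P (a' w)) &
       `|pders l (fseries uD) w| <= X 1%N * (4 * P (a' w))] /\
   [/\ `|pders l (fseries uR) w| <= X 0%N * (4 * P (a w)),
       `|pders l (fseries uI) w| <= X 0%N * (4 * P (a w)),
       `|pders l (fseries uR2) w| <= X 2%N * (4 * P (a w)) &
       `|pders l (fseries uI2) w| <= X 2%N * (4 * P (a w))]].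
Proof.
have [C [B [C1 [B00 [HP HP' HD [HR HI HR2 HI2]]]]]] := region_bounds.
have C4 : 0 < 4 * C by rewrite mulr_gt0// (lt_le_trans ltr01).
(* Beyond [B4] one order costs at most [1/4], which makes the differences of the three functions
   small against [P]. This relies on [rho1 > 0]. *)
pose B4 := (4 * C) `^ rho1^-1.
have B40 : 0 <= B4 by exact: powR_ge0.
exists C, (`|B1| + `|B0| + B + B4); split => //; split.
  by rewrite ltr_wpDr// ltr_wpDl// addr_ge0.
move=> w Qw; have Jw := Qc_japan Qw.
have hB1 := ler_norm B1; have hB0 := ler_norm B0.
have n1 := normr_ge0 B1; have n0 := normr_ge0 B0.
have Ww : W w.
  split; first by apply: Qc_le Qw; lra.
  by apply: le_trans Jw; lra.
have Bw : B <= japan w by apply: le_trans Jw; lra.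
have J0 : 0 < japan w `^ rho1 by rewrite powR_gt0// japan_gt0.
split => //.
  rewrite ler_pdivrMr// -ler_pdivrMl ?invr_gt0// invrK.
  have -> : 4 * C = B4 `^ rho1 by rewrite /B4 -powRrM mulVf ?gt_eqF// powRr1// ltW.
  apply: ge0_ler_powR; rewrite ?nnegrE ?(ltW (japan_gt0 w))//.
  by apply: le_trans Jw; lra.
move=> l X; split; split; [|  |exact: HD|exact: HR|exact: HI|exact: HR2|exact: HI2].
- by rewrite -(fseries_pow a); exact: HP.
- by rewrite -(fseries_pow a'); exact: HP'.
Qed.

Let P1x x : 0 <= x -> 1 <= P x.
Proof. exact: (Pser_ge1 m1 s1 C01 Mh0 Mh00 MhC). Qed.

Let rho_le1 : rho <= 1.
Proof.
have si : 0 < s^-1 by rewrite invr_gt0 (lt_trans ltr01).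
have := lt_trans si rhos; rewrite subr_gt0; exact: ltW.
Qed.

Lemma growth_P (v : V -> R) : symb_seq M beur (fam_term m Mh 0 (pow_fam v)) ->
  ultrapoly_growth beur M (fun w => P `|v w|).
Proof.
have key L K : 0 <= L -> (forall p, symb_bound M L (K * 2 ^- p) (fam_term m Mh 0 (pow_fam v) p)) ->
  forall h, 3 * L <= h -> exists C, forall w, `|P `|v w| | * expR (- assoc_fun M (h * enorm w)) <= C.
  move=> L0 H h Lh; exists (K * 2 * expR (assoc_fun M (3 * L) + assoc_fun M (3 * 0))) => w.
  have K0 : 0 <= K by have := symb_bound_ge0 (H 0%N); rewrite expr0 invr1 mulr1.
  have e0 := enorm_ge0 w; have j0 := japan_gt0 w.
  set E := expR (assoc_fun M (L * japan w)).
  have bnd p : `| `|v w| ^+ p / Mh p| <= K * E * 2 ^- p.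
    have := H p [::] w; rewrite /= expr0 mulr1 mul1r pow_fam_term.
    by rewrite !normrM !normrX normr_id => h'; apply: (le_trans h'); rewrite mulrAC.
  have [_ Pb] := half_cvg bnd.
  have Mle : assoc_fun M (L * japan w) <=
     assoc_fun M (h * enorm w) + (assoc_fun M (3 * L) + assoc_fun M (3 * 0)).
    (* As [<w> <= 1 + |w|], two summands suffice and the third is set to 0. *)
    have := @assoc_le_sum _ M M0 Mexp (L * japan w) (L * enorm w) L 0.
    move=> h'; rewrite addrA; apply: le_trans (h' _ _ _ _ _) _; rewrite ?mulr_ge0 ?(ltW j0)//.
      rewrite addr0 -[X in _ + X]mulr1 -mulrDr ler_wpM2l// addrC; exact: japan_le.
    by rewrite !lerD2r; apply: ler_assoc; rewrite ?mulr_ge0// mulrA ler_wpM2r.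
  apply: (@le_trans _ _ (K * E * 2 * expR (- assoc_fun M (h * enorm w)))).
    by rewrite ler_wpM2r ?expR_ge0.
  rewrite (_ : K * E * 2 * _ = K * 2 * (E * expR (- assoc_fun M (h * enorm w)))); last by ring.
  rewrite ler_wpM2l ?mulr_ge0// /E -expRD ler_expR.
  by move: Mle; lra.
rewrite /symb_seq /ultrapoly_growth; case: (beur) => [[L [L0 [K H]]]|H h h0].
  exists (3 * L); split; first by rewrite mulr_gt0.
  by apply: (key L K) => //; exact: ltW.
have L0 : 0 < h / 3 by rewrite divr_gt0.
have [K HK] := H _ L0; apply: (key (h / 3) K) => //; first exact: ltW.
by rewrite mulrCA divff ?mulr1.
Qed.

Lemma continuous_P (v : V -> R) : sm v -> continuous (fun w => P `|v w|).
Proof.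
move=> sv w; apply: (@continuous_comp _ _ _ (fun w => `|v w|) P); last exact: (Pser_continuous m1 s1 C01 Mh0 Mh00 MhC).
apply: (@continuous_comp _ _ _ v (fun x : R => `|x|)); last exact: norm_continuous.
exact/differentiable_continuous/(sv [::]).
Qed.

Lemma part_i : continuous (fun w => P `|a w|) /\ ultrapoly_growth beur M (fun w => P `|a w|) /\
   continuous (fun w => P `|a' w|) /\ ultrapoly_growth beur M (fun w => P `|a' w|).
Proof.
split; first exact: continuous_P; split; first exact: growth_P grP.
by split; [exact: continuous_P|exact: growth_P grP'].
Qed.

Lemma part_ii : abs_conv_Gamma beur A M 1 (fun n w => sharp_powsum aC n w / (Mh n)%:C) /\
   abs_conv_Gamma beur A M 1 (fun n w => (a w ^+ n / Mh n)%:C) /\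
   abs_conv_Gamma beur A M 1 (fun n w => (a' w ^+ n / Mh n)%:C).
Proof.
split; first exact: (symb_seqC_abs_conv A0 Afact M0 Mexp symb_seqC_US).
have E v : (fun n (w : V) => (v w ^+ n / Mh n)%:C) =
    fun n w => (fam_term m Mh 0 (pow_fam v) n w)%:C :> R[i].
  by apply/funext => n; apply/funext => w; rewrite pow_fam_term.
rewrite !E; split; apply: (symb_seqC_abs_conv A0 Afact M0 Mexp).
  exact: symb_seqC_real smP grP.
exact: symb_seqC_real smP' grP'.
Qed.

Lemma hypo_real (v : V -> R) (u : nat -> V -> R) (C B : R) :
  (forall k, sm (u k)) -> symb_seq M beur u -> fseries u = (fun w => P (v w)) ->
  1 <= C -> 0 < B -> (forall w, Qc B w -> 0 <= v w) ->
  (forall w l, Qc B w -> `|pders l (fun y => P (v y)) w| <=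
      C ^+ (size l + 1) * P (v w) / japan w `^ (rho * (size l)%:R)) ->
  hypoelliptic beur A M rho (fun w => (P (v w))%:C).
Proof.
move=> su gu uE C1 B00 v0 H.
have sv : sm (fun w => P (v w)) by rewrite -uE; apply: fseries_sm; exact: (symb_seq_summable M0 Mexp su gu).
apply: (hypoelliptic_of_symb A0 Afact M0 Mexp rho_le1 _ _ _ B00 (le_trans ler01 C1) ltr01).
- exact: smC_real.
- by rewrite -uE; exact: (symb_fun_fseries M0 Mexp su gu).
- have := symb_fun_fseries M0 Mexp (u := fun _ _ => 0) (fun _ => sm_cst 0) symb_seq_zero.
  rewrite (_ : fseries _ = fun=> 0)//; apply/funext => w; rewrite /fseries.
  by apply/cvg_lim => //; rewrite (_ : series _ = fun=> 0); [exact: cvg_cst|apply/funext => N; rewrite /series /= big1].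
- move=> w Qw; rewrite cabsR; apply: le_trans (ler_norm _).
  exact: P1x (v0 w Qw).
- move=> l w Qw; rewrite pdersC_real !cabsR [X in _ <= _ * X / _]ger0_norm; first exact: H.
  by apply: le_trans (P1x (v0 w Qw)).
Qed.

Lemma part_iii :
  (exists C B : R, 1 < C /\ 0 < B /\
     forall w, Qc B w -> forall g : 'I_(d + d) -> nat,
       cabs (csum (fun n => Dc g (sharp_powsum aC n) w / (Mh n)%:C))
         <= C ^+ (mabs g + 1) * P (a w) / japan w `^ (rho * (mabs g)%:R) /\
       cabs (Dc g Pa w)
         <= C ^+ (mabs g + 1) * P (a w) / japan w `^ (rho * (mabs g)%:R) /\
       cabs (Dc g (fun v => Pa v - S v) w)
         <= C ^+ (mabs g + 1) * P (a w) / japan w `^ (rho * (mabs g + 2)%:R)) /\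
   hypoelliptic beur A M rho S /\ hypoelliptic beur A M rho Pa.
Proof.
have [C [B [C1 [B00 H]]]] := region_all.
have C3 : 1 <= C ^+ 3 by rewrite exprn_ege1.
have pos w : Qc B w -> 0 < a w by move=> Qw; have [Ww _ _] := H w Qw; exact: pos_a.
have Ppos w : Qc B w -> 1 <= P (a w) by move=> Qw; apply: P1x; rewrite ltW ?pos.
have Ppos0 w : Qc B w -> 0 <= P (a w) by move=> Qw; exact: le_trans (Ppos w Qw).
(* 8 is 4 for the real part plus 4 for the imaginary part. *)
have K8 : 1 <= (8 : R) by rewrite ler1n.
have bS l w : Qc B w -> cabs (pdersC l S w) <=
    (8 * C ^+ 3) ^+ (size l + 1) * P (a w) / japan w `^ (rho * (size l)%:R).
  move=> Qw; have [_ _ /(_ l)[_ [hR hI _ _]]] := H w Qw.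
  have := @absorb_constants C 8 (japan w) (P (a w)) 0 (size l) C1 K8 (Ppos0 w Qw) (japan_ge1 w) isT; rewrite addn0; apply: le_trans.
  apply: (le_trans (cabs_pdersC_le _ _ _)); rewrite reSE imSE.
  by apply: (le_trans (lerD hR hI)); rewrite le_eqVlt; apply/orP; left; apply/eqP; ring.
have bP l w : Qc B w -> `|pders l (fun v => P (a v)) w| <=
    (8 * C ^+ 3) ^+ (size l + 1) * P (a w) / japan w `^ (rho * (size l)%:R).
  move=> Qw; have [_ _ /(_ l)[[hP _ _] _]] := H w Qw.
  have := @absorb_constants C 8 (japan w) (P (a w)) 0 (size l) C1 K8 (Ppos0 w Qw) (japan_ge1 w) isT; rewrite addn0; apply: le_trans.
  apply: (le_trans hP); rewrite mulrA ler_wpM2r ?Ppos0// mulrC ler_wpM2r ?ler_nat// exprn_ge0//.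
  by rewrite divr_ge0 ?powR_ge0// (le_trans ler01).
split; last split.
- exists (8 * C ^+ 3), B; split; first by rewrite (@lt_le_trans _ _ 8) ?ltr1n// ler_peMr.
  split => // w Qw g; rewrite csum_Dc !cabs_Dc -size_mi_seq; split; first exact: bS.
  split; first by rewrite pdersC_real cabsR; exact: bP.
  have [_ _ /(_ (mi_seq g))[_ [_ _ hR2 hI2]]] := H w Qw.
  have := @absorb_constants C 8 (japan w) (P (a w)) 2 (size (mi_seq g)) C1 K8 (Ppos0 w Qw) (japan_ge1 w) isT; apply: le_trans.
  apply: (le_trans (cabs_Pa_S _ _)).
  by apply: (le_trans (lerD hR2 hI2)); rewrite le_eqVlt; apply/orP; left; apply/eqP; ring.
(* The real part of [S] differs from [P(a)] by at most [(1/4)^2 * 4 P(a) = P(a) / 4]. *)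
- have half w : Qc B w -> P (a w) <= 2 * cabs (S w).
    move=> Qw; have [_ h4 /(_ [::])[_ [_ _ hR2 _]]] := H w Qw.
    have := reC_le_cabs (S w); rewrite -[reC _]/((fun w => reC (S w)) w) reSE => hc.
    have {}hR2 : `|fseries uR w - P (a w)| <= (C / japan w `^ rho1) ^+ 2 * (4 * P (a w)).
      by move: hR2; rewrite fseries_uR2.
    have x0 : 0 <= C / japan w `^ rho1 by rewrite divr_ge0 ?powR_ge0// (le_trans ler01).
    have x2 : (C / japan w `^ rho1) ^+ 2 <= 16^-1.
      rewrite (_ : 16^-1 = 4^-1 ^+ 2 :> R); first by rewrite lerXn2r ?nnegrE ?invr_ge0.
      by rewrite exprVn; congr (_^-1); rewrite -natrX.
    have : (C / japan w `^ rho1) ^+ 2 * (4 * P (a w)) <= 16^-1 * (4 * P (a w)).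
      by rewrite ler_wpM2r// mulr_ge0// Ppos0.
    have := Ppos0 w Qw; move: (le_trans (ler_norm _) hc) => hc'.
    by move/ler_normlP: hR2 => [h1 h2]; move: h1 h2; set Z := _ ^+ 2 * _; lra.
  (* Replacing [P(a)] by [2 |S|] doubles the constant 8, and [P(a) >= 1] gives the lower bound
     [1/2]. *)
  apply: (@hypoelliptic_of_symb R d A M beur A0 Afact M0 Mexp rho S B (16 * C ^+ 3) 2^-1 rho_le1 smS) => //.
  + by rewrite reSE; exact: (symb_fun_fseries M0 Mexp smR grR).
  + by rewrite imSE; exact: (symb_fun_fseries M0 Mexp smI grI).
  + by rewrite mulr_ge0// (le_trans ler01).
  + by move=> w Qw; have := half w Qw; have := Ppos w Qw; lra.
  move=> l w Qw; apply: (le_trans (bS l w Qw)).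
  rewrite ler_wpM2r ?invr_ge0 ?powR_ge0//.
  apply: (@le_trans _ _ ((8 * C ^+ 3) ^+ (size l + 1) * (2 * cabs (S w)))).
    by rewrite ler_wpM2l ?half// exprn_ge0// mulr_ge0// (le_trans ler01).
  rewrite mulrA ler_wpM2r ?cabs_ge0//.
  have -> : 16 * C ^+ 3 = (8 * C ^+ 3) * 2 by ring.
  rewrite [leRHS]exprMn ler_wpM2l ?exprn_ge0 ?mulr_ge0 ?(le_trans ler01)//.
  by rewrite addn1 exprS ler_peMr// exprn_ege1// ler1n.
apply: (@hypo_real a uP (8 * C ^+ 3) B) => //.
- exact: fseries_pow.
- by rewrite mulr_ege1.
- by move=> w Qw; rewrite ltW// pos.
by move=> w l; exact: bP.
Qed.

Lemma part_iv :
  (exists C B : R, 1 < C /\ 0 < B /\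
     forall w, Qc B w -> forall g : 'I_(d + d) -> nat,
       cabs (Dc g Pa' w)
         <= C ^+ (mabs g + 1) * P (a' w) / japan w `^ (rho * (mabs g)%:R) /\
       cabs (Dc g (fun v => Pa' v - S v) w)
         <= C ^+ (mabs g + 1) * P (a' w) / japan w `^ (rho * (mabs g + 1)%:R)) /\
   hypoelliptic beur A M rho Pa'.
Proof.
have [C [B [C1 [B00 H]]]] := region_all.
have C3 : 1 <= C ^+ 3 by rewrite exprn_ege1.
have pos w : Qc B w -> 0 < a' w by move=> Qw; have [Ww _ _] := H w Qw; exact: pos_a'.
have Ppos w : Qc B w -> 1 <= P (a' w) by move=> Qw; apply: P1x; rewrite ltW ?pos.
have Ppos0 w : Qc B w -> 0 <= P (a' w) by move=> Qw; exact: le_trans (Ppos w Qw).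
have K8 : 1 <= (8 : R) by rewrite ler1n.
have bP l w : Qc B w -> `|pders l (fun v => P (a' v)) w| <=
    (8 * C ^+ 3) ^+ (size l + 1) * P (a' w) / japan w `^ (rho * (size l)%:R).
  move=> Qw; have [_ _ /(_ l)[[_ hP _] _]] := H w Qw.
  have := @absorb_constants C 8 (japan w) (P (a' w)) 0 (size l) C1 K8 (Ppos0 w Qw) (japan_ge1 w) isT; rewrite addn0; apply: le_trans.
  apply: (le_trans hP); rewrite mulrA ler_wpM2r ?Ppos0// mulrC ler_wpM2r ?ler_nat// exprn_ge0//.
  by rewrite divr_ge0 ?powR_ge0// (le_trans ler01).
split.
- exists (8 * C ^+ 3), B; split; first by rewrite (@lt_le_trans _ _ 8) ?ltr1n// ler_peMr.
  split => // w Qw g; rewrite !cabs_Dc -size_mi_seq; split.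
    by rewrite pdersC_real cabsR; exact: bP.
  have [_ h4 HH] := H w Qw.
  have [[_ _ hD0] _] := HH [::].
  have [[_ _ hD] [_ _ hR2 hI2]] := HH (mi_seq g).
  have := @absorb_constants C 8 (japan w) (P (a' w)) 1 (size (mi_seq g)) C1 K8 (Ppos0 w Qw) (japan_ge1 w) isT; apply: le_trans.
  apply: (le_trans (cabs_Pa'_S _ _)).
  apply: (le_trans (lerD hD (lerD hR2 hI2))).
  set L := size _; set y := C / _.
  have y0 : 0 <= y by rewrite divr_ge0 ?powR_ge0// (le_trans ler01).
  have P'0 := Ppos0 w Qw.
  (* The undifferentiated bound on [P(a) - P(a')] is at most [(1/4) * 4 P(a')]. With it the sharp
     error, of order 2, is restated through [P(a')], one of its two orders being traded for [1/4];
     the total is [4 + 2 + 2 = 8]. *)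
  have Pa2 : P (a w) <= 2 * P (a' w).
    move: hD0; rewrite /= fseries_diff /= addn0 expr1 -/y => /(le_trans (ler_norm _)).
    have : y * (4 * P (a' w)) <= 4^-1 * (4 * P (a' w)) by rewrite ler_wpM2r// mulr_ge0.
    by set Z := y * _; lra.
  have X0 : 0 <= y ^+ (1 + L) by rewrite exprn_ge0.
  have X2 : y ^+ (2 + L) <= 4^-1 * y ^+ (1 + L).
    by rewrite addSn exprS ler_wpM2r.
  have Pa0 : 0 <= P (a w).
    by have [Ww _ _] := H w Qw; apply: le_trans (P1x (ltW (pos_a Ww))).
  have X20 : 0 <= y ^+ (2 + L) by rewrite exprn_ge0.
  have h1 : y ^+ (2 + L) * (4 * P (a w)) <= (4^-1 * y ^+ (1 + L)) * (4 * (2 * P (a' w))).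
    by apply: ler_pM => //; [exact: mulr_ge0|rewrite ler_wpM2l].
  move: h1; rewrite (_ : 4^-1 * _ * _ = 2 * (y ^+ (1 + L) * P (a' w))); last by field.
  rewrite (_ : y ^+ (1 + L) * (4 * P (a' w)) = 4 * (y ^+ (1 + L) * P (a' w))); last by ring.
  rewrite -[8 * _ * _]mulrA.
  by set Z1 := y ^+ (1 + L) * _; set Z2 := y ^+ (2 + L) * _; lra.
apply: (@hypo_real a' uP' (8 * C ^+ 3) B) => //.
- exact: fseries_pow.
- by rewrite mulr_ege1.
- by move=> w Qw; rewrite ltW// pos.
by move=> w l; exact: bP.
Qed.

Lemma conclusion_with_constants :
  (continuous (fun w => P `|a w|) /\ ultrapoly_growth beur M (fun w => P `|a w|) /\
   continuous (fun w => P `|a' w|) /\ ultrapoly_growth beur M (fun w => P `|a' w|)) /\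
  (abs_conv_Gamma beur A M 1 (fun n w => sharp_powsum aC n w / (Mh n)%:C) /\
   abs_conv_Gamma beur A M 1 (fun n w => (a w ^+ n / Mh n)%:C) /\
   abs_conv_Gamma beur A M 1 (fun n w => (a' w ^+ n / Mh n)%:C)) /\
  ((exists C B : R, 1 < C /\ 0 < B /\
     forall w, Qc B w -> forall g : 'I_(d + d) -> nat,
       cabs (csum (fun n => Dc g (sharp_powsum aC n) w / (Mh n)%:C))
         <= C ^+ (mabs g + 1) * P (a w) / japan w `^ (rho * (mabs g)%:R) /\
       cabs (Dc g Pa w)
         <= C ^+ (mabs g + 1) * P (a w) / japan w `^ (rho * (mabs g)%:R) /\
       cabs (Dc g (fun v => Pa v - S v) w)
         <= C ^+ (mabs g + 1) * P (a w) / japan w `^ (rho * (mabs g + 2)%:R)) /\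
   hypoelliptic beur A M rho S /\ hypoelliptic beur A M rho Pa) /\
  ((exists C B : R, 1 < C /\ 0 < B /\
     forall w, Qc B w -> forall g : 'I_(d + d) -> nat,
       cabs (Dc g Pa' w)
         <= C ^+ (mabs g + 1) * P (a' w) / japan w `^ (rho * (mabs g)%:R) /\
       cabs (Dc g (fun v => Pa' v - S v) w)
         <= C ^+ (mabs g + 1) * P (a' w) / japan w `^ (rho * (mabs g + 1)%:R)) /\
   hypoelliptic beur A M rho Pa').
Proof.
split; first exact: part_i; split; first exact: part_ii.
by split; [exact: part_iii|exact: part_iv].
Qed.

End Constants.

End Assembly.

(** * Consequences of the standing assumptions *)

Section StandingAssumptions.
Variable R : realType.
Implicit Types (A M : nat -> R).

(** Factorials are below [A_p], hence below [C L^p M_p], so [t^p / M_p] is at most a constant times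
    [(t L)^p / p!]. *)
Lemma pow_bounded_of_wsub A M : (forall p, 0 < A p) -> (forall p, 0 < M p) ->
  (forall h : R, 0 < h -> exists C : R, 0 < C /\ forall p, p`!%:R <= C * h ^+ p * A p) ->
  wsub A M -> forall t : R, 0 <= t -> exists C, forall p, t ^+ p / M p <= C.
Proof.
move=> A0 M0 Afact [C1 [L1 [C10 [L10 AM]]]] t t0.
have [C2 [C20 C2P]] := Afact 1 ltr01.
exists (C1 * C2 * expR (t * L1)) => p; rewrite ler_pdivrMr//.
apply: (@le_trans _ _ (C1 * C2 * (t * L1) ^+ p / p`!%:R * M p)); last first.
  rewrite ler_wpM2r ?(ltW (M0 p))// -[C1 * C2 * _ / _]mulrA ler_wpM2l ?mulr_ge0 ?(ltW C10) ?(ltW C20)//.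
  rewrite ler_pdivrMr ?ltr0n ?fact_gt0//; apply: exp_le_fact.
  by rewrite mulr_ge0// ltW.
rewrite mulrAC ler_pdivlMr ?ltr0n ?fact_gt0//.
apply: (@le_trans _ _ (t ^+ p * (C2 * 1 ^+ p * A p))).
  by rewrite ler_wpM2l ?exprn_ge0.
rewrite expr1n mulr1 (_ : C1 * C2 * _ * _ = t ^+ p * (C2 * (C1 * L1 ^+ p * M p))); last first.
  by rewrite exprMn; ring.
by rewrite ler_wpM2l ?exprn_ge0// ler_wpM2l// ltW.
Qed.

(** [X + 1] replaces [X] to be positive: in the Roumieu case the bound on [M] is taken with
    [L / (X + 1)] in order to reach a prescribed [L]. *)
Lemma growth_of_bound (s : R) M (X C L : R) : (forall p, 0 < M p) ->
  (forall t : R, 0 <= t -> exists C, forall p, t ^+ p / M p <= C) ->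
  0 <= X -> 0 < C -> 0 < L -> (forall p, M p <= C * L ^+ p * p`!%:R `^ s) ->
  growth s M X ((X + 1) * L).
Proof.
move=> M0 Mexp X0 C0 L0 ML; exists C; split; first exact: ltW.
move=> q t t0; have f0 : (0 : R) < q`!%:R `^ s by rewrite powR_gt0// ltr0n fact_gt0.
have X10 : 0 <= X + 1 by rewrite addr_ge0.
have T0 : 0 <= (X + 1) * L * t by rewrite !mulr_ge0// ltW.
apply: (@le_trans _ _ (C * (((X + 1) * L * t) ^+ q / M q))); last first.
  by rewrite ler_wpM2l ?(ltW C0)//; exact: pow_le_exp_assoc.
rewrite ler_pdivrMr//.
have -> : C * (((X + 1) * L * t) ^+ q / M q) * q`!%:R `^ s =
  ((X + 1) * t) ^+ q * ((C * L ^+ q * q`!%:R `^ s) / M q).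
  by rewrite !exprMn; ring.
apply: (@le_trans _ _ (((X + 1) * t) ^+ q)).
  by rewrite lerXn2r ?nnegrE ?mulr_ge0// ler_wpM2r// lerDl.
by rewrite ler_peMr ?exprn_ge0 ?mulr_ge0// ler_pdivlMr// mul1r.
Qed.

(** [rho0] is the infimum of a set of positive numbers; for an empty set [inf] is 0 by
    convention. *)
Lemma rho_admissible_ge0 A M rho : rho_admissible A M rho -> 0 <= rho.
Proof.
have r0 : 0 <= rho0 A M.
  rewrite /rho0; have [ne|/set0P/negP/negPn/eqP->] := pselect (rho_set A M !=set0); last by rewrite inf0.
  by apply: lb_le_inf => // r [r0 _]; exact: ltW.
by case=> [[_ [h _]]|[_ [h _]]]; [exact: le_trans h|exact: le_trans (ltW h)].
Qed.

End StandingAssumptions.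

Unset Implicit Arguments.

(* beur = true : Beurling case (M_p);  beur = false : Roumieu case {M_p}.
   The polynomial a lives on R^{2d} = 'rV[R]_(d + d), w = (x, xi). *)
Theorem theorem3p6 (R : realType) (beur : bool) (d : nat)
    (A M : nat -> R) (rho : R)
    (m : nat) (c : {ffun 'I_(d + d) -> 'I_m.+1} -> R) (B1 s : R)
    (Mh : nat -> R) :
  (0 < d)%N ->
  standing A M rho ->
  rho < 1 ->
  (2 <= m)%N ->
  elliptic_shubin c ->
  1 <= B1 ->
  (forall w, Qc B1 w -> 0 < poly_eval c w) ->
  1 / (1 - rho) < s ->
  (if beur then wsub M (fun p => (p`!)%:R `^ s)
   else wprec M (fun p => (p`!)%:R `^ s)) ->
  (forall n, 0 < Mh n) -> Mh 0%N = 1 ->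
  (exists C0 : R, 1 <= C0 /\
     forall n k, (k <= n)%N ->
       Mh k / ((k * m)`!)%:R `^ s <= C0 ^+ (n - k) * (Mh n / ((n * m)`!)%:R `^ s)) ->
  let a := poly_eval c in
  let a' := poly_princ c in
  let P := Pser Mh in
  let aC := fun w => (a w)%:C in
  let S := fun w => csum (fun n => sharp_powsum aC n w / (Mh n)%:C) in
  let Pa := fun w => (P (a w))%:C in
  let Pa' := fun w => (P (a' w))%:C in
  (* (i) *)
  (continuous (fun w => P `|a w|) /\ ultrapoly_growth beur M (fun w => P `|a w|) /\
   continuous (fun w => P `|a' w|) /\ ultrapoly_growth beur M (fun w => P `|a' w|)) /\
  (* (ii) *)
  (abs_conv_Gamma beur A M 1 (fun n w => sharp_powsum aC n w / (Mh n)%:C) /\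
   abs_conv_Gamma beur A M 1 (fun n w => (a w ^+ n / Mh n)%:C) /\
   abs_conv_Gamma beur A M 1 (fun n w => (a' w ^+ n / Mh n)%:C)) /\
  (* (iii) *)
  ((exists C B : R, 1 < C /\ 0 < B /\
     forall w, Qc B w -> forall g : 'I_(d + d) -> nat,
       cabs (csum (fun n => Dc g (sharp_powsum aC n) w / (Mh n)%:C))
         <= C ^+ (mabs g + 1) * P (a w) / japan w `^ (rho * (mabs g)%:R) /\
       cabs (Dc g Pa w)
         <= C ^+ (mabs g + 1) * P (a w) / japan w `^ (rho * (mabs g)%:R) /\
       cabs (Dc g (fun v => Pa v - S v) w)
         <= C ^+ (mabs g + 1) * P (a w) / japan w `^ (rho * (mabs g + 2)%:R)) /\
   hypoelliptic beur A M rho S /\ hypoelliptic beur A M rho Pa) /\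
  (* (iv) *)
  ((exists C B : R, 1 < C /\ 0 < B /\
     forall w, Qc B w -> forall g : 'I_(d + d) -> nat,
       cabs (Dc g Pa' w)
         <= C ^+ (mabs g + 1) * P (a' w) / japan w `^ (rho * (mabs g)%:R) /\
       cabs (Dc g (fun v => Pa' v - S v) w)
         <= C ^+ (mabs g + 1) * P (a' w) / japan w `^ (rho * (mabs g + 1)%:R)) /\
   hypoelliptic beur A M rho Pa').
Proof.
move=> d0 st rho1 m2 ell B11 apos srho Mgrow Mh0 Mh00 [C0 [C01 MhC]].
case: st => wA [wM [_ [_ [_ [_ [_ [_ [_ [A3 [_ [AM adm]]]]]]]]]]].
have [_ A0] := wA; have [_ M0] := wM.
have Afact := fact_prec wA A3.
have Mexp := pow_bounded_of_wsub A0 M0 Afact AM.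
have rho0' := rho_admissible_ge0 adm.
have rho1' : 0 < 1 - rho by rewrite subr_gt0.
have s1 : 1 < s.
  by apply: le_lt_trans srho; rewrite ler_pdivlMr// mul1r gerBl.
have s0 : 0 < s by exact: lt_trans s1.
have rhos : s^-1 < 1 - rho.
  by move: srho; rewrite ltr_pdivrMr// mulrC -ltr_pdivrMr// div1r.
have m1 : (1 <= m)%N by exact: leq_trans m2.
have grow : if beur then forall X, 0 <= X -> exists L, 0 < L /\ growth s M X L
    else forall X, 0 <= X -> forall L, 0 < L -> growth s M X L.
  case: (beur) Mgrow => [[C [L [C0' [L0 ML]]]] X X0|Mgrow X X0 L L0].
    exists ((X + 1) * L); split; first by rewrite mulr_gt0// ltr_wpDl.
    exact: (growth_of_bound M0 Mexp X0 C0' L0 ML).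
  have X1 : 0 < X + 1 by rewrite ltr_wpDl.
  have L0' : 0 < L / (X + 1) by rewrite divr_gt0.
  have [C [C0' ML]] := Mgrow _ L0'.
  have := growth_of_bound M0 Mexp X0 C0' L0' ML.
  by rewrite mulrC divfK// gt_eqF.
have [Cv [Cv1 [oa oa' ob]]] := order_bases c m1.
have n0 : (0 < d + d)%N by rewrite addn_gt0 d0.
have [cl [B0 [cl0 [_ low]]]] := elliptic_lower n0 m1 ell apos.
have q0 : 0 <= Cv / cl by rewrite divr_ge0 ?ltW// (lt_le_trans ltr01).
(* The factor per order has to dominate both 1 and [Cv / cl]. *)
have Ck1 : 1 <= 1 + Cv / cl by rewrite lerDl.
have CvCk : Cv / cl <= 1 + Cv / cl by rewrite lerDr.
exact: (conclusion_with_constants m1 rho0' rhos s1 C01 Mh0 Mh00 MhC A0 Afact M0 Mexp grow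
  Cv1 Ck1 cl0 CvCk oa oa' ob low).
Qed.
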